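(* Let $(u_\alpha)_{\alpha>0}$ be a family such that each $u_\alpha$ is a stationary point of $(P_\alpha)$ and $u_\alpha\rightharpoonup\bar u\in U_{ad}$ weakly in $L^2(\Omega)$ for $\alpha\searrow0$. Write $y_\alpha=S(u_\alpha)$, $\bar y=S(\bar u)$, $\bar p=p_{\bar u}$, and $K:=\{x\in\Omega:\bar p(x)=0\}$. Suppose that $\|y_\alpha-\bar y\|_{L^2(\Omega)}=\mathcal O(\alpha)$ for $\alpha\searrow0$. Then there exists a function $w\in L^2(\Omega)$ such that \[ \bar u=P_{U_{ad}}\big(S'(\bar u)^*w\big)\quad\text{pointwise almost everywhere on }K. \] If in addition $\|y_\alpha-\bar y\|_{L^2(\Omega)}=o(\alpha)$ for $\alpha\searrow0$, then $\bar u$ vanishes (almost everywhere) on $K$.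
   Context: Setting. $\Omega\subseteq\mathbb R^n$, $n\le 3$, is a bounded Lipschitz domain. $\mathcal A y=-\sum_{i,j=1}^n\partial_{x_j}[a_{ij}\partial_{x_i}y]$ with $a_{ij}\in C(\bar\Omega)$ and, for some $\lambda_{\mathcal A}>0$, $\lambda_{\mathcal A}|\zeta|^2\le\sum_{i,j}a_{ij}(x)\zeta_i\zeta_j$ for all $\zeta\in\mathbb R^n$ and a.a. $x\in\Omega$; $\mathcal A^*$ is its formal adjoint. $f:\Omega\times\mathbb R\to\mathbb R$ is measurable in $x$ and $C^2$ in $y$; $f',f''$ denote its first and second partial derivatives with respect to $y$, and $f(y)$ means $f(\cdot,y(\cdot))$. Assume: $f(\cdot,0)\in L^{q}(\Omega)$ with $q>n/2$, $q\ge1$; $f'(x,y)\ge0$ for all $y\in\mathbb R$ and a.a. $x$; for every $M>0$ there is $C_{f,M}>0$ with $|f'(x,y)|+|f''(x,y)|\le C_{f,M}$ for a.a. $x$ and $|y|\le M$; for every $M>0,\varepsilon>0$ there is $\delta>0$ with $|f''(x,y_2)-f''(x,y_1)|\le\varepsilon$ for a.a. $x$ whenever $|y_1|,|y_2|\le M$, $|y_2-y_1|\le\delta$. Further $y_d\in L^2(\Omega)\cap L^{q}(\Omega)$, $u_a,u_b\in L^\infty(\Omega)$, $u_a\le u_b$ a.e., and $U_{ad}:=\{u\in L^2(\Omega):u_a\le u\le u_b\text{ a.e.}\}$; $P_{U_{ad}}(v)=\max(u_a,\min(v,u_b))$ pointwise. Let $Y:=H^1_0(\Omega)\cap C(\bar\Omega)$.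 For $u\in L^2(\Omega)$, $y_u=S(u)\in Y$ is the unique weak solution of $\mathcal A y+f(y)=u$ in $\Omega$, $y=0$ on $\partial\Omega$; the map $S:L^2(\Omega)\to Y$ is $C^2$, and $z=S'(u)v$ solves $\mathcal A z+f'(y_u)z=v$ in $\Omega$, $z=0$ on $\partial\Omega$. $S'(u)^*$ is the adjoint of $S'(u)$ as an operator $L^2(\Omega)\to L^2(\Omega)$. The adjoint state $p_u$ is the weak solution of $\mathcal A^*p+f'(y_u)p=y_u-y_d$ in $\Omega$, $p=0$ on $\partial\Omega$. Let $J(u)=\frac12\|y_u-y_d\|_{L^2(\Omega)}^2$, so that $J'(u)v=\int_\Omega p_u v\,dx$. $(P_\alpha)$, $\alpha>0$: minimize $J(u)+\frac\alpha2\|u\|_{L^2(\Omega)}^2$ over $u\in U_{ad}$. A stationary point of $(P_\alpha)$ is $u_\alpha\in U_{ad}$ with $J'(u_\alpha)(u-u_\alpha)+\alpha(u_\alpha,u-u_\alpha)_{L^2(\Omega)}\ge0$ for all $u\in U_{ad}$.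
   Formalization: The second claim fails when 0 is not between the bounds on K (e.g. u_a = u_b = 1, y_d = S(1)); what is proved is that ū = P_{U_ad}(0) a.e. on K, and that ū = 0 a.e. on K if u_a ≤ 0 ≤ u_b a.e. on K, a condition necessary for the claim. *)

(* Defs.v *)
From HB Require Import structures.
From mathcomp Require Import all_boot all_order all_algebra.
From mathcomp Require Import all_classical all_reals all_analysis.
From mathcomp Require Import measurable_realfun lra.
Set Implicit Arguments.
Unset Strict Implicit.
Unset Printing Implicit Defensive.
Import Order.TTheory GRing.Theory Num.Theory.
Import numFieldNormedType.Exports.
Local Open Scope classical_set_scope.
Local Open Scope ring_scope.

HB.instance Definition _ (R : realType) (n : nat) :=
  @isMeasurable.Build (sigma_display (@open 'rV[R]_n)) 'rV[R]_n
    <<s @open 'rV[R]_n >> (@sigma_algebra0 _ setT _) (@sigma_algebraC _ _)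
    (@sigma_algebra_bigcup _ setT _).

Section borel_rV.
Context {R : realType}.

Lemma open_measurable_rV n (A : set 'rV[R]_n) : open A -> measurable A.
Proof. by move=> oA; exact: sub_gen_smallest. Qed.

Lemma measurable_coord n (i : 'I_n) :
  measurable_fun [set: 'rV[R]_n] (fun x : 'rV[R]_n => x ord0 i).
Proof.
apply: (measurability _ (RGenOpens.measurableE R)).
move=> _ [_ [a [b ->] <-]]; rewrite setTI; apply: open_measurable_rV.
apply: open_comp; last exact: interval_open.
by move=> x _; exact: coord_continuous.
Qed.

Let box n (c : {ffun 'I_n -> rat} * rat) : set 'rV[R]_n :=
  [set x | forall i, `|x ord0 i - ratr (c.1 i)| < ratr c.2].

Let open_boxes n (A : set 'rV[R]_n) : open A ->
  A = \bigcup_(c in [set c | box c `<=` A]) box c.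
Proof.
move=> oA; apply/seteqP; split => [x Ax|x [c cA]]; last exact: cA.
have /nbhs_ballP[e /= e0 xeA] : nbhs x A by exact: open_nbhs_nbhs.
have [q] : exists q, ratr q \in `]0, e / 2[%R by apply: rat_in_itvoo; rewrite divr_gt0.
rewrite in_itv/= => /andP[q0 qe].
have /choice[g gx] i : exists p : rat, `|x ord0 i - ratr p| < ratr q.
  have [|p] := @rat_in_itvoo _ (x ord0 i - ratr q) (x ord0 i + ratr q).
    by lra.
  by rewrite in_itv/= => /andP[? ?]; exists p; rewrite ltr_norml; apply/andP; split; lra.
exists ([ffun i => g i], q) => [y /= yb|i /=]; last by rewrite ffunE.
apply: xeA; split => // j i /=; rewrite !ord1 /ball/=.
have := gx i; have := yb i; rewrite ffunE !ltr_norml => /andP[? ?] /andP[? ?].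
by apply/andP; split; lra.
Qed.

Lemma measurable_fun_rV d (T : measurableType d) n (f : T -> 'rV[R]_n) :
  (forall i, measurable_fun setT (fun t => f t ord0 i)) -> measurable_fun setT f.
Proof.
move=> mf; apply: (@measurability _ _ _ _ _ f (@open 'rV[R]_n)) => // _ [A oA <-].
rewrite setTI (open_boxes oA) preimage_bigcup bigcup_mkcond.
apply: countable_bigcupT_measurable => // c; case: ifPn => // _.
rewrite (_ : _ @^-1` _ = \bigcap_i [set t | `|f t ord0 i - ratr (c.1 i)| < ratr c.2]).
  apply: fin_bigcap_measurable => // i _.
  have mh : measurable_fun setT (fun t => `|f t ord0 i - ratr (c.1 i)|).
    by apply: measurableT_comp => //; apply: measurable_funB.
  have := mh measurableT _ (measurable_itv `]-oo, (ratr c.2 : R)[).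
  by rewrite setTI; congr measurable.
by apply/seteqP; split => [t ft i _|t ft i]; [exact: ft|exact: ft].
Qed.

Definition rV_cons n (p : R * 'rV[R]_n) : 'rV[R]_n.+1 :=
  row_mx (p.1%:M : 'rV_1) p.2.

Definition rV_uncons n (x : 'rV[R]_n.+1) : R * 'rV[R]_n :=
  (x ord0 ord0, rsubmx (x : 'rV_(1 + n))).

Lemma rV_cons0 n (p : R * 'rV[R]_n) : rV_cons p ord0 ord0 = p.1.
Proof.
have -> : (ord0 : 'I_n.+1) = lshift n (ord0 : 'I_1) by exact: val_inj.
by rewrite [LHS]row_mxEl mxE eqxx.
Qed.

Lemma rV_consS n (p : R * 'rV[R]_n) i :
  rV_cons p ord0 (lift ord0 i) = p.2 ord0 i.
Proof.
have -> : lift ord0 i = rshift 1 i by exact: val_inj.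
exact: row_mxEr.
Qed.

Lemma rV_consK n : cancel (@rV_cons n) (@rV_uncons n).
Proof.
by move=> [a x]; rewrite /rV_uncons rV_cons0 /rV_cons row_mxKr.
Qed.

Lemma measurable_rV_cons n : measurable_fun setT (@rV_cons n).
Proof.
apply: measurable_fun_rV => i.
have [j ->|->] := unliftP ord0 i.
  under eq_fun do rewrite rV_consS.
  by apply: (measurableT_comp (measurable_coord j)); exact: measurable_snd.
under eq_fun do rewrite rV_cons0.
exact: measurable_fst.
Qed.

Lemma measurable_rV_uncons n : measurable_fun setT (@rV_uncons n).
Proof.
apply: measurable_fun_pair; first exact: measurable_coord.
apply: measurable_fun_rV => i.
under eq_fun do rewrite mxE.
exact: measurable_coord.
Qed.

End borel_rV.

Section lebesgue_rV.
Context {R : realType}.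
Local Open Scope ereal_scope.

Section step.
Variables (n : nat) (mu : {sigma_finite_measure set 'rV[R]_n -> \bar R}).

Definition lebesgue_rV_step : set 'rV[R]_n.+1 -> \bar R :=
  pushforward (@lebesgue_measure R \x mu) (@rV_cons R n).

Let lebesgue_rV_step0 : lebesgue_rV_step set0 = 0.
Proof. by rewrite /lebesgue_rV_step /pushforward preimage_set0 measure0. Qed.

Let lebesgue_rV_step_ge0 A : 0 <= lebesgue_rV_step A.
Proof. by rewrite /lebesgue_rV_step /pushforward. Qed.

Let lebesgue_rV_step_sigma_additive : semi_sigma_additive lebesgue_rV_step.
Proof.
exact: (@measure_semi_sigma_additive _ _ _
  (measure_function_pushforward__canonical__measure_function_Measure
    (@lebesgue_measure R \x mu) (@measurable_rV_cons R n))).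
Qed.

HB.instance Definition _ := isMeasure.Build _ _ _ lebesgue_rV_step
  lebesgue_rV_step0 lebesgue_rV_step_ge0 lebesgue_rV_step_sigma_additive.

Let lebesgue_rV_step_sigma_finite : sigma_finite setT lebesgue_rV_step.
Proof.
have /sigma_finiteP[F [FT ndF mF]] := sigma_finiteT (@lebesgue_measure R).
have /sigma_finiteP[G [GT ndG mG]] := sigma_finiteT mu.
exists (fun k => @rV_uncons R n @^-1` (F k `*` G k)) => [|k].
  rewrite -preimage_bigcup -[LHS](preimage_setT (@rV_uncons R n)).
  congr (_ @^-1` _); apply/seteqP; split => // -[t x] _.
  have [i _ Fit] : (\bigcup_i F i) t by rewrite -FT.
  have [j _ Gjx] : (\bigcup_i G i) x by rewrite -GT.
  exists (maxn i j) => //; split => /=.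
  - by move: t Fit; exact/subsetPset/ndF/leq_maxl.
  - by move: x Gjx; exact/subsetPset/ndG/leq_maxr.
have [mFk Fkoo] := mF k; have [mGk Gkoo] := mG k; split.
  rewrite -[X in measurable X]setTI; apply: measurable_rV_uncons => //.
  exact: measurableX.
rewrite /lebesgue_rV_step /pushforward.
rewrite (_ : _ @^-1` _ = F k `*` G k).
  by rewrite product_measure1E// lte_mul_pinfty// ge0_fin_numE.
by rewrite -comp_preimage (_ : _ \o _ = id)//; apply/funext => p; exact: rV_consK.
Qed.

HB.instance Definition _ := @Measure_isSigmaFinite.Build _ _ _ lebesgue_rV_step
  lebesgue_rV_step_sigma_finite.
End step.

Fixpoint lebesgue_rV (n : nat) : {sigma_finite_measure set 'rV[R]_n -> \bar R} :=
  if n is m.+1 then lebesgue_rV_step (lebesgue_rV m) else dirac (0%R : 'rV[R]_0).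

Lemma lebesgue_rV_box n (a b : 'I_n -> R) : (forall i, (a i <= b i)%R) ->
  lebesgue_rV n [set x | forall i, (a i <= x ord0 i <= b i)%R] =
  \prod_(i < n) (b i - a i)%:E.
Proof.
elim: n a b => [|n IHn] a b ab.
  rewrite big_ord0 /= diracE mem_set// => -[]//.
rewrite big_ord_recl.
transitivity ((@lebesgue_measure R \x lebesgue_rV n) (@rV_cons R n @^-1`
  [set x | forall i, (a i <= x ord0 i <= b i)%R])); first by [].
have -> : @rV_cons R n @^-1` [set x | forall i, (a i <= x ord0 i <= b i)%R] =
    `[a ord0, b ord0]%classic `*` [set x : 'rV[R]_n |
      forall i : 'I_n, (a (lift ord0 i) <= x ord0 i <= b (lift ord0 i))%R].
  apply/seteqP; split => -[t x]/=.
    move=> h; split => [|i]; first by have := h ord0; rewrite in_itv/= rV_cons0.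
    by have := h (lift ord0 i); rewrite rV_consS.
  move=> [+ h] i; rewrite in_itv/= => tab.
  by have [j ->|->] := unliftP ord0 i; rewrite ?rV_cons0 ?rV_consS.
rewrite product_measure1E//; last first.
  rewrite (_ : [set x | _] = \bigcap_i [set x : 'rV[R]_n |
      (a (lift ord0 i) <= x ord0 i <= b (lift ord0 i))%R]).
    apply: fin_bigcap_measurable => // i _.
    have := @measurable_coord R n i measurableT _
      (measurable_itv `[a (lift ord0 i), b (lift ord0 i)]).
    by rewrite setTI; congr measurable.
  by apply/seteqP; split => [t ft i _|t ft i]; exact: ft.
rewrite IHn//; congr (_ * _).
rewrite [LHS](@lebesgue_measure_itv R `[a ord0, b ord0])/= lte_fin lt_neqAle ab andbT.
by case: eqVneq => [->|]//=; rewrite subrr.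
Qed.
End lebesgue_rV.

(* An equivalence class of functions on [Om] is represented by a function on  *)
(* the whole of R^n; only its values on [Om] (on the closure of [Om] for      *)
(* continuous functions) are ever used.                                       *)

(* In a neighbourhood [U] of each boundary point, and in the orthonormal      *)
(* coordinates [x *m Q], the set is the strict epigraph, in the direction of  *)
(* the [k]-th axis, of a Lipschitz function of the other coordinates.         *)
Definition lipschitz_boundary (R : realType) n (A : set 'rV[R]_n) :=
  forall x, (closure A `\` A) x ->
  exists U : set 'rV[R]_n, exists Q : 'M[R]_n, exists k : 'I_n,
  exists g : 'rV[R]_n.-1 -> R, exists L : R,
  [/\ open U, U x, Q *m Q^T = 1%:M, L.-lipschitz g &
    A `&` U = [set y | g (col' k (y *m Q)) < (y *m Q) ord0 k] `&` U].

Record lipschitzDomain (R : realType) (n : nat) := LipschitzDomain {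
  domain_set :> set 'rV[R]_n ;
  domain_open : open domain_set ;
  domain_connected : connected domain_set ;
  domain_nonempty : domain_set !=set0 ;
  domain_bounded : bounded_set domain_set ;
  domain_lipschitz : lipschitz_boundary domain_set }.

Section calculus.
Context {R : realType} {E F : lmodType R}.
(* [U], [V] are subspaces, [nE], [nF] seminorms that are finite on them.      *)
(* Equality in the Hausdorff quotients is equality up to seminorm zero.       *)
Variables (U : set E) (nE : E -> R) (V : set F) (nF : F -> R).

Definition bounded_linear (D : E -> F) :=
  [/\ forall h, U h -> V (D h),
      forall (c : R) h k, U h -> U k ->
        nF (D (c *: h + k) - (c *: D h + D k)) = 0 &
      exists C : R, forall h, U h -> nF (D h) <= C * nE h].

Definition frechet_derivative (S : E -> F) (u : E) (D : E -> F) :=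
  bounded_linear D /\
  forall e : R, 0 < e -> exists2 d : R, 0 < d &
    forall h, U h -> nE h < d -> nF (S (u + h) - S u - D h) <= e * nE h.

Definition bounded_bilinear (B : E -> E -> F) :=
  [/\ forall h k, U h -> U k -> V (B h k),
      forall (c : R) h1 h2 k, U h1 -> U h2 -> U k ->
        nF (B (c *: h1 + h2) k - (c *: B h1 k + B h2 k)) = 0,
      forall (c : R) h k1 k2, U h -> U k1 -> U k2 ->
        nF (B h (c *: k1 + k2) - (c *: B h k1 + B h k2)) = 0 &
      exists C : R, forall h k, U h -> U k -> nF (B h k) <= C * nE h * nE k].

(* [S] is C^2 from [U] to [V], with first derivative [dS]; the derivative of  *)
(* [dS] and the continuity of [d2S] are with respect to operator norms.       *)
Definition C2_with_derivative (S : E -> F) (dS : E -> E -> F) :=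
  (forall u, U u -> frechet_derivative S u (dS u)) /\
  exists d2S : E -> E -> E -> F, forall u, U u ->
  [/\ bounded_bilinear (d2S u),
      forall e : R, 0 < e -> exists2 d : R, 0 < d &
        forall h, U h -> nE h < d -> forall k, U k ->
        nF (dS (u + h) k - dS u k - d2S u h k) <= e * nE h * nE k &
      forall e : R, 0 < e -> exists2 d : R, 0 < d &
        forall h, U h -> nE h < d -> forall k l, U k -> U l ->
        nF (d2S (u + h) k l - d2S u k l) <= e * nE k * nE l].

End calculus.

Section function_spaces.
Context {R : realType} {n : nat}.
Variable Om : lipschitzDomain R n.
Implicit Types (u v y phi : 'rV[R]_n -> R).

Definition lebesgue_on : set 'rV[R]_n -> \bar R :=
  mrestr (lebesgue_rV n) (open_measurable_rV (@domain_open R n Om)).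

HB.instance Definition _ := Measure.on lebesgue_on.

Definition L2 : set ('rV[R]_n -> R) :=
  [set u | u \in Lfun lebesgue_on 2%:E].

Definition L2inner u v : R := \int[lebesgue_on]_(x in Om) (u x * v x).

Definition L2norm u : R := fine ('N[lebesgue_on]_2%:E[EFin \o u])%E.

Definition partial (i : 'I_n) u : 'rV[R]_n -> R :=
  fun x => 'D_(delta_mx ord0 i) u x.

(* All iterated partial derivatives exist and are continuous.                 *)
Definition smooth phi := forall s : seq 'I_n,
  continuous (foldr partial phi s) /\
  forall i x, derivable (foldr partial phi s) x (delta_mx ord0 i).

Definition test_function phi :=
  smooth phi /\ exists K : set 'rV[R]_n,
    [/\ compact K, K `<=` Om & forall x, ~ K x -> phi x = 0].

Definition weak_gradient u (g : 'I_n -> 'rV[R]_n -> R) := forall i, L2 (g i) /\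
  forall phi, test_function phi ->
    L2inner u (partial i phi) = - L2inner (g i) phi.

Definition H1 : set ('rV[R]_n -> R) :=
  [set u | L2 u /\ exists g, weak_gradient u g].

Definition grad u : 'I_n -> 'rV[R]_n -> R := get (weak_gradient u).

Definition H1norm u : R :=
  Num.sqrt (L2norm u ^+ 2 + \sum_(i < n) L2norm (grad u i) ^+ 2).

Definition H10 : set ('rV[R]_n -> R) :=
  [set u | H1 u /\ forall e : R, 0 < e ->
    exists2 phi, test_function phi & H1norm (u - phi) < e].

Definition Y : set ('rV[R]_n -> R) :=
  [set y | H10 y /\ {within closure Om, continuous y}].

Definition Ynorm y : R := H1norm y + sup [set `|y x| | x in closure Om].

End function_spaces.

Section optimal_control.
Context {R : realType} {n : nat}.
Variable Om : lipschitzDomain R n.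
Local Notation mu := (lebesgue_on Om).
Implicit Types (u v w y p : 'rV[R]_n -> R) (f g : 'rV[R]_n -> R -> R).

Definition elliptic_coefficients (a : 'I_n -> 'I_n -> 'rV[R]_n -> R) :=
  (forall i j, {within closure Om, continuous (a i j)}) /\
  exists2 lam : R, 0 < lam & {ae mu, forall x, forall z : 'rV[R]_n,
    lam * (\sum_(i < n) z ord0 i ^+ 2) <=
    \sum_(i < n) \sum_(j < n) a i j x * z ord0 i * z ord0 j}.

Definition admissible_nonlinearity (q : \bar R) f :=
  [/\ (forall t, measurable_fun Om (f ^~ t)) /\
      (forall x, domain_set Om x -> [/\ forall t, derivable (f x) t 1,
         forall t, derivable (derive1 (f x)) t 1 & continuous (derive1n 2 (f x))]),
      (f ^~ 0) \in Lfun mu q,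
      {ae mu, forall x, forall t, 0 <= derive1 (f x) t},
      forall M : R, 0 < M -> exists2 C : R, 0 < C &
        {ae mu, forall x, forall t, `|t| <= M ->
          `|derive1 (f x) t| + `|derive1n 2 (f x) t| <= C} &
      forall M e : R, 0 < M -> 0 < e -> exists2 d : R, 0 < d &
        {ae mu, forall x, forall t1 t2,
          `|t1| <= M -> `|t2| <= M -> `|t2 - t1| <= d ->
          `|derive1n 2 (f x) t2 - derive1n 2 (f x) t1| <= e}].

(* Weak form of [- \sum_ij d_j (a i j d_i y)].                                *)
Definition bilinear_form (a : 'I_n -> 'I_n -> 'rV[R]_n -> R) y v : R :=
  \sum_(i < n) \sum_(j < n)
    L2inner Om (fun x => a i j x * grad Om y i x) (grad Om v j).

(* Weak solution in [Y] of [A y + g(., y) = u] in [Om], [y = 0] on the        *)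
(* boundary, where [A] has coefficients [a].                                  *)
Definition weak_solution (a : 'I_n -> 'I_n -> 'rV[R]_n -> R) g u y :=
  Y Om y /\ forall v, H10 Om v ->
    bilinear_form a y v + L2inner Om (fun x => g x (y x)) v = L2inner Om u v.

Definition control_to_state a f (S : ('rV[R]_n -> R) -> 'rV[R]_n -> R) :=
  forall u, L2 Om u -> weak_solution a f u (S u) /\
    forall y, weak_solution a f u y -> {in Om : set _, y =1 S u}.

Definition linearized f y : 'rV[R]_n -> R -> R :=
  fun x t => derive1 (f x) (y x) * t.

(* The formal adjoint has the transposed coefficients.                        *)
Definition adjoint_state a f yd S (p : ('rV[R]_n -> R) -> 'rV[R]_n -> R) :=
  forall u, L2 Om u ->
    weak_solution (fun i j => a j i) (linearized f (S u)) (S u - yd) (p u).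

Definition L2_adjoint (D Dadj : ('rV[R]_n -> R) -> 'rV[R]_n -> R) :=
  forall w, L2 Om w -> L2 Om (Dadj w) /\
    forall v, L2 Om v -> L2inner Om (D v) w = L2inner Om v (Dadj w).

Definition Uad ua ub : set ('rV[R]_n -> R) :=
  [set u | L2 Om u /\ {ae mu, forall x, ua x <= u x <= ub x}].

Definition proj_Uad ua ub v : 'rV[R]_n -> R :=
  fun x => Num.max (ua x) (Num.min (v x) (ub x)).

Definition objective S yd u : R := 2^-1 * L2norm Om (S u - yd) ^+ 2.

Definition stationary_point S yd ua ub (alpha : R) u :=
  Uad ua ub u /\ exists2 dJ : ('rV[R]_n -> R) -> R,
    frechet_derivative (L2 Om) (L2norm Om) [set: R] Num.norm
      (objective S yd) u dJ &
    forall v, Uad ua ub v -> 0 <= dJ (v - u) + alpha * L2inner Om u (v - u).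

End optimal_control.

(* Main.v *)
(** The operator [D = S'(ubar)] maps L^2 boundedly into continuous functions, so
    by Bessel's inequality it is Hilbert-Schmidt: [D] and its L^2-adjoint [T] are
    compact on L^2, and [T] maps L^1 into L^2. Let [y], [p] be the state and the
    adjoint state of the stationary point for [alpha], let [ybar], [pbar] be those
    of [ubar], and [d = p - pbar]. Testing the adjoint equations with [D v] and
    the linearized equation with [p] and [pbar] gives
      [(v, d) = (D v, w - (f'(y) - f'(ybar)) d)],
      [w = y - ybar - (f'(y) - f'(ybar)) pbar],
    hence [|d - T w| <= C |y - ybar| |d|], and [|d| = O(|y - ybar|)]. This uses a
    uniform bound on the states [y], which comes from a continuation argument: the
    sup norm of [S(ubar + t (u - ubar)) - ybar] is continuous in [t] and, by
    compactness, cannot enter a gap.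

    A stationary point is [P(-p / alpha)], which on [K] equals [P(-d / alpha)].
    If [|y - ybar| = O(alpha)], then [- w / alpha] is bounded; let [l] be its weak
    limit along an ultrafilter refining [alpha -> 0]. By compactness
    [- d / alpha] converges strongly to [T l], and passing to the limit on [K]
    yields [ubar = P(T l)] there. If [|y - ybar| = o(alpha)], the limit is [0]. *)
Require Import Defs.
From HB Require Import structures.
From mathcomp Require Import all_boot all_order all_algebra.
From mathcomp Require Import all_classical all_reals all_analysis.
From mathcomp Require Import measurable_realfun ring lra.
Set Implicit Arguments.
Unset Strict Implicit.
Unset Printing Implicit Defensive.
Import Order.TTheory GRing.Theory Num.Theory.
Import numFieldNormedType.Exports.
Local Open Scope classical_set_scope.
Local Open Scope ring_scope.

(** * Inner product spaces *)

(** The obstacle is that [f] is controlled only on bounded ranges of the state, while weak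
    convergence of the controls says nothing about pointwise values of the states: no Lipschitz
    estimate can start before a uniform bound. The way out is that [S] is differentiable into [Y],
    so [h |-> D h x] is bounded by [C * |h|_2] with one [C] for all points [x]. Summing its squares
    over an orthonormal list and integrating over a domain of finite measure bounds the
    Hilbert-Schmidt sum by [C ^+ 2] times the volume. This yields compactness without any embedding
    theorem. Two encodings shape the lemmas. Functions are not identified almost everywhere, so all
    norms are seminorms, and linearity or uniqueness may hold only up to norm zero. And [grad] is a
    choice among weak gradients, so it is not known to be linear: energy arguments carry a function
    together with an explicitly built gradient, and an equation is tested with a combination through
    its constituents. *)

Lemma discriminant_le0 (R : realType) (a b c : R) : 0 <= a ->
  (forall t, 0 <= a * t ^+ 2 + 2 * b * t + c) -> b ^+ 2 <= a * c.
Proof.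
move=> a0 h; have [az|a1] := eqVneq a 0.
  have [->|b1] := eqVneq b 0; first by rewrite expr0n/= az mul0r.
  (* For [a = 0] and [b != 0] the affine function [2 * b * t + c] takes the value [-1] here. *)
  have := h (- (c + 1) / (2 * b)).
  rewrite az mul0r add0r (_ : _ + _ = -1); last by field.
  by rewrite ler0N1.
have {}a0 : 0 < a by rewrite lt_neqAle eq_sym a1.
have := h (- b / a); rewrite (_ : _ + _ = (a * c - b ^+ 2) / a); last by field.
by rewrite pmulr_lge0 ?invr_gt0// subr_ge0.
Qed.

Lemma ultra_fmap (I J : Type) (f : I -> J) (F : set_system I) :
  UltraFilter F -> UltraFilter (f @ F).
Proof.
move=> UF; have FF : ProperFilter F by exact: ultra_proper.
split => [|G GF FG]; first exact: fmap_proper_filter.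
apply/seteqP; split => [A GA|]; last exact: FG.
have [//|FA] := in_ultra_setVsetC (f @^-1` A) UF.
have : G (~` A) by exact: FG.
by move=> /(filterI GA)/filter_ex[j []].
Qed.

Section prehilbert.
Context {R : realType} {E : lmodType R}.

(** Definiteness is left out: functions are not identified almost everywhere, so [ip x x = 0] does
    not force [x = 0]. Symmetry is asked on all of [E], since the integral of a product is symmetric
    whatever the factors. *)
Record prehilbert (P : set E) (ip : E -> E -> R) : Prop := Prehilbert {
  ph0 : P 0 ;
  ph_lin : forall c x y, P x -> P y -> P (c *: x + y) ;
  ph_sym : forall x y, ip x y = ip y x ;
  ph_ipl : forall c x y z, P x -> P y -> P z ->
    ip (c *: x + y) z = c * ip x z + ip y z ;
  ph_ge0 : forall x, P x -> 0 <= ip x x }.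

Variables (P : set E) (ip : E -> E -> R).
Hypothesis H : prehilbert P ip.
Let nrm x : R := Num.sqrt (ip x x).

Lemma phD x y : P x -> P y -> P (x + y).
Proof. by move=> Px Py; rewrite -(scale1r x); exact: (ph_lin H). Qed.

Lemma phZ c x : P x -> P (c *: x).
Proof. by move=> Px; rewrite -[_ *: _]addr0; apply: (ph_lin H) => //; exact: ph0 H. Qed.

Lemma phN x : P x -> P (- x).
Proof. by rewrite -scaleN1r; exact: phZ. Qed.

Lemma phB x y : P x -> P y -> P (x - y).
Proof. by move=> Px Py; apply: phD => //; exact: phN. Qed.

Lemma ph_sum I (r : seq I) (F : I -> E) :
  (forall i, P (F i)) -> P (\sum_(i <- r) F i).
Proof.
move=> PF; elim: r => [|i r ih]; first by rewrite big_nil; exact: ph0 H.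
by rewrite big_cons; apply: phD.
Qed.

Lemma ipDl x y z : P x -> P y -> P z -> ip (x + y) z = ip x z + ip y z.
Proof. by move=> Px Py Pz; rewrite -{1}(scale1r x) (ph_ipl H)// mul1r. Qed.

Lemma ip0l z : P z -> ip 0 z = 0.
Proof.
move=> Pz; have := ipDl (ph0 H) (ph0 H) Pz.
by rewrite addr0 => /eqP; rewrite -subr_eq0 opprD addrA subrr sub0r oppr_eq0 => /eqP.
Qed.

Lemma ipZl c x z : P x -> P z -> ip (c *: x) z = c * ip x z.
Proof.
by move=> Px Pz; rewrite -[c *: x]addr0 (ph_ipl H)// ?ip0l ?addr0//; exact: ph0 H.
Qed.

Lemma ipNl x z : P x -> P z -> ip (- x) z = - ip x z.
Proof. by move=> Px Pz; rewrite -scaleN1r ipZl// mulN1r. Qed.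

Lemma ipBl x y z : P x -> P y -> P z -> ip (x - y) z = ip x z - ip y z.
Proof. by move=> Px Py Pz; rewrite ipDl ?ipNl//; exact: phN. Qed.

Lemma ipDr x y z : P x -> P y -> P z -> ip z (x + y) = ip z x + ip z y.
Proof. by move=> *; rewrite !(ph_sym H z) ipDl. Qed.

Lemma ipZr c x z : P x -> P z -> ip z (c *: x) = c * ip z x.
Proof. by move=> *; rewrite !(ph_sym H z) ipZl. Qed.

Lemma ipNr x z : P x -> P z -> ip z (- x) = - ip z x.
Proof. by move=> *; rewrite !(ph_sym H z) ipNl. Qed.

Lemma ipBr x y z : P x -> P y -> P z -> ip z (x - y) = ip z x - ip z y.
Proof. by move=> *; rewrite !(ph_sym H z) ipBl. Qed.

Lemma ip_suml I (r : seq I) (F : I -> E) z : (forall i, P (F i)) -> P z ->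
  ip (\sum_(i <- r) F i) z = \sum_(i <- r) ip (F i) z.
Proof.
move=> PF Pz; elim: r => [|i r ih]; first by rewrite !big_nil ip0l.
by rewrite !big_cons ipDl ?ih//; exact: ph_sum.
Qed.

Lemma ip_sqD t x y : P x -> P y ->
  ip (t *: x + y) (t *: x + y) = ip x x * t ^+ 2 + 2 * ip x y * t + ip y y.
Proof.
move=> Px Py; have Ptx := phZ t Px.
rewrite ipDl// ?ipDr// ?ipZl// ?ipZr// ?(ph_sym H y x); [ring|exact: phD..].
Qed.

Lemma cauchy_schwarz_sq x y : P x -> P y -> ip x y ^+ 2 <= ip x x * ip y y.
Proof.
move=> Px Py; apply: discriminant_le0 => [|t]; first exact: (ph_ge0 H).
by rewrite -ip_sqD//; apply: (ph_ge0 H); exact: (ph_lin H).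
Qed.

Lemma nrm_ge0 x : 0 <= nrm x. Proof. exact: sqrtr_ge0. Qed.

Lemma nrm_sq x : P x -> nrm x ^+ 2 = ip x x.
Proof. by move=> Px; rewrite sqr_sqrtr//; exact: (ph_ge0 H). Qed.

Lemma cauchy_schwarz x y : P x -> P y -> `|ip x y| <= nrm x * nrm y.
Proof.
move=> Px Py; rewrite -(@ler_pXn2r _ 2)// ?nnegrE ?mulr_ge0 ?nrm_ge0//.
by rewrite exprMn !nrm_sq// -normrX ger0_norm ?sqr_ge0//; exact: cauchy_schwarz_sq.
Qed.

Lemma nrm_triangle x y : P x -> P y -> nrm (x + y) <= nrm x + nrm y.
Proof.
move=> Px Py; rewrite -(@ler_pXn2r _ 2)// ?nnegrE ?addr_ge0 ?nrm_ge0//.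
have := cauchy_schwarz Px Py; have := ler_norm (ip x y).
have := nrm_sq Px; have := nrm_sq Py.
have := nrm_sq (phD Px Py); have := ip_sqD 1 Px Py; rewrite scale1r => -> ->.
by nra.
Qed.

Lemma nrmZ c x : P x -> nrm (c *: x) = `|c| * nrm x.
Proof.
move=> Px; rewrite /nrm ipZl ?ipZr//; last exact: phZ.
by rewrite mulrA -expr2 sqrtrM ?sqr_ge0// sqrtr_sqr.
Qed.

Lemma nrmN x : P x -> nrm (- x) = nrm x.
Proof. by move=> Px; rewrite -scaleN1r nrmZ// normrN normr1 mul1r. Qed.

Lemma nrm0 : nrm 0 = 0.
Proof. by rewrite /nrm ip0l ?sqrtr0//; exact: ph0 H. Qed.

Lemma nrm_distC x y : P x -> P y -> nrm (x - y) = nrm (y - x).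
Proof. by move=> Px Py; rewrite -opprB nrmN//; exact: phB. Qed.

Definition nrm_complete := forall u : nat -> E, (forall k, P (u k)) ->
  (forall e : R, 0 < e -> exists N, forall i j, (N <= i)%N -> (N <= j)%N ->
     nrm (u i - u j) <= e) ->
  exists2 l, P l & forall e : R, 0 < e -> exists N, forall i, (N <= i)%N ->
     nrm (u i - l) <= e.

Lemma ltr_invS_exists (e : R) : 0 < e -> exists N, forall i, (N <= i)%N -> i.+1%:R^-1 <= e.
Proof.
move=> e0; exists (Num.truncn e^-1) => i Ni.
rewrite -[leRHS]invrK lef_pV2 ?posrE ?invr_gt0//.
apply/ltW/(lt_le_trans (truncnS_gt _)); by rewrite ler_nat ltnS.
Qed.

(** [w] is the limit of a minimizing sequence of [Phi]. By the parallelogram identity, [|x - y|^2]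
    equals [2 Phi x + 2 Phi y - 4 Phi m] with [m] the midpoint, and [Phi m >= inf A] makes the
    sequence Cauchy. *)
Lemma riesz_representation (l : E -> R) (C : R) : nrm_complete ->
  (forall c x y, P x -> P y -> l (c *: x + y) = c * l x + l y) ->
  (forall x, P x -> `|l x| <= C * nrm x) ->
  exists2 w, P w & forall v, P v -> l v = ip w v.
Proof.
move=> cmp llin lC.
pose Phi v := ip v v - 2 * l v.
have PhiE t x y : P x -> P y ->
    Phi (t *: x + y) = ip x x * t ^+ 2 + 2 * (ip x y - l x) * t + Phi y.
  by move=> Px Py; rewrite /Phi ip_sqD// llin//; ring.
have Phi_lb v : P v -> - C ^+ 2 <= Phi v.
  move=> Pv; have := lC _ Pv; have := ler_norm (l v); have := nrm_sq Pv.
  rewrite /Phi; have : 0 <= (nrm v - C) ^+ 2 by exact: sqr_ge0.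
  by nra.
pose A := [set Phi v | v in P].
have A0 : A !=set0 by exists (Phi 0), 0 => //; exact: ph0 H.
have Alb : has_lbound A by exists (- C ^+ 2) => _ [v Pv <-]; exact: Phi_lb.
have infA v : P v -> inf A <= Phi v by move=> Pv; apply: ge_inf => //; exists v.
have /choice[v_ v_P] (k : nat) : exists v, P v /\ Phi v <= inf A + k.+1%:R^-1.
  have [_ [v Pv <-] lev] := @inf_adherent _ A k.+1%:R^-1 ltac:(by rewrite invr_gt0) (conj A0 Alb).
  by exists v; split => //; exact: ltW.
have Pv k := (v_P k).1; have vlt k := (v_P k).2.
have cau i j : ip (v_ i - v_ j) (v_ i - v_ j) <= 2 * (i.+1%:R^-1 + j.+1%:R^-1).
  have E1 : v_ i = 1 *: (v_ i - v_ j) + v_ j by rewrite scale1r subrK.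
  have := PhiE 1 _ _ (phB (Pv i) (Pv j)) (Pv j); rewrite -E1.
  have := PhiE 2^-1 _ _ (phB (Pv i) (Pv j)) (Pv j).
  have := infA _ (ph_lin H 2^-1 (phB (Pv i) (Pv j)) (Pv j)).
  have := vlt i; have := vlt j; move: (Phi _) (Phi _) (Phi _) (i.+1%:R^-1) (j.+1%:R^-1).
  move=> a b c ri rj; rewrite expr1n expr2.
  move: (ip (_ - _) _) (ip (_ - _) (_)) (l _) => x y z.
  lra.
have [|w Pw wlim] := cmp v_ Pv.
  move=> e e0.
  have [|N hN] := @ltr_invS_exists (e ^+ 2 / 4).
    by rewrite divr_gt0// exprn_gt0.
  exists N => i j Ni Nj.
  rewrite -(@ler_pXn2r _ 2)// ?nnegrE ?nrm_ge0 ?(ltW e0)//.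
  rewrite nrm_sq; last exact: phB.
  have := cau i j; have := hN _ Ni; have := hN _ Nj.
  by move: (i.+1%:R^-1) (j.+1%:R^-1) => ri rj; lra.
exists w => // v Pv'; apply/esym/eqP; rewrite -subr_eq0 -normr_le0.
(* For every [t], [Phi (t *: v + v_ k) >= inf A >= Phi (v_ k) - k.+1%:R^-1]: a quadratic in [t] that
   stays nonnegative, whose discriminant is the claim. *)
have key k : (ip v (v_ k) - l v) ^+ 2 <= ip v v * k.+1%:R^-1.
  apply: discriminant_le0 => [|t]; first exact: (ph_ge0 H).
  have := infA _ (ph_lin H t Pv' (Pv k)); rewrite PhiE//.
  by have := vlt k; move: (_ * t ^+ 2) (_ * t) (Phi _) (k.+1%:R^-1) => *; lra.
apply/ler_addgt0Pr => e e0; rewrite add0r.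
pose M := nrm v + 1; have M0 : 0 < M by rewrite ltr_wpDl// nrm_ge0.
have [N1 hN1] := wlim (e / 2 / M) ltac:(by rewrite !divr_gt0).
have [|N2 hN2] := @ltr_invS_exists ((e / 2 / M) ^+ 2).
  by rewrite exprn_gt0// !divr_gt0.
pose k := maxn N1 N2.
have h1 := hN1 k (leq_maxl _ _); have h2 := hN2 k (leq_maxr _ _).
have -> : ip w v - l v = (ip v (v_ k) - l v) - ip (v_ k - w) v.
  by rewrite ipBl// (ph_sym H v (v_ k)); ring.
apply: (le_trans (ler_normB _ _)); rewrite [e]splitr; apply: lerD.
  rewrite -(@ler_pXn2r _ 2)// ?nnegrE ?divr_ge0 ?(ltW e0)//.
  rewrite -normrX ger0_norm ?sqr_ge0//; apply: (le_trans (key k)).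
  have -> : (e / 2) ^+ 2 = M ^+ 2 * (e / 2 / M) ^+ 2.
    by rewrite -exprMn; congr (_ ^+ 2); field; rewrite gt_eqF.
  rewrite -nrm_sq//; apply: ler_pM => //; rewrite ?sqr_ge0 ?invr_ge0//.
  by rewrite ler_pXn2r// ?nnegrE ?nrm_ge0 ?(ltW M0)// lerDl.
apply: (le_trans (cauchy_schwarz _ _)) => //; first exact: phB.
have -> : e / 2 = e / 2 / M * M by field; rewrite gt_eqF.
by apply: ler_pM; rewrite ?nrm_ge0// lerDl.
Qed.

(** Each [ip (q i) v] stays in a compact segment, so along an ultrafilter it converges, for all [v]
    at once and with no diagonal extraction. The limits form a bounded linear functional, which
    Riesz represents. *)
Lemma ultra_weak_limit (I : Type) (F : set_system I) (q : I -> E) (C : R) :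
  UltraFilter F -> nrm_complete -> (forall i, P (q i)) ->
  (\forall i \near F, nrm (q i) <= C) ->
  exists2 w, P w & forall v, P v -> ip (q i) v @[i --> F] --> ip w v.
Proof.
move=> UF cmp Pq qC.
have FF : ProperFilter F by exact: ultra_proper.
have C0 : 0 <= C.
  by have [i iC] := filter_ex qC; exact: le_trans (nrm_ge0 _) iC.
have cv v : P v -> exists l : R, ip (q i) v @[i --> F] --> l.
  move=> Pv; pose M := C * nrm v.
  have := @segment_compact R (- M) M; rewrite compact_ultra => Mcpt.
  have : (ip (q i) v @[i --> F]) `[- M, M]%classic.
    rewrite /= ; near=> i; rewrite /= in_itv/= -ler_norml.
    apply: (le_trans (cauchy_schwarz _ _)) => //.
    by apply: ler_wpM2r; [exact: nrm_ge0|near: i].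
  have UG : UltraFilter (ip (q i) v @[i --> F]) by exact: ultra_fmap.
  by move=> /(Mcpt _ UG)[l [_ ?]]; exists l.
pose l v := lim (ip (q i) v @[i --> F]).
have lcv v : P v -> ip (q i) v @[i --> F] --> l v.
  by move=> /cv[b vb]; rewrite /l (cvg_lim _ vb).
have [| |w Pw wl] := @riesz_representation l C cmp.
- move=> c x y Px Py; apply/cvg_lim => //.
  under eq_fun do rewrite (ph_sym H) (ph_ipl H)// ?(ph_sym H x) ?(ph_sym H y).
  by apply: cvgD; [apply: cvgMr|]; exact: lcv.
- move=> v Pv.
  have h : `|ip (q i) v| @[i --> F] --> `|l v| by apply: cvg_norm; exact: lcv.
  have -> : `|l v| = lim (`|ip (q i) v| @[i --> F]) by rewrite (cvg_lim _ h).
  apply: limr_le; first by apply/cvg_ex; exists `|l v|.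
  near=> i; apply: (le_trans (cauchy_schwarz _ _)) => //.
  by apply: ler_wpM2r; [exact: nrm_ge0|near: i].
- by exists w => // v Pv; rewrite -wl//; exact: lcv.
Unshelve. all: by end_near. Qed.

Definition orthonormal (es : seq E) := forall i j, (i < size es)%N -> (j < size es)%N ->
  ip es`_i es`_j = (i == j)%:R.

(** Take a finite orthonormal [es] whose Hilbert-Schmidt sum is within [e ^+ 2] of the supremum over
    all such lists. A unit vector [y] orthogonal to [es] can be appended, so [nrm (D y) <= e]. Hence
    [D] is [e]-close to a map of finite rank, and no orthonormal basis is required. *)
Lemma hilbert_schmidt_approx (D : E -> E) (B : R) :
  (forall x, P x -> P (D x)) ->
  (forall c x y, P x -> P y -> nrm (D (c *: x + y) - (c *: D x + D y)) = 0) ->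
  (exists C, forall x, P x -> nrm (D x) <= C * nrm x) ->
  (forall es : seq E, (forall i, P es`_i) -> orthonormal es ->
     \sum_(i < size es) nrm (D es`_i) ^+ 2 <= B) ->
  forall e : R, 0 < e -> exists2 es : seq E, (forall i, P es`_i) &
    forall x, P x -> nrm (D x) <=
      \sum_(i < size es) `|ip x es`_i| * nrm (D es`_i) + e * nrm x.
Proof.
move=> PD Dlin [C DC] HS e e0.
pose good (es : seq E) := (forall i, P es`_i) /\ orthonormal es.
pose A := [set \sum_(i < size es) nrm (D es`_i) ^+ 2 | es in good].
have g0 : good [::] by split => [i|[]//]; rewrite nth_nil; exact: ph0 H.
have A0 : A !=set0 by exists (\sum_(i < 0) nrm (D [::]`_i) ^+ 2), [::].
have Aub : has_ubound A by exists B => _ [es [Pes oes] <-]; exact: HS.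
have [_ [es [Pes oes] <-] les] := @sup_adherent _ A (e ^+ 2) (exprn_gt0 _ e0) (conj A0 Aub).
exists es => // x Px.
pose s := \sum_(i < size es) ip x es`_i *: es`_i.
have Ps : P s by apply: ph_sum => i; exact: phZ.
pose x' := x - s; have Px' : P x' by exact: phB.
have ox' (i : 'I_(size es)) : ip x' es`_i = 0.
  rewrite /x' ipBl// /s ip_suml//; last by move=> j; exact: phZ.
  rewrite (bigD1 i)//= ipZl// oes// eqxx mulr1 big1 ?addr0 ?subrr// => j ji.
  by rewrite ipZl// oes//; have /negbTE -> : (j != i :> nat) by []; rewrite mulr0.
have nx' : nrm x' <= nrm x.
  rewrite /nrm ler_wsqrtr//.
  have xs : ip x' s = 0.
    rewrite (ph_sym H) ip_suml//; last by move=> j; exact: phZ.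
    by rewrite big1// => i _; rewrite ipZl// (ph_sym H _ x') ox' mulr0.
  have -> : ip x x = ip x' x' + ip s s.
    have -> : x = 1 *: x' + s by rewrite scale1r subrK.
    by rewrite ip_sqD// xs; ring.
  by rewrite lerDl; exact: (ph_ge0 H).
have Dx' : nrm (D x') <= e * nrm x'.
  have [x'0|x'0] := eqVneq (nrm x') 0.
    by have := DC _ Px'; rewrite x'0 !mulr0.
  have x'p : 0 < nrm x' by rewrite lt_neqAle eq_sym x'0 nrm_ge0.
  pose y := (nrm x')^-1 *: x'.
  have Py : P y by exact: phZ.
  have Dy : nrm (D x') = nrm x' * nrm (D y).
    (* [D] is linear only up to norm zero, so homogeneity is recovered by one triangle inequality in
       each direction. *)
    have -> : nrm (D x') = nrm (nrm x' *: D y).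
      have := Dlin (nrm x') y 0 Py (ph0 H).
      rewrite addr0 {1}/y scalerA divff// scale1r => h.
      have D0 : nrm (D 0) = 0.
        by apply/eqP; rewrite eq_le nrm_ge0 andbT (le_trans (DC _ (ph0 H)))// nrm0 mulr0.
      apply/eqP; rewrite eq_le; apply/andP; split.
        rewrite -[D x'](subrK (nrm x' *: D y + D 0)).
        have PZ := phZ (nrm x') (PD _ Py); have PD0 := PD _ (ph0 H).
        apply: (le_trans (nrm_triangle _ _)).
        - by apply: phB; [exact: PD|exact: phD].
        - exact: phD.
        by rewrite h add0r (le_trans (nrm_triangle _ _))// D0 addr0.
      rewrite -[nrm x' *: D y](addrK (D 0)) -[X in nrm (X - _)](subrK (D x')).
      have PZ := phZ (nrm x') (PD _ Py); have PD0 := PD _ (ph0 H).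
      have PX := PD _ Px'.
      rewrite -addrA; apply: (le_trans (nrm_triangle _ _)).
      - by apply: phB => //; exact: phD.
      - exact: phB.
      rewrite nrm_distC ?h ?add0r//; last exact: phD.
      by apply: (le_trans (nrm_triangle _ _)) => //; [exact: phN|rewrite nrmN// D0 addr0].
    by rewrite nrmZ ?ger0_norm ?nrm_ge0//; exact: PD.
  rewrite Dy mulrC ler_pM2r//.
  have gy : good (rcons es y).
    split => [i|i j].
      rewrite nth_rcons; case: ifP => // _; case: ifP => // _; exact: ph0 H.
    have yy : ip y y = 1.
      by rewrite ipZl// ipZr// -nrm_sq//; field.
    have ye k : (k < size es)%N -> ip y es`_k = 0.
      by move=> kes; rewrite ipZl// (ox' (Ordinal kes)) mulr0.
    rewrite size_rcons !ltnS !nth_rcons.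
    rewrite [(i <= _)%N]leq_eqVlt [(j <= _)%N]leq_eqVlt.
    move=> /predU1P[->|ies] /predU1P[->|jes]; rewrite ?ltnn ?eqxx ?ies ?jes//.
    - by rewrite ye// gtn_eqF.
    - by rewrite (ph_sym H) ye// ltn_eqF.
    - exact: oes.
  have : \sum_(i < size (rcons es y)) nrm (D (rcons es y)`_i) ^+ 2 <= sup A.
    by apply: ub_le_sup => //; exists (rcons es y).
  rewrite size_rcons big_ord_recr/= nth_rcons ltnn eqxx.
  under eq_bigr do rewrite nth_rcons ltn_ord.
  move=> h; rewrite -(@ler_pXn2r _ 2)// ?nnegrE ?nrm_ge0 ?(ltW e0)//.
  by move: les h; lra.
have Dsum : forall m (c : nat -> R), (m <= size es)%N ->
    nrm (D (\sum_(i < m) c i *: es`_i)) <= \sum_(i < m) `|c i| * nrm (D es`_i).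
  elim=> [c _|m ih c mes].
    by rewrite !big_ord0 (le_trans (DC _ (ph0 H)))// nrm0 mulr0.
  rewrite !big_ord_recr/= addrC.
  set t := \sum_(i < m) _ *: _.
  have Pt : P t by apply: ph_sum => i; exact: phZ.
  rewrite -[D _](subrK (c m *: D es`_m + D t)).
  have PZ := phZ (c m) (PD _ (Pes m)).
  apply: (le_trans (nrm_triangle _ _)).
  - by apply: phB; [apply: PD; exact: (ph_lin H)|apply: phD => //; exact: PD].
  - by apply: phD => //; exact: PD.
  rewrite Dlin// add0r (le_trans (nrm_triangle _ _))//; first exact: PD.
  by rewrite nrmZ; [rewrite addrC lerD// ih// ltnW|exact: PD].
have -> : x = 1 *: s + x' by rewrite scale1r addrC subrK.
rewrite -[D _](subrK (1 *: D s + D x')).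
have Ds := PD _ Ps; have Dx'P := PD _ Px'.
apply: (le_trans (nrm_triangle _ _)).
- by apply: phB; [apply: PD; exact: (ph_lin H)|rewrite scale1r; exact: phD].
- by rewrite scale1r; exact: phD.
rewrite Dlin// add0r scale1r (le_trans (nrm_triangle _ _))//.
apply: lerD; last first.
  by apply: (le_trans Dx'); rewrite ler_pM2l// scale1r addrC subrK.
have -> : 1 *: s + x' = x by rewrite scale1r addrC subrK.
exact: (Dsum _ (fun i => ip x es`_i)).
Qed.

(** The finite sum tends to 0 by weak convergence, and the rest is small because [h] stays
    bounded. *)
Lemma hilbert_schmidt_compact (D : E -> E) (I : Type) (F : set_system I)
    (FF : Filter F) (h : I -> E) (C : R) :
  (forall e : R, 0 < e -> exists2 es : seq E, (forall i, P es`_i) &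
    forall x, P x -> nrm (D x) <=
      \sum_(i < size es) `|ip x es`_i| * nrm (D es`_i) + e * nrm x) ->
  (forall i, P (h i)) -> (\forall i \near F, nrm (h i) <= C) ->
  (forall v, P v -> ip (h i) v @[i --> F] --> 0) ->
  nrm (D (h i)) @[i --> F] --> 0.
Proof.
move=> happ Ph hC hw; apply/cvgr0Pnorm_le => e e0.
pose C' := `|C| + 1; have C'0 : 0 < C' by rewrite ltr_wpDl.
have [es Pes esD] := happ (e / 2 / C') ltac:(by rewrite !divr_gt0).
have : \sum_(k < size es) `|ip (h i) es`_k| * nrm (D es`_k) @[i --> F] --> 0.
  rewrite [X in _ --> X](_ : 0 = \sum_(k < size es) `|0 : R| * nrm (D es`_k)); last first.
    by rewrite big1// => k _; rewrite normr0 mul0r.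
  apply: cvg_big => [|k _]; first exact: add_continuous.
  by apply: cvgMr_tmp; apply: cvg_norm; exact: hw.
move=> /cvgr0Pnorm_le/(_ (e / 2) ltac:(by rewrite divr_gt0)) h2.
near=> i; rewrite ger0_norm ?nrm_ge0//.
apply: (le_trans (esD _ (Ph i))); rewrite [leRHS]splitr; apply: lerD.
  by apply: le_trans (ler_norm _) _; near: i.
rewrite [leRHS](_ : _ = e / 2 / C' * C'); last by field; rewrite gt_eqF.
rewrite ler_pM2l; last by rewrite !divr_gt0.
have : nrm (h i) <= C by near: i.
by move=> /le_trans; apply; rewrite /C'; have := ler_norm C; lra.
Unshelve. all: by end_near. Qed.

End prehilbert.

(** * Square integrable functions *)

Lemma sqr_normr (R : realType) (x : R) : `|x| ^+ 2 = x ^+ 2.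
Proof. by rewrite real_normK ?num_real. Qed.

Section ae_integral.
Context d (T : measurableType d) (R : realType).
Variables (mu : {measure set T -> \bar R}) (D : set T) (mD : measurable D).
Local Notation ig f := (mu.-integrable D (EFin \o f)).
Implicit Types f g h : T -> R.

Lemma ig_meas f : ig f -> measurable_fun D f.
Proof. by move=> /integrableP[/measurable_EFinP]. Qed.

Lemma ae_le_integrable f g : measurable_fun D f -> ig g ->
  {ae mu, forall x, D x -> `|f x| <= g x} -> ig f.
Proof.
move=> mf /[dup] /ig_meas mg /integrableP[_ ig] fg.
apply/integrableP; split; first exact/measurable_EFinP.
apply: le_lt_trans ig; apply: ae_ge0_le_integral => //.
- by apply: measurableT_comp => //; apply/measurable_EFinP.
- by apply: measurableT_comp => //; apply/measurable_EFinP.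
- apply: filterS fg => x fg Dx; rewrite /= lee_fin.
  exact: le_trans (fg Dx) (ler_norm _).
Qed.

Lemma le_integrableR f g : measurable_fun D f -> ig g ->
  (forall x, D x -> `|f x| <= g x) -> ig f.
Proof. by move=> mf gg fg; apply: ae_le_integrable gg _ => //; exact: aeW. Qed.

Lemma ig_lin c f g : ig f -> ig g -> ig (fun x => c * f x + g x).
Proof.
move=> hf hg.
have := integrableD mD (integrableZl mD c hf) hg.
by apply: eq_integrable => // x _.
Qed.

Lemma igD f g : ig f -> ig g -> ig (fun x => f x + g x).
Proof. by move=> hf hg; have := integrableD mD hf hg; apply: eq_integrable. Qed.

Lemma igB f g : ig f -> ig g -> ig (fun x => f x - g x).
Proof. by move=> hf hg; have := integrableB mD hf hg; apply: eq_integrable. Qed.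

Lemma igZ c f : ig f -> ig (fun x => c * f x).
Proof. by move=> hf; have := integrableZl mD c hf; apply: eq_integrable. Qed.

Lemma ig_norm f : ig f -> ig (fun x => `|f x|).
Proof. by move=> hf; have := integrable_norm hf. Qed.

Lemma ae_eq_Rintegral f g : measurable_fun D f -> measurable_fun D g ->
  {ae mu, forall x, D x -> f x = g x} ->
  \int[mu]_(x in D) f x = \int[mu]_(x in D) g x.
Proof.
move=> mf mg fg; rewrite /Rintegral; congr fine; apply: ae_eq_integral => //.
- exact/measurable_EFinP.
- exact/measurable_EFinP.
- by apply: filterS fg => x h Dx /=; rewrite h.
Qed.

Lemma ae_ge0_Rintegral f : ig f -> {ae mu, forall x, D x -> 0 <= f x} ->
  0 <= \int[mu]_(x in D) f x.
Proof.
move=> igf f0; have mf := ig_meas igf.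
rewrite (@ae_eq_Rintegral _ (fun x => `|f x|)) ?Rintegral_ge0//.
  exact: measurableT_comp.
by apply: filterS f0 => x h Dx; rewrite ger0_norm ?h.
Qed.

Lemma ae_le_Rintegral f g : ig f -> ig g ->
  {ae mu, forall x, D x -> f x <= g x} ->
  \int[mu]_(x in D) f x <= \int[mu]_(x in D) g x.
Proof.
move=> igf igg fg; rewrite -subr_ge0 -RintegralB//.
apply: ae_ge0_Rintegral; first exact: igB.
by apply: filterS fg => x h Dx; rewrite subr_ge0 h.
Qed.

Lemma EFin_Rintegral f : ig f ->
  (\int[mu]_(x in D) f x)%:E = (\int[mu]_(x in D) (f x)%:E)%E.
Proof. by move=> igf; rewrite fineK//; exact: integrable_fin_num. Qed.

Lemma Rintegral_eq0_ae f : ig f -> (forall x, D x -> 0 <= f x) ->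
  \int[mu]_(x in D) f x = 0 -> {ae mu, forall x, D x -> f x = 0}.
Proof.
move=> igf f0 h.
have : (\int[mu]_(x in D) `|(f x)%:E|)%E = 0%E.
  rewrite -[RHS]/(0%:E) -h EFin_Rintegral//; apply: eq_integral => x xD.
  by rewrite gee0_abs ?lee_fin//; apply: f0; exact: set_mem.
have mf : measurable_fun D (EFin \o f) by apply/measurable_EFinP; exact: ig_meas.
move=> /(ae_eq_integral_abs mu mD mf).1.
by apply: filterS => x h' Dx; have /= [] := h' Dx.
Qed.

End ae_integral.

Section sqint.
Context d (T : measurableType d) (R : realType).
Variables (mu : {measure set T -> \bar R}) (D : set T) (mD : measurable D).
Local Notation ig f := (mu.-integrable D (EFin \o f)).
Implicit Types f g h : T -> R.

(** Measurability is asked on [D] only, whereas members of [L2] are measurable on the whole space.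
    Compositions such as [f x (y x)] are controlled on the domain alone. *)
Definition sqint f := measurable_fun D f /\ ig (fun x => f x ^+ 2).

Definition ipD f g : R := \int[mu]_(x in D) (f x * g x).

Definition nrmD f : R := Num.sqrt (ipD f f).

Lemma sqint_mul f g : sqint f -> sqint g -> ig (fun x => f x * g x).
Proof.
move=> [mf f2] [mg g2]; apply: (le_integrableR mD _ (igD mD f2 g2)).
  exact: measurable_funM.
move=> x _; rewrite normrM.
have := sqr_ge0 (`|f x| - `|g x|); have := sqr_ge0 (`|f x| + `|g x|).
rewrite -[f x ^+ 2]sqr_normr -[g x ^+ 2]sqr_normr; nra.
Qed.

Lemma sqint_lin c f g : sqint f -> sqint g -> sqint (c *: (f : T -> R) + g).
Proof.
move=> sf sg; have := sqint_mul sf sg.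
move: sf sg => [mf f2] [mg g2] fg; split.
  by apply: measurable_funD => //; apply: measurable_funM => //; exact: measurable_cst.
have := ig_lin mD (c ^+ 2) f2 (ig_lin mD (2 * c) fg g2).
apply: eq_integrable => // x _ /=; congr EFin.
by rewrite -[RHS]/((c * f x + g x) ^+ 2); ring.
Qed.

Lemma prehilbert_sqint : prehilbert sqint ipD.
Proof.
split=> [|||c f g h sf sg sh|f _].
- split; first exact: measurable_cst.
  by under eq_fun do rewrite expr0n/=; exact: integrable0.
- exact: sqint_lin.
- by move=> f g; apply: eq_Rintegral => x _; rewrite mulrC.
- have fh := sqint_mul sf sh; have gh := sqint_mul sg sh.
  rewrite /ipD -(RintegralZl c mD fh) -(RintegralD mD (igZ mD c fh) gh).
  by apply: eq_Rintegral => x _; rewrite -[LHS]/((c * f x + g x) * h x); ring.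
- by apply: Rintegral_ge0 => x _; rewrite -expr2 sqr_ge0.
Qed.
Let H := prehilbert_sqint.

Lemma nrmD_sq f : sqint f -> nrmD f ^+ 2 = \int[mu]_(x in D) (f x ^+ 2).
Proof. by move=> sf; rewrite (nrm_sq H sf). Qed.

Lemma nrmD_ge0 f : 0 <= nrmD f. Proof. exact: sqrtr_ge0. Qed.

Lemma nrmD_ip f : sqint f -> nrmD f ^+ 2 = ipD f f.
Proof. exact: (nrm_sq H). Qed.

Lemma nrmDZ c f : sqint f -> nrmD (c *: f) = `|c| * nrmD f.
Proof. exact: (nrmZ H). Qed.

Lemma nrmDN f : sqint f -> nrmD (- f) = nrmD f.
Proof. exact: (nrmN H). Qed.

Lemma ler_nrmD f g : sqint f -> sqint g -> nrmD (f + g) <= nrmD f + nrmD g.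
Proof. exact: (nrm_triangle H). Qed.

Lemma ler_nrmB f g : sqint f -> sqint g -> nrmD (f - g) <= nrmD f + nrmD g.
Proof.
by move=> sf sg; rewrite -(nrmDN sg); apply: ler_nrmD => //; exact: (phN H).
Qed.

Lemma ipD_le f g : sqint f -> sqint g -> `|ipD f g| <= nrmD f * nrmD g.
Proof. exact: (cauchy_schwarz H). Qed.

Lemma sqint_norm f : sqint f -> sqint (fun x => `|f x|).
Proof.
move=> [mf f2]; split; first exact: measurableT_comp.
by apply: eq_integrable f2 => // x _ /=; rewrite sqr_normr.
Qed.

Lemma nrmD_norm f : nrmD (fun x => `|f x|) = nrmD f.
Proof.
congr Num.sqrt; apply: eq_Rintegral => x _.
by rewrite -[LHS]expr2 sqr_normr expr2.
Qed.

Lemma ae_le_sqint f g : measurable_fun D f -> sqint g ->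
  {ae mu, forall x, D x -> `|f x| <= `|g x|} -> sqint f.
Proof.
move=> mf [mg g2] fg; split => //; apply: ae_le_integrable g2 _ => //.
  exact: measurable_funX.
apply: filterS fg => x fg Dx; rewrite normrX -[leRHS]sqr_normr.
by rewrite ler_pXn2r// ?nnegrE// fg.
Qed.

Lemma ae_le_nrmD f g : sqint f -> sqint g ->
  {ae mu, forall x, D x -> `|f x| <= `|g x|} -> nrmD f <= nrmD g.
Proof.
move=> sf sg fg; rewrite ler_wsqrtr//; apply: ae_le_Rintegral => //; try exact: sqint_mul.
apply: filterS fg => x fg Dx; rewrite -!expr2 -[leLHS]sqr_normr -[leRHS]sqr_normr.
by rewrite ler_pXn2r// ?nnegrE// fg.
Qed.

Lemma nrmD_eq0_ae f : sqint f -> nrmD f = 0 -> {ae mu, forall x, D x -> f x = 0}.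
Proof.
move=> sf f0; have : \int[mu]_(x in D) (f x ^+ 2) = 0.
  by rewrite -nrmD_sq// f0 expr0n.
move=> /(Rintegral_eq0_ae mD sf.2)h.
have : {ae mu, forall x, D x -> f x ^+ 2 = 0} by apply: h => x _; exact: sqr_ge0.
by apply: filterS => x fx Dx; apply/eqP; rewrite -sqrf_eq0; apply/eqP/fx.
Qed.

Lemma ae_nrmD_eq0 f : sqint f -> {ae mu, forall x, D x -> f x = 0} -> nrmD f = 0.
Proof.
move=> sf f0; rewrite /nrmD /ipD (@ae_eq_Rintegral _ _ _ _ _ mD _ (fun=> 0)).
- by rewrite /Rintegral integral0 sqrtr0.
- by apply: measurable_funM => //; exact: sf.1.
- exact: measurable_cst.
- by apply: filterS f0 => x h Dx; rewrite h// mulr0.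
Qed.

Hypothesis Dfin : (mu D < +oo)%E.

Lemma ig_cst (c : R) : ig (fun=> c).
Proof.
apply/integrableP; split; first exact: measurable_cst.
by rewrite integral_cst// lte_mul_pinfty// ?lee_fin.
Qed.

Lemma sqint_cst c : sqint (fun=> c).
Proof. by split; [exact: measurable_cst|exact: ig_cst]. Qed.

Lemma sqint_ig f : sqint f -> ig f.
Proof.
move=> sf; have := sqint_mul sf (sqint_cst 1).
by apply: eq_integrable => // x _ /=; rewrite mulr1.
Qed.

Lemma integral_norm_le f : sqint f ->
  \int[mu]_(x in D) `|f x| <= nrmD (fun=> 1) * nrmD f.
Proof.
move=> sf; rewrite -(nrmD_norm f) mulrC.
have := cauchy_schwarz H (sqint_norm sf) (sqint_cst 1).
apply: le_trans; apply: le_trans (ler_norm _).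
by rewrite /ipD; under [leRHS]eq_Rintegral do rewrite mulr1.
Qed.

(** On a set of finite measure the L^1 norms of the increments are summable as well. The series of
    their absolute values is then integrable, hence finite almost everywhere, and the telescoping
    series converges. *)
Let ge0_summable_cvg (c : R) (v : nat -> T -> R) :
  (forall j, sqint (v j)) ->
  (forall j, nrmD (v j.+1 - v j) <= c * 2^-1 ^+ j) ->
  {ae mu, forall x, D x -> cvgn (v ^~ x)}.
Proof.
move=> sv vc.
pose dd j x : \bar R := `|v j.+1 x - v j x|%:E.
have sd j : sqint (v j.+1 - v j) by exact: (phB H).
have mdd j : measurable_fun D (dd j).
  by apply/measurable_EFinP; apply: measurableT_comp => //; exact: (sd j).1.
have dd0 j x : D x -> (0 <= dd j x)%E by rewrite lee_fin.
pose C := nrmD (fun=> 1) * c.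
have ddi : (\int[mu]_(x in D) (\sum_(0 <= j <oo) dd j x) <= (C * 2)%:E)%E.
  rewrite integral_nneseries//.
  apply: lime_le.
    by apply: is_cvg_nneseries => j _ _; apply: integral_ge0; exact: dd0.
  apply: nearW => m /=.
  have c0 : 0 <= C.
    rewrite mulr_ge0 ?sqrtr_ge0//.
    by have := le_trans (sqrtr_ge0 _) (vc 0%N); rewrite expr0 mulr1.
  (* [C * 2 - C * 2 * 2^-1 ^+ m] is the exact sum of [C * 2^-1 ^+ j] over [j < m], which is what the
     induction on [m] can carry. *)
  have -> : (C * 2)%:E = ((C * 2 - C * 2 * 2^-1 ^+ m) + C * 2 * 2^-1 ^+ m)%:E by rewrite subrK.
  apply: (@le_trans _ _ (C * 2 - C * 2 * 2^-1 ^+ m)%:E); last first.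
    rewrite lee_fin lerDl; apply: mulr_ge0; first exact: mulr_ge0.
    by apply: exprn_ge0; rewrite invr_ge0.
  elim: m => [|m ih]; first by rewrite big_nil expr0 mulr1 subrr.
  rewrite big_nat_recr//=.
  have -> : C * 2 - C * 2 * 2^-1 ^+ m.+1 = (C * 2 - C * 2 * 2^-1 ^+ m) + C * 2^-1 ^+ m.
    by rewrite exprS; field.
  rewrite EFinD; apply: leeD => //.
  rewrite /dd -EFin_Rintegral//; last by apply: ig_norm => //; exact: (sqint_ig (sd m)).
  rewrite lee_fin; apply: (le_trans (integral_norm_le (sd m))).
  by rewrite -mulrA ler_wpM2l ?sqrtr_ge0.
have : mu.-integrable D (fun x => \sum_(0 <= j <oo) dd j x)%E.
  apply/integrableP; split.
    by apply: ge0_emeasurable_sum => // j x Dx _; exact: dd0.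
  under eq_integral => x xD.
    rewrite gee0_abs; last by apply: nneseries_ge0 => j _ _; apply: dd0; rewrite -in_setE.
    over.
  exact: le_lt_trans ddi (ltry _).
move=> /(integrable_ae mD); apply: filterS => x h Dx; have {}h := h Dx.
have /normed_cvg : cvgn [normed series (telescope (v ^~ x))].
  apply: nondecreasing_is_cvgn.
    by apply: nondecreasing_series => j _ _; exact: normr_ge0.
  exists (fine (\sum_(0 <= j <oo) dd j x)%E) => _ [m _ <-].
  rewrite -lee_fin fineK// /series/= -sumEFin.
  by apply: nneseries_lim_ge => j _ _; exact: dd0.
move=> cs; have -> : v ^~ x = (fun j => v 0%N x + series (telescope (v ^~ x)) j).
  by apply/funext => j; rewrite -eq_sum_telescope.
by apply: is_cvgD => //; exact: is_cvg_cst.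
Qed.

(** A rapidly Cauchy subsequence [v] converges almost everywhere to [l]. Fatou's lemma applied to
    [(u i - v (M + j)) ^+ 2] as [j] grows bounds [nrmD (u i - l)], and this also shows that [l] is
    square integrable. *)
Lemma riesz_fischer : nrm_complete sqint ipD.
Proof.
move=> u su cau.
have h2 j : 0 < 2^-1 ^+ j :> R by rewrite exprn_gt0.
have /choice[N hN] j := cau _ (h2 j).
(* The maximum over all [i <= j] gives [N j] below both [k j] and [k j.+1], as the increment bound
   demands. Including [i] itself gives [j <= k j], so the subsequence runs off to infinity. *)
pose k j := (\max_(i < j.+1) maxn (N i) i)%N.
have kN i j : (i <= j)%N -> (N i <= k j)%N.
  move=> ij; apply: (leq_trans (leq_maxl _ i)).
  by rewrite /k -ltnS in ij *; exact: (@leq_bigmax _ (fun i : 'I_j.+1 => maxn (N i) i) (Ordinal ij)).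
have kj j : (j <= k j)%N.
  apply: (leq_trans (leq_maxr (N j) _)).
  exact: (@leq_bigmax _ (fun i : 'I_j.+1 => maxn (N i) i) ord_max).
pose v j := u (k j); have sv j : sqint (v j) by exact: su.
have vc j : nrmD (v j.+1 - v j) <= 1 * 2^-1 ^+ j.
  by rewrite mul1r; apply: hN; exact: kN.
have cvg_v := ge0_summable_cvg sv vc.
(* The limit exists only almost everywhere; the upper limit is measurable on all of [D] and agrees
   with it there. *)
pose l x : R := fine (limn_esup (fun j => (v j x)%:E)).
have ml : measurable_fun D l.
  apply: measurableT_comp; first exact: fine_measurable.
  by apply: measurable_fun_limn_esup => j; apply/measurable_EFinP; exact: (sv j).1.
have lv : {ae mu, forall x, D x -> v ^~ x @ \oo --> l x}.
  apply: filterS cvg_v => x h Dx; have /cvg_ex[a va] := h Dx.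
  have : (v j x)%:E @[j --> \oo] --> a%:E by apply: cvg_EFin => //; exact: nearW.
  by move=> /cvg_limn_einf_sup[_ e]; rewrite /l e.
have key i (e : R) : 0 < e -> (exists M, forall j, (M <= j)%N -> nrmD (u i - u j) <= e) ->
    sqint (u i - l) /\ nrmD (u i - l) <= e.
  move=> e0 [M hM].
  have sui j : sqint (u i - v (M + j)%N) by exact: (phB H).
  pose f j x : \bar R := ((u i x - v (M + j)%N x) ^+ 2)%:E.
  have mf j : measurable_fun D (f j).
    by apply/measurable_EFinP; apply: measurable_funX; exact: (sui j).1.
  have f0 j x : D x -> (0 <= f j x)%E by rewrite lee_fin sqr_ge0.
  have mul : measurable_fun D (u i - l) by apply: measurable_funB => //; exact: (su i).1.
  have fle : (\int[mu]_(x in D) ((u i x - l x) ^+ 2)%:E <= (e ^+ 2)%:E)%E.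
    have := fatou mu mD mf f0.
    rewrite (@ae_eq_integral _ _ _ _ _ (fun x => ((u i x - l x) ^+ 2)%:E) (fun x => limn_einf (f^~ x)))//.
    - move=> /le_trans; apply; rewrite limn_einf_lim; apply: lime_le.
        exact: is_cvg_einfs.
      apply: nearW => m; apply: (@le_trans _ _ (\int[mu]_(x in D) f m x)%E).
        by apply: ereal_inf_lbound; exists m => /=.
      rewrite /f -EFin_Rintegral//; last exact: (sui m).2.
      rewrite lee_fin -[leLHS](nrmD_sq (sui m)) ler_pXn2r// ?nnegrE ?sqrtr_ge0 ?(ltW e0)//.
      apply: hM; exact: leq_trans (leq_addr _ _) (kj _).
    - rewrite (_ : (fun x => _) = (fun x => - limn_esup (fun j => - f j x))%E).
        apply: measurableT_comp => //; apply: measurable_fun_limn_esup => j.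
        exact: measurableT_comp.
      by apply/funext => x; rewrite (limn_esupN (f ^~ x)) oppeK.
    - by apply/measurable_EFinP; exact: measurable_funX.
    - apply: filterS lv => x h Dx; have {}h := h Dx.
      have : f j x @[j --> \oo] --> ((u i x - l x) ^+ 2)%:E.
        apply: cvg_EFin; first exact: nearW.
        rewrite [X in X @ _ --> _](_ : _ = fun j => (u i x - v (M + j)%N x) * (u i x - v (M + j)%N x)) ?expr2; last first.
          by apply/funext => j; rewrite /= expr2.
        have : u i x - v (M + j)%N x @[j --> \oo] --> u i x - l x.
          apply: cvgB; first exact: cvg_cst.
          rewrite -(cvg_shiftn M (v ^~ x)) in h; move: h.
          by under eq_cvg do rewrite /= addnC.
        by move=> a; apply: cvgM.
      by move=> /cvg_limn_einf_sup[-> _].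
  have sul : sqint (u i - l).
    split => //; apply/integrableP; split; first by apply/measurable_EFinP; exact: measurable_funX.
    apply: le_lt_trans (ltry (e ^+ 2)).
    apply: le_trans fle; rewrite le_eqVlt; apply/orP; left; apply/eqP.
    by apply: eq_integral => x _ /=; rewrite ger0_norm ?sqr_ge0.
  split => //; rewrite -(@ler_pXn2r _ 2)// ?nnegrE ?sqrtr_ge0 ?(ltW e0)//.
  by rewrite nrmD_sq// -lee_fin EFin_Rintegral//; exact: sul.2.
exists l.
  have [M hM] := cau _ ltr01.
  have [||sul _] := key M 1; [by []|by exists M => j Mj; exact: hM|].
  rewrite (_ : l = (u M - (u M - l))); first exact: (phB H).
  by rewrite opprB addrC subrK.
move=> e e0; have [M hM] := cau _ e0; exists M => i Mi.
by have [] := key i e e0 (ex_intro _ M (fun j Mj => hM i j Mi Mj)).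
Qed.

End sqint.

(** * Integrals of derivatives *)

Section rV.
Context {R : realType}.

Lemma coord_le_norm n (x : 'rV[R]_n) i : `|x ord0 i| <= `|x|.
Proof.
rewrite [leRHS]/Num.norm/= mx_normrE.
by apply/bigmax_geP; right; exists (ord0, i).
Qed.

Lemma rV_norm_le n (x : 'rV[R]_n) M : 0 <= M -> (forall i, `|x ord0 i| <= M) -> `|x| <= M.
Proof.
move=> M0 h; rewrite [leLHS]/Num.norm/= mx_normrE.
by apply/bigmax_leP; split => // -[i j] _ /=; rewrite ord1.
Qed.

Lemma continuous_rV (T : topologicalType) n (f : T -> 'rV[R]_n) :
  (forall i, continuous (fun t => f t ord0 i)) -> continuous f.
Proof.
move=> cf t; apply/cvgrPdist_le => e e0.
have : \forall s \near t, forall i : 'I_n, `|f t ord0 i - f s ord0 i| <= e.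
  by apply: filter_forall => i; move: e e0; apply/cvgrPdist_le; exact: cf.
apply: filterS => s h; apply: rV_norm_le; first exact: ltW.
by move=> i; rewrite !mxE.
Qed.

Lemma continuous_measurable_rV n (f : 'rV[R]_n -> R) : continuous f ->
  measurable_fun setT f.
Proof.
move=> /continuousP cf; apply: (measurability _ (RGenOpens.measurableE R)).
move=> _ [_ [a [b ->] <-]]; rewrite setTI; apply: open_measurable_rV.
by apply: cf; exact: interval_open.
Qed.

Lemma open_continuous_measurable_rV n (A : set 'rV[R]_n) (f : 'rV[R]_n -> R) :
  open A -> (forall x, A x -> {for x, continuous f}) -> measurable_fun A f.
Proof.
move=> oA cf; apply: (measurability _ (RGenOpens.measurableE R)).
move=> _ [_ [a [b ->] <-]]; apply: open_measurable_rV.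
have open_int (B : set 'rV[R]_n) : B `<=` B^° -> open B by rewrite openE.
apply: open_int => x [Ax fx]; apply: filterI; first exact: open_nbhs_nbhs.
apply: (cf x Ax); apply: open_nbhs_nbhs; split => //; exact: interval_open.
Qed.

Lemma lebesgue_rV_ball_lty n (M : R) : 0 <= M ->
  (lebesgue_rV n [set x : 'rV[R]_n | (`|x| <= M)%R] < +oo)%E.
Proof.
move=> M0.
have -> : [set x : 'rV[R]_n | `|x| <= M] =
    [set x | forall i, - M <= x ord0 i <= M].
  apply/seteqP; split => x /= h.
    by move=> i; rewrite -ler_norml; exact: le_trans (coord_le_norm _ _) h.
  by apply: rV_norm_le => // i; rewrite ler_norml.
rewrite (@lebesgue_rV_box R n (fun=> - M) (fun=> M)); last by move=> _; lra.
by rewrite prodEFin ltry.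
Qed.

Lemma measurable_rV_ball n (M : R) : measurable [set x : 'rV[R]_n | `|x| <= M].
Proof.
have mN : measurable_fun setT (fun x : 'rV[R]_n => `|x|).
  apply: continuous_measurable_rV => x; exact: norm_continuous.
have := mN measurableT _ (measurable_itv `]-oo, M]).
by rewrite setTI; congr measurable.
Qed.

Lemma compact_support_integrable n (M : R) (g : 'rV[R]_n -> R) :
  continuous g -> (forall x, M < `|x| -> g x = 0) ->
  (lebesgue_rV n).-integrable setT (EFin \o g).
Proof.
move=> cg g0; pose M' := Num.max M 0; have M'0 : 0 <= M' by rewrite le_max lexx orbT.
pose A := [set x : 'rV[R]_n | `|x| <= M'].
have cA : compact A.
  apply: bounded_closed_compact.
    exists M'; split=> [|N MN x Ax]; first exact: num_real.
    exact: le_trans Ax (ltW MN).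
  apply: (@closed_comp _ _ (fun x : 'rV[R]_n => `|x|) [set y | y <= M']).
    by move=> x _; exact: norm_continuous.
  exact: closed_le.
have [B hB] : exists B, forall x, A x -> `|g x| <= B.
  have : compact (g @` A) by apply: continuous_compact => //; exact: continuous_subspaceT.
  move=> /compact_bounded[B [_ hB]]; exists (B + 1) => x Ax.
  by apply: hB; [rewrite ltrDl|exists x].
have mA : measurable A by exact: measurable_rV_ball.
have -> : EFin \o g = (EFin \o g) \_ A.
  apply/funext => x; rewrite patchE; case: ifPn => // /negP xA /=.
  by rewrite g0//; case: leP => // xM; case: xA; rewrite inE /A/= le_max xM.
apply/integrable_restrict => //; rewrite setTI.
apply: measurable_bounded_integrable => //.
- exact: lebesgue_rV_ball_lty.
- apply: measurable_funTS; exact: continuous_measurable_rV.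
- by exists B; split; [exact: num_real|move=> N BN x Ax; exact: le_trans (hB x Ax) (ltW BN)].
Qed.

Lemma rV_cons_continuousl n (x : 'rV[R]_n) : continuous (fun t => rV_cons (t, x)).
Proof.
apply: continuous_rV => i; have [j ->|->] := unliftP ord0 i.
  by under eq_fun do rewrite rV_consS/=; move=> t; exact: cvg_cst.
by under eq_fun do rewrite rV_cons0; move=> t; exact: cvg_id.
Qed.

Lemma rV_cons_continuousr n (t : R) : continuous (fun x : 'rV[R]_n => rV_cons (t, x)).
Proof.
apply: continuous_rV => i; have [j ->|->] := unliftP ord0 i.
  by under eq_fun do rewrite rV_consS; exact: coord_continuous.
rewrite (_ : (fun x => _) = cst t); last by apply/funext => x; rewrite rV_cons0.
exact: cst_continuous.
Qed.

Lemma rV_cons_add0 n t (x : 'rV[R]_n) h :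
  rV_cons (t, x) + h *: delta_mx ord0 ord0 = rV_cons (t + h, x).
Proof.
apply/rowP => i; rewrite mxE [X in _ + X]mxE [X in _ * X]mxE eqxx/=.
have [j ->|->] := unliftP ord0 i; rewrite ?rV_consS ?rV_cons0 /=.
  by rewrite mulr0 addr0.
by rewrite mulr1.
Qed.

Lemma rV_cons_addS n t (x : 'rV[R]_n) h j :
  rV_cons (t, x) + h *: delta_mx ord0 (lift ord0 j) = rV_cons (t, x + h *: delta_mx ord0 j).
Proof.
apply/rowP => i; rewrite mxE [X in _ + X]mxE [X in _ * X]mxE eqxx/=.
have [k ->|->] := unliftP ord0 i; rewrite ?rV_consS ?rV_cons0 /=.
  by rewrite [RHS]mxE [X in _ = _ + X]mxE mxE eqxx/= (inj_eq (@lift_inj _ _)).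
by rewrite mulr0 addr0.
Qed.

Lemma integral_derivative_compact_support (M : R) (f F : R -> R) :
  continuous f -> (forall t, is_derive t (1 : R) F (f t)) ->
  (forall t, M < `|t| -> F t = 0) -> (forall t, M < `|t| -> f t = 0) ->
  (\int[lebesgue_measure]_t (f t)%:E = 0)%E.
Proof.
move=> cf dF F0 f0; pose N := `|M| + 1.
have MN : M < N by rewrite /N; have := ler_norm M; lra.
have N0 : 0 < N by rewrite ltr_wpDl.
have cF t : {for t, continuous F}.
  by apply: differentiable_continuous; apply/derivable1_diffP; case: (dF t).
have FN : F N = 0 by rewrite F0// gtr0_norm.
have FNN : F (- N) = 0 by rewrite F0// normrN gtr0_norm.
have : (\int[lebesgue_measure]_(t in `[(- N)%R, N]) (f t)%:E = (F N)%:E - (F (- N))%:E)%E.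
  apply: continuous_FTC2; first lra.
  - exact: continuous_subspaceT.
  - split.
    + by move=> t _; case: (dF t).
    + by apply: cvg_at_right_filter; exact: cF.
    + by apply: cvg_at_left_filter; exact: cF.
  - by move=> t _; rewrite derive1E; case: (dF t).
rewrite FN FNN subee// => <-; rewrite [RHS]integral_mkcond; apply: eq_integral => t _.
rewrite patchE; case: ifPn => // /negP tN; rewrite f0//.
case: leP => // tM; case: tN; rewrite inE/= in_itv/= -ler_norml.
exact: le_trans tM (ltW MN).
Qed.

(** Induction on the dimension: the measure on R^n.+1 is the image of a product, and the order in
    Fubini's theorem depends on [i]. For the first coordinate the inner integral is one-dimensional
    and vanishes by the fundamental theorem of calculus; otherwise the inner integral is over the
    remaining coordinates and vanishes by induction. *)
Lemma integral_partial_eq0 (M : R) n (i : 'I_n) (g G : 'rV[R]_n -> R) :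
  continuous g ->
  (forall x, is_derive (0 : R) (1 : R) (fun h => G (x + h *: delta_mx ord0 i)) (g x)) ->
  (forall x, M < `|x| -> G x = 0) -> (forall x, M < `|x| -> g x = 0) ->
  (\int[lebesgue_rV n]_x (g x)%:E = 0)%E.
Proof.
elim: n i g G => [[]//|n IHn] i g G cg dG G0 g0.
have consl t (x : 'rV[R]_n) : `|t| <= `|rV_cons (t, x)|.
  by have := coord_le_norm (rV_cons (t, x)) ord0; rewrite rV_cons0.
have consr t (x : 'rV[R]_n) : `|x| <= `|rV_cons (t, x)|.
  by apply: rV_norm_le => // j; have := coord_le_norm (rV_cons (t, x)) (lift ord0 j); rewrite rV_consS.
have mcons : measurable_fun [set: (measurableTypeR R * 'rV[R]_n)%type] (@rV_cons R n).
  exact: measurable_rV_cons.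
have mg : measurable_fun setT (EFin \o g) by apply/measurable_EFinP; exact: continuous_measurable_rV.
have ig := compact_support_integrable cg g0.
have ig2 : (@lebesgue_measure R \x lebesgue_rV n)%E.-integrable setT ((EFin \o g) \o @rV_cons R n).
  move: ig => /integrableP[_ igl]; apply/integrableP; split.
    exact: measurableT_comp.
  move: igl; rewrite (_ : (\int[lebesgue_rV n.+1]_x `|(EFin \o g) x|)%E =
     (\int[pushforward (@lebesgue_measure R \x lebesgue_rV n) (@rV_cons R n)]_x `|(EFin \o g) x|)%E)//.
  by rewrite ge0_integral_pushforward// ?preimage_setT//; exact: measurableT_comp.
have -> : (\int[lebesgue_rV n.+1]_x (g x)%:E =
    \int[(@lebesgue_measure R \x lebesgue_rV n)%E]_z (g (rV_cons z))%:E)%E.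
  transitivity (\int[pushforward (@lebesgue_measure R \x lebesgue_rV n) (@rV_cons R n)]_x (g x)%:E)%E => //.
  move: (ig2); rewrite -[X in _.-integrable X _](preimage_setT (@rV_cons R n)) => ig2'.
  by have := integral_pushforward mcons mg ig2' measurableT; rewrite preimage_setT.
have [j ij|i0] := unliftP ord0 i.
- rewrite -(integral12_prod_meas1 ig2)/=; apply: integral0_eq => t _ /=.
  apply: (IHn j (fun x => g (rV_cons (t, x))) (fun x => G (rV_cons (t, x)))).
  + by move=> x; apply: continuous_comp; [exact: rV_cons_continuousr|exact: cg].
  + by move=> x; have := dG (rV_cons (t, x)); rewrite ij; under eq_fun do rewrite rV_cons_addS.
  + by move=> x Mx; apply: G0; exact: lt_le_trans Mx (consr _ _).
  + by move=> x Mx; apply: g0; exact: lt_le_trans Mx (consr _ _).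
- rewrite -(integral21_prod_meas1 ig2)/=; apply: integral0_eq => x _ /=.
  apply: (@integral_derivative_compact_support M (fun t => g (rV_cons (t, x))) (fun t => G (rV_cons (t, x)))).
  + by move=> t; apply: continuous_comp; [exact: rV_cons_continuousl|exact: cg].
  + move=> t; have := dG (rV_cons (t, x)); rewrite i0; under eq_fun do rewrite rV_cons_add0.
    have E : (fun h : R => h^-1 *: (((fun s => G (rV_cons (s, x))) \o shift t) (h *: 1) - G (rV_cons (t, x)))) =
        (fun h => h^-1 *: (((fun s => G (rV_cons (t + s, x))) \o shift 0) (h *: 1) - G (rV_cons (t + 0, x)))).
      by apply/funext => h /=; rewrite !addr0 [in RHS](addrC t).
    by move=> [d1 d2]; apply: DeriveDef; [rewrite /derivable E|rewrite -d2 /derive E].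
  + by move=> t Mx; apply: G0; exact: lt_le_trans Mx (consl _ _).
  + by move=> t Mx; apply: g0; exact: lt_le_trans Mx (consl _ _).
Qed.

End rV.

(** * Function spaces on the domain *)

Lemma line_derive (R : realType) (V : normedModType R) (f : V -> R) x v :
  derivable f x v -> is_derive (0 : R) (1 : R) (fun h => f (x + h *: v)) ('D_v f x).
Proof.
have E : (fun h : R => h^-1 *: ((f \o shift x) (h *: v) - f x)) =
    (fun h => h^-1 *: (((fun s => f (x + s *: v)) \o shift 0) (h *: 1) - f (x + 0 *: v))).
  apply/funext => h /=; rewrite addr0 scale0r addr0 addrC.
  by rewrite -[h%:A]/(h * 1) mulr1 addrC (addrC (h *: v)).
by move=> d1; apply: DeriveDef; [rewrite /derivable -E|rewrite /derive E].
Qed.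

Lemma is_derive_mul (R : realType) (f g : R -> R) (x a b : R) :
  is_derive x (1 : R) f a -> is_derive x (1 : R) g b ->
  is_derive x (1 : R) (fun t => f t * g t) (a * g x + f x * b).
Proof.
move=> df dg; have := is_deriveM df dg.
by rewrite [a * _]mulrC [g x * a + _]addrC.
Qed.

Section domain.
Context {R : realType} {n : nat}.
Variable Om : lipschitzDomain R n.
Local Notation mu := (lebesgue_on Om : {measure set 'rV[R]_n -> \bar R}).
Local Notation T := ('rV[R]_n).
Local Notation O := (domain_set Om).
Implicit Types (f g u v phi psi : T -> R).

Lemma measurable_domain : measurable O.
Proof. exact: open_measurable_rV (@domain_open _ _ Om). Qed.
Let mOm := measurable_domain.

Lemma domain_ball : exists2 M : R, 0 < M & forall x, O x -> `|x| <= M.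
Proof.
have [M0 [_ hM]] := @domain_bounded _ _ Om.
exists (`|M0| + 1); first by rewrite ltr_wpDl.
by apply: hM; rewrite ltr_pwDr// ler_norm.
Qed.

Lemma lebesgue_onE A : A `<=` O -> measurable A -> mu A = lebesgue_rV n A.
Proof. by move=> AO mA; rewrite /= /lebesgue_on /mrestr setIidl. Qed.

Lemma lebesgue_on_lty : (mu O < +oo)%E.
Proof.
have [M M0 hM] := domain_ball.
rewrite lebesgue_onE//; apply: le_lt_trans (lebesgue_rV_ball_lty n (ltW M0)).
by apply: le_measure => //; rewrite inE//; exact: measurable_rV_ball.
Qed.
Let Ofin := lebesgue_on_lty.

Lemma lebesgue_onC : mu (~` O) = 0%E.
Proof. by rewrite /= /lebesgue_on /mrestr setICl measure0. Qed.

Lemma ge0_integral_lebesgue_onT (f : T -> \bar R) : (forall x, 0 <= f x)%E ->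
  measurable_fun setT f -> (\int[mu]_x f x = \int[mu]_(x in O) f x)%E.
Proof.
move=> f0 mf.
rewrite (@ge0_negligible_integral _ _ _ _ setT (~` O))//.
- by rewrite setTD setCK.
- exact: measurableC.
- exact: lebesgue_onC.
Qed.

Lemma integral_lebesgue_on (f : T -> \bar R) :
  (\int[mu]_(x in O) f x = \int[lebesgue_rV n]_(x in O) f x)%E.
Proof. by apply: eq_measure_integral => A mA AO; exact: lebesgue_onE. Qed.

Notation sq := (sqint mu O).
Notation nrm := (nrmD mu O).
Notation ip := (L2inner Om).
Notation ig f := (mu.-integrable O (EFin \o f)).

Let HS := prehilbert_sqint mu mOm.

Lemma L2_sqint u : L2 Om u -> sq u.
Proof.
move=> Lu; have := Lfun2_integrable_sqr Lu.
move: Lu; rewrite /L2/= inE => /andP[/[!inE]/= mu' _] iu.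
split; first exact: measurable_funTS.
exact: integrableS iu.
Qed.

Lemma L2_measurable u : L2 Om u -> measurable_fun setT u.
Proof. by rewrite /L2/= inE => /andP[/[!inE]/=]. Qed.

Lemma L2_Lnorm u : measurable_fun setT u ->
  ('N[mu]_2%:E[EFin \o u] = (\int[mu]_(x in O) ((u x) ^+ 2)%:E) `^ 2^-1)%E.
Proof.
move=> mu'; rewrite unlock; congr (_ `^ _)%E.
rewrite ge0_integral_lebesgue_onT.
- by apply: eq_integral => x _ /=; rewrite -sqr_normr -powR_mulrn.
- by move=> x; rewrite poweR_ge0.
- apply/measurable_EFinP.
  apply/(@measurableT_comp _ _ _ _ _ _ (fun x : R => x `^ 2)%R) => //.
  exact/measurableT_comp.
Qed.

Lemma sqint_L2 u : measurable_fun setT u -> sq u -> L2 Om u.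
Proof.
move=> mu' su; rewrite /L2/= inE; apply/andP; split; rewrite inE//=.
rewrite /finite_norm L2_Lnorm// poweR_lty//.
by rewrite -EFin_Rintegral ?ltry//; exact: su.2.
Qed.

Lemma L2normE u : L2 Om u -> L2norm Om u = nrm u.
Proof.
move=> Lu; have su := L2_sqint Lu.
rewrite /L2norm L2_Lnorm; last exact: L2_measurable.
rewrite -EFin_Rintegral//; last exact: su.2.
rewrite poweR_EFin /= -nrmD_sq//.
rewrite -powR_mulrn ?sqrtr_ge0// -powRrM mulfV ?powRr1 ?sqrtr_ge0//.
Qed.

Lemma prehilbert_L2 : prehilbert (L2 Om) ip.
Proof.
split=> [|c x y Lx Ly|x y|c x y z Lx Ly Lz|x Lx].
- apply: sqint_L2; [exact: measurable_cst|exact: (ph0 HS)].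
- apply: sqint_L2; last by apply: (ph_lin HS); exact: L2_sqint.
  apply: measurable_funD; last exact: L2_measurable.
  by apply: measurable_funM; [exact: measurable_cst|exact: L2_measurable].
- exact: (ph_sym HS).
- by apply: (ph_ipl HS); exact: L2_sqint.
- by apply: (ph_ge0 HS); exact: L2_sqint.
Qed.

(** Extension by zero supplies the measurability on the whole space that [L2] demands. *)
Lemma sqint_restrict_L2 u : sq u -> L2 Om (u \_ Om).
Proof.
move=> su; apply: sqint_L2; first by apply/(measurable_restrictT _ mOm); exact: su.1.
have E : {in O, u =1 u \_ Om} by move=> x xO; rewrite patchE xO.
split.
  by apply: eq_measurable_fun su.1 => x xO; exact: E.
by apply: eq_integrable su.2 => // x xO /=; rewrite -E.
Qed.

Lemma restrict_nrm u : nrm (u \_ Om) = nrm u.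
Proof. by congr Num.sqrt; apply: eq_Rintegral => x xO; rewrite patchE xO. Qed.

Lemma L2_complete : nrm_complete (L2 Om) ip.
Proof.
move=> u Lu cau.
have [|l sl hl] := riesz_fischer mOm Ofin (fun k => L2_sqint (Lu k)); first exact: cau.
exists (l \_ Om); first exact: sqint_restrict_L2.
move=> e e0; have [N hN] := hl e e0; exists N => i Ni; apply: le_trans (hN i Ni).
rewrite le_eqVlt; apply/orP; left; apply/eqP; congr Num.sqrt.
by apply: eq_Rintegral => x xO; rewrite !fctE patchE xO.
Qed.

Lemma Om0_integrable f : continuous f -> (forall x, ~ O x -> f x = 0) -> ig f.
Proof.
move=> cf f0; have [M M0 hM] := domain_ball.
have f0' x : M < `|x| -> f x = 0.
  by move=> Mx; apply: f0 => /hM; rewrite leNgt Mx.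
have /integrableP[mf] := compact_support_integrable cf f0'.
move=> h; apply/integrableP; split; first exact: measurable_funTS.
rewrite integral_lebesgue_on; apply: le_lt_trans h.
by apply: ge0_subset_integral => //; apply: measurableT_comp.
Qed.

Lemma Om0_Rintegral f : continuous f -> (forall x, ~ O x -> f x = 0) ->
  (\int[mu]_(x in O) f x)%:E = (\int[lebesgue_rV n]_x (f x)%:E)%E.
Proof.
move=> cf f0; rewrite EFin_Rintegral ?Om0_integrable// integral_lebesgue_on.
rewrite [LHS]integral_mkcond; apply: eq_integral => x _.
by rewrite patchE; case: ifPn => // /negP; rewrite inE => /f0 ->.
Qed.

Lemma integral_partial_domain (i : 'I_n) g G : continuous g ->
  (forall x, is_derive (0 : R) (1 : R) (fun h => G (x + h *: delta_mx ord0 i)) (g x)) ->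
  (forall x, ~ O x -> G x = 0) -> (forall x, ~ O x -> g x = 0) ->
  \int[mu]_(x in O) g x = 0.
Proof.
move=> cg dG G0 g0; apply: EFin_inj; rewrite Om0_Rintegral//.
have [M M0 hM] := domain_ball.
apply: (@integral_partial_eq0 R M n i g G) => // x Mx.
- by apply: G0 => /hM; rewrite leNgt Mx.
- by apply: g0 => /hM; rewrite leNgt Mx.
Qed.

Lemma tf_continuous phi : test_function Om phi -> continuous phi.
Proof. by move=> [sm _]; have [] := sm [::]. Qed.

Lemma tf_derivable phi i x : test_function Om phi -> derivable phi x (delta_mx ord0 i).
Proof. by move=> [sm _]; have [_] := sm [::]. Qed.

Lemma tf_partial phi i : test_function Om phi -> test_function Om (partial i phi).
Proof.
move=> [sm [K [cK KO phi0]]]; split.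
  by move=> s; have := sm (rcons s i); rewrite foldr_rcons.
exists K; split => // x Kx; rewrite /partial.
have clK : closed K by apply: compact_closed => //; exact: norm_hausdorff.
have oK : open (~` K) by rewrite openC.
have phi0n : \forall y \near x, phi y = cst 0 y.
  by apply: filterS (open_nbhs_nbhs (conj oK Kx)) => y Ky; exact: phi0.
rewrite (near_eq_derive _ phi0n); first exact: derive_cst.
Qed.

Lemma tf0 phi x : test_function Om phi -> ~ O x -> phi x = 0.
Proof. by move=> [_ [K [_ KO phi0]]] Ox; apply: phi0 => /KO. Qed.

Lemma tf_lin c phi psi : test_function Om phi -> test_function Om psi ->
  test_function Om (c *: phi + psi).
Proof.
move=> [sm1 [K1 [cK1 KO1 z1]]] [sm2 [K2 [cK2 KO2 z2]]]; split; last first.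
  exists (K1 `|` K2); split; first exact: compactU.
    by move=> x [/KO1|/KO2].
  move=> x /not_orP[x1 x2]; rewrite -[LHS]/(c * phi x + psi x) z1// z2// mulr0 addr0//.
have E s : foldr partial (c *: phi + psi) s = c *: foldr partial phi s + foldr partial psi s.
  elim: s => //= i s ->; apply/funext => x; rewrite /partial.
  have d1 := (sm1 s).2 i x; have d2 := (sm2 s).2 i x.
  rewrite deriveD; [|exact: derivableZ|exact: d2].
  by rewrite deriveZ.
move=> s; rewrite E; split.
  move=> x; apply: continuousD; last exact: (sm2 s).1.
  by apply: continuousM; [exact: cst_continuous|exact: (sm1 s).1].
move=> i x; apply: derivableD; last exact: (sm2 s).2.
by apply: derivableZ; exact: (sm1 s).2.
Qed.

Lemma continuous_mulr_rV f g : continuous f -> continuous g -> continuous (fun x => f x * g x).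
Proof. by move=> cf cg x; apply: continuousM; [exact: cf|exact: cg]. Qed.

Lemma continuous_addr_rV f g : continuous f -> continuous g -> continuous (fun x => f x + g x).
Proof. by move=> cf cg x; apply: continuousD; [exact: cf|exact: cg]. Qed.

Lemma tf_L2 phi : test_function Om phi -> L2 Om phi.
Proof.
move=> tphi; have cphi := tf_continuous tphi; apply: sqint_L2.
  exact: continuous_measurable_rV.
split; first by apply: measurable_funTS; exact: continuous_measurable_rV.
apply: Om0_integrable.
  by apply: continuous_mulr_rV.
by move=> x Ox; rewrite (tf0 tphi)// expr0n.
Qed.

Lemma tf_ibp phi psi i : test_function Om phi -> test_function Om psi ->
  ip phi (partial i psi) = - ip (partial i phi) psi.
Proof.
move=> t1 t2; apply/eqP; rewrite -addr_eq0; apply/eqP.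
have s1 := L2_sqint (tf_L2 t1); have s2 := L2_sqint (tf_L2 t2).
have s1' := L2_sqint (tf_L2 (tf_partial i t1)); have s2' := L2_sqint (tf_L2 (tf_partial i t2)).
rewrite /L2inner -(RintegralD mOm (sqint_mul mOm s1 s2') (sqint_mul mOm s1' s2)).
apply: (@integral_partial_domain i _ (fun x => phi x * psi x)).
- apply: continuous_addr_rV; apply: continuous_mulr_rV; apply: tf_continuous => //; exact: tf_partial.
- move=> x.
  have d1 := line_derive (@tf_derivable _ i x t1); have d2 := line_derive (@tf_derivable _ i x t2).
  by have := is_derive_mul d1 d2; rewrite scale0r addr0 addrC.
- by move=> x Ox; rewrite (tf0 t1)// mul0r.
- by move=> x Ox; rewrite (tf0 t1)// (tf0 t2)// mul0r mulr0 addr0.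
Qed.

Lemma tf_weak_gradient phi : test_function Om phi ->
  weak_gradient Om phi (fun i => partial i phi).
Proof.
move=> t1 i; split; first by apply: tf_L2; exact: tf_partial.
by move=> psi t2; exact: tf_ibp.
Qed.

(** The integral of the [i]-th partial derivative of [x_i * phi ^+ 2] vanishes, so [|phi|^2] is
    minus the integral of [2 * x_i * phi * partial i phi]. As [|x_i| <= M] on the domain,
    Cauchy-Schwarz gives the constant [2 * M]. *)
Lemma tf_poincare : exists2 C : R, 0 <= C & forall phi i, test_function Om phi ->
  nrm phi <= C * nrm (partial i phi).
Proof.
have [M M0 hM] := domain_ball; exists (2 * M); first by rewrite mulr_ge0// ltW.
move=> phi i tp; have tp' := tf_partial i tp.
have sp := L2_sqint (tf_L2 tp); have sp' := L2_sqint (tf_L2 tp').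
have cp := tf_continuous tp; have cp' := tf_continuous tp'.
have cx : continuous (fun x : T => x ord0 i) by exact: coord_continuous.
pose h (x : T) := x ord0 i * partial i phi x.
have sh : sq (fun x => 2 * h x).
  apply: (@ae_le_sqint _ _ _ mu _ mOm _ (fun x => (2 * M) * partial i phi x)).
  - apply: measurable_funTS; apply: continuous_measurable_rV.
    apply: continuous_mulr_rV; first exact: cst_continuous.
    exact: continuous_mulr_rV.
  - by have := sqint_lin mOm (2 * M) sp' (ph0 HS); rewrite addr0.
  - apply: aeW => x Ox; rewrite !normrM !mulrA ler_wpM2r// ler_wpM2l//.
    exact: le_trans (coord_le_norm _ _) (le_trans (hM _ Ox) (ler_norm _)).
have key : ip phi phi = - ip phi (fun x => 2 * h x).
  apply/eqP; rewrite -addr_eq0; apply/eqP.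
  rewrite /L2inner -(RintegralD mOm (sqint_mul mOm sp sp) (sqint_mul mOm sp sh)).
  apply: (@integral_partial_domain i _ (fun x => x ord0 i * (phi x * phi x))).
  - apply: continuous_addr_rV; first exact: continuous_mulr_rV.
    apply: continuous_mulr_rV => //; apply: continuous_mulr_rV; first exact: cst_continuous.
    exact: continuous_mulr_rV.
  - move=> x; have d1 := line_derive (@tf_derivable _ i x tp).
    have d0 : is_derive (0 : R) (1 : R) (fun h => (x + h *: delta_mx ord0 i) ord0 i) 1.
      rewrite (_ : (fun h => _) = cst (x ord0 i) + id); last first.
        by apply/funext => t; rewrite !mxE !eqxx/= mulr1.
      by apply: is_derive_eq; rewrite add0r.
    have := is_derive_mul d0 (is_derive_mul d1 d1).
    by rewrite scale0r addr0 /h /partial; congr is_derive; ring.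
  - by move=> x Ox; rewrite (tf0 tp)// !mulr0.
  - by move=> x Ox; rewrite (tf0 tp)// !mul0r addr0.
have le1 : nrm (fun x : T => 2 * h x) <= 2 * M * nrm (partial i phi).
  have -> : 2 * M * nrm (partial i phi) = nrm ((2 * M) *: partial i phi).
    by rewrite nrmDZ// ger0_norm// mulr_ge0// ltW.
  apply: ae_le_nrmD => //; first exact: (phZ HS).
  apply: aeW => x Ox; rewrite !normrM !mulrA ler_wpM2r// ler_wpM2l//.
  exact: le_trans (coord_le_norm _ _) (le_trans (hM _ Ox) (ler_norm _)).
have [p0|p0] := eqVneq (nrm phi) 0.
  by rewrite p0 mulr_ge0 ?sqrtr_ge0// mulr_ge0// ltW.
have pp : 0 < nrm phi by rewrite lt_neqAle eq_sym p0 sqrtr_ge0.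
rewrite -(ler_pM2l pp); apply: le_trans (ler_wpM2l (sqrtr_ge0 _) le1).
apply: le_trans (ipD_le mOm sp sh); rewrite -normrN; apply: le_trans (ler_norm _).
by rewrite -[X in _ <= - X]/(ip phi (fun x => 2 * h x)) -key -expr2 nrmD_ip.
Qed.

End domain.

Lemma ler_sqrt_sumr (R : realType) n (a : R) (b : 'I_n -> R) :
  `|a| <= Num.sqrt (a ^+ 2 + \sum_(i < n) b i ^+ 2) /\
  forall i, `|b i| <= Num.sqrt (a ^+ 2 + \sum_(i < n) b i ^+ 2).
Proof.
have b0 : 0 <= \sum_(i < n) b i ^+ 2 by apply: sumr_ge0 => i _; exact: sqr_ge0.
split => [|i]; rewrite -sqrtr_sqr ler_wsqrtr//; first by rewrite lerDl.
rewrite (bigD1 i)//= addrCA lerDl addr_ge0 ?sqr_ge0//.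
by apply: sumr_ge0 => j _; exact: sqr_ge0.
Qed.

(** * Functions paired with a weak gradient, and the sup norm on the closure *)

Section h10.
Context {R : realType} {n : nat}.
Variable Om : lipschitzDomain R n.
Local Notation mu := (lebesgue_on Om : {measure set 'rV[R]_n -> \bar R}).
Local Notation T := ('rV[R]_n).
Local Notation O := (domain_set Om).
Notation nrm := (nrmD mu O).
Notation ip := (L2inner Om).
Implicit Types (f g u v phi psi y : T -> R) (G H : 'I_n -> T -> R).
Let mOm := measurable_domain Om.
Let HS := prehilbert_sqint mu mOm.
Let H2 := prehilbert_L2 Om.

Definition lin c G H i : T -> R := c *: G i + H i.

Lemma weak_gradient_lin c u v G H : L2 Om u -> L2 Om v ->
  weak_gradient Om u G -> weak_gradient Om v H ->
  weak_gradient Om (c *: u + v) (lin c G H).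
Proof.
move=> Lu Lv uG vH i; have [LG uG'] := uG i; have [LH vH'] := vH i; split.
  exact: (ph_lin H2).
move=> phi tphi; have Lp := tf_L2 tphi; have Lp' := tf_L2 (tf_partial i tphi).
by rewrite !(ph_ipl H2)// uG'// vH'//; ring.
Qed.

(** [grad] is picked by [get], so the gradient of a combination need not be the combination of the
    gradients. Here the gradient is part of the data, and the notion is stable under [lin]. *)
Definition H10pair u G : Prop := [/\ L2 Om u, weak_gradient Om u G &
  forall e : R, 0 < e -> exists phi H, [/\ test_function Om phi,
    weak_gradient Om (u - phi) H, nrm (u - phi) <= e & forall i, nrm (H i) <= e]].

Lemma H10pair_lin c u v G H : H10pair u G -> H10pair v H ->
  H10pair (c *: u + v) (lin c G H).
Proof.
move=> [Lu uG au] [Lv vH av]; split; first exact: (ph_lin H2).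
  exact: weak_gradient_lin.
move=> e e0; pose d := e / (`|c| + 1); have c1 : 0 < `|c| + 1 by rewrite ltr_wpDl.
have d0 : 0 < d by rewrite divr_gt0.
have [p1 [G1 [t1 w1 n1 m1]]] := au d d0; have [p2 [G2 [t2 w2 n2 m2]]] := av d d0.
have L1 : L2 Om (u - p1) by apply: (phB H2) => //; exact: tf_L2.
have L2' : L2 Om (v - p2) by apply: (phB H2) => //; exact: tf_L2.
have E : c *: u + v - (c *: p1 + p2) = c *: (u - p1) + (v - p2).
  by rewrite scalerBr opprD addrACA.
have le_e x y : L2 Om x -> L2 Om y -> nrm x <= d -> nrm y <= d -> nrm (c *: x + y) <= e.
  move=> /L2_sqint Lx /L2_sqint Ly xd yd.
  apply: (le_trans (ler_nrmD mOm (phZ HS c Lx) Ly)); rewrite nrmDZ//.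
  rewrite (_ : e = `|c| * d + d); last by rewrite /d; field; rewrite gt_eqF.
  by apply: lerD => //; apply: ler_wpM2l.
exists (c *: p1 + p2), (lin c G1 G2); split.
- exact: tf_lin.
- by rewrite E; exact: weak_gradient_lin.
- by rewrite E; exact: le_e.
- by move=> i; apply: le_e => //; [exact: (w1 i).1|exact: (w2 i).1].
Qed.

Lemma H10_L2 y : H10 Om y -> L2 Om y.
Proof. by move=> [[]]. Qed.

Lemma H10_weak_gradient y : H10 Om y -> weak_gradient Om y (grad Om y).
Proof. by move=> [[_ ey] _]; exact: getPex ey. Qed.

Lemma H10_pair y : H10 Om y -> H10pair y (grad Om y).
Proof.
move=> Hy; have Ly := H10_L2 Hy; have wy := H10_weak_gradient Hy; split => // e e0.
have [phi tphi le] := Hy.2 e e0; exists phi, (grad Om (y - phi)).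
have Lp := tf_L2 tphi; have Lyp := phB H2 Ly Lp.
have wyp : weak_gradient Om (y - phi) (grad Om (y - phi)).
  (* [get] returns a weak gradient of [y - phi] only if one exists, so one is exhibited. *)
  apply: getPex; exists (lin (-1) (fun i => partial i phi) (grad Om y)).
  rewrite -[X in weak_gradient _ X]/(y - phi) (_ : y - phi = (-1) *: phi + y).
    by apply: weak_gradient_lin => //; exact: tf_weak_gradient.
  by rewrite scaleN1r addrC.
have [h1 h2] := ler_sqrt_sumr (L2norm Om (y - phi)) (fun i => L2norm Om (grad Om (y - phi) i)).
split => //.
- rewrite -L2normE//; apply: le_trans (ler_norm _) (le_trans h1 (ltW le)).
- move=> i; rewrite -L2normE; last exact: (wyp i).1.
  exact: le_trans (ler_norm _) (le_trans (h2 i) (ltW le)).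
Qed.

(* [phi'' := d_i d_i phi] is itself a test function, so the weak gradient [G] *)
(* of [u] need not be unique for [u ~ phi] to control [|d_i phi|] by [|G i|]. *)
Lemma H10pair_poincare : exists2 C : R, 0 <= C & forall u G i, H10pair u G ->
  nrm u <= C * nrm (G i).
Proof.
have [C C0 hC] := tf_poincare Om; exists C => // u G i [Lu wu au].
apply/ler_addgt0Pr => e e0; pose d := e / (C + 1).
have C1 : 0 < C + 1 by rewrite ltr_wpDl.
have d0 : 0 < d by rewrite divr_gt0.
have [phi [g [tphi wg n1 m1]]] := au d d0.
have t' := tf_partial i tphi; have t'' := tf_partial i t'.
have Lp := tf_L2 tphi; have Lp' := tf_L2 t'; have Lp'' := tf_L2 t''.
have Lg := (wg i).1; have LG := (wu i).1.
have sp := L2_sqint Lp; have sp' := L2_sqint Lp'.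
have key : ip (partial i phi) (partial i phi) = ip (G i) (partial i phi) - ip (g i) (partial i phi).
  have e1 := tf_ibp i tphi t'; have e2 := (wu i).2 _ t'; have e3 := (wg i).2 _ t'.
  by move: e3; rewrite (ipBl H2)// e2 e1 opprK => <-; rewrite addrA subrr add0r.
have le1 : nrm (partial i phi) <= nrm (G i) + d.
  have [p0|p0] := eqVneq (nrm (partial i phi)) 0.
    by rewrite p0 addr_ge0 ?nrmD_ge0// ltW.
  have pp : 0 < nrm (partial i phi) by rewrite lt_neqAle eq_sym p0 nrmD_ge0.
  rewrite -(ler_pM2l pp) -expr2 nrmD_ip// -[leLHS]/(ip (partial i phi) (partial i phi)) key.
  have b1 := ipD_le mOm (L2_sqint LG) sp'; have b2 := ipD_le mOm (L2_sqint Lg) sp'.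
  rewrite mulrDr; apply: lerD.
    by rewrite mulrC; exact: le_trans (ler_norm _) b1.
  rewrite mulrC; apply: (le_trans (ler_norm _)); rewrite normrN; apply: (le_trans b2).
  by rewrite ler_wpM2r ?nrmD_ge0.
rewrite -[u](subrK phi).
apply: (le_trans (ler_nrmD mOm (L2_sqint (phB H2 Lu Lp)) sp)).
have := hC phi i tphi; have := ler_wpM2l C0 le1.
have -> : C * nrm (G i) + e = C * (nrm (G i) + d) + d.
  by rewrite /d; field; rewrite gt_eqF.
lra.
Qed.

Lemma closure_compact : compact (closure O).
Proof.
have [M M0 hM] := domain_ball Om; apply: bounded_closed_compact; last exact: closed_closure.
exists M; split=> [|N MN x Cx]; first exact: num_real.
apply: le_trans (ltW MN).
have : closed [set x : T | `|x| <= M].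
  apply: (@closed_comp _ _ (fun x : T => `|x|) [set y | y <= M]).
    by move=> z _; exact: norm_continuous.
  exact: closed_le.
move=> cB; have : closure O `<=` [set z : T | `|z| <= M] by rewrite closureE; apply: smallest_sub.
exact.
Qed.

Lemma within_closure_bounded y : {within closure O, continuous y} ->
  exists2 M : R, 0 < M & forall x, closure O x -> `|y x| <= M.
Proof.
move=> cy; have : compact (y @` closure O) by apply: continuous_compact => //; exact: closure_compact.
move=> /compact_bounded[B [_ hB]]; exists (`|B| + 1); first by rewrite ltr_wpDl.
by move=> x Cx; apply: hB; [rewrite ltr_pwDr// ler_norm|exists x].
Qed.

Definition supnorm y : R := sup [set `|y x| | x in closure O].

Lemma supnorm_ge y x : {within closure O, continuous y} -> closure O x ->
  `|y x| <= supnorm y.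
Proof.
move=> /within_closure_bounded[M _ hM] Cx; apply: ub_le_sup; last by exists x.
by exists M => _ [z Cz <-]; exact: hM.
Qed.

Lemma supnorm_le y B : (forall x, closure O x -> `|y x| <= B) -> supnorm y <= B.
Proof.
move=> h; apply: ge_sup => [|_ [x Cx <-]]; last exact: h.
have [x Ox] := @domain_nonempty _ _ Om.
by exists `|y x|, x => //; exact: subset_closure.
Qed.

Lemma supnorm_ge0 y : 0 <= supnorm y.
Proof.
have [x Ox] := @domain_nonempty _ _ Om.
have [hb|hb] := pselect (has_sup [set `|y x| | x in closure O]).
  apply: (le_trans (normr_ge0 (y x))); apply: ub_le_sup; first exact: hb.2.
  by exists x => //; exact: subset_closure.
(* Without a supremum, [sup] takes the default value 0. *)
by rewrite /supnorm sup_out.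
Qed.

Lemma supnorm_le_Ynorm y : supnorm y <= Ynorm Om y.
Proof. by rewrite /Ynorm lerDr sqrtr_ge0. Qed.

Lemma Ynorm_ge y x : {within closure O, continuous y} -> closure O x ->
  `|y x| <= Ynorm Om y.
Proof. by move=> cy Cx; apply: le_trans (supnorm_ge cy Cx) (supnorm_le_Ynorm y). Qed.

Lemma open_lebesgue_gt0 (A : set T) : open A -> A !=set0 -> (0 < lebesgue_rV n A)%E.
Proof.
move=> oA [x Ax]; have /nbhs_ballP[e /= e0 xeA] : nbhs x A by exact: open_nbhs_nbhs.
pose B := [set z : T | forall i, x ord0 i - e / 2 <= z ord0 i <= x ord0 i + e / 2].
have BE : B = [set z : T | `|z - x| <= e / 2].
  apply/seteqP; split => z h.
    by apply: rV_norm_le => [|i]; [rewrite divr_ge0// ltW|rewrite !mxE ler_distl; exact: h].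
  move=> i; rewrite -ler_distl.
  by have := le_trans (coord_le_norm _ i) h; rewrite !mxE.
have mB : measurable B.
  rewrite BE; have mN : measurable_fun setT (fun z : T => `|z - x|).
    apply: continuous_measurable_rV => z; apply: continuous_comp; last exact: norm_continuous.
    by apply: continuousB; [exact: cvg_id|exact: cst_continuous].
  have := mN measurableT _ (measurable_itv `]-oo, (e / 2)]).
  by rewrite setTI; congr measurable.
have BA : B `<=` A.
  move=> z; rewrite BE /= => h; apply: xeA; rewrite -ball_normE/= distrC.
  by apply: le_lt_trans h _; rewrite ltr_pdivrMr// ltr_pMr// ltr1n.
apply: (@lt_le_trans _ _ (lebesgue_rV n B)); last first.
  by apply: le_measure => //; rewrite inE//; exact: open_measurable_rV.
rewrite (@lebesgue_rV_box R n (fun i => x ord0 i - e / 2) (fun i => x ord0 i + e / 2)).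
  rewrite prodEFin lte_fin; apply: prodr_gt0 => i _; lra.
by move=> i; lra.
Qed.

(** A violation inside the domain would hold on a nonempty open set, which has positive measure;
    boundary points follow by continuity. With [B = 0] this turns an identity in L^2 between
    continuous functions into a pointwise one. *)
Lemma ae_le_closure y B : {within closure O, continuous y} ->
  {ae mu, forall x, O x -> `|y x| <= B} -> forall x, closure O x -> `|y x| <= B.
Proof.
move=> cy yB.
have inO x : O x -> `|y x| <= B.
  move=> Ox; rewrite leNgt; apply/negP => Byx.
  have oO := @domain_open _ _ Om.
  have cO z : O z -> y w @[w --> z] --> y z.
    move=> Oz; have : {within O, continuous y}.
      by apply: continuous_subspaceW cy; exact: subset_closure.
    by rewrite continuous_open_subspace// => /(_ z (mem_set Oz)).
  pose A := [set z | O z /\ B < `|y z|].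
  have open_int (V : set T) : V `<=` V^° -> open V by rewrite openE.
  have oA : open A.
    apply: open_int => z [Oz Bz]; apply: filterI; first exact: open_nbhs_nbhs.
    have e0 : 0 < `|y z| - B by rewrite subr_gt0.
    move/cvgrPdist_lt: (cO z Oz) => /(_ _ e0); apply: filterS => w /=.
    have := ler_normD (y z - y w) (y w); rewrite subrK.
    by move: `|y z| `|y w| `|_ - _| => a b c; lra.
  have [N [mN N0 AN]] := yB.
  have : (0 < lebesgue_rV n A)%E by apply: open_lebesgue_gt0 => //; exists x.
  rewrite -(@lebesgue_onE _ _ Om) => [| z []//|]; last exact: open_measurable_rV.
  rewrite ltNge => /negP; apply; rewrite -N0; apply: le_measure; rewrite ?inE//.
    exact: open_measurable_rV.
  by move=> z [Oz Bz]; apply: AN => /(_ Oz); rewrite leNgt Bz.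
move=> x Cx; apply/ler_addgt0Pr => e e0.
have : y z @[z --> within (closure O) (nbhs x)] --> y x.
  by move: (cy x); rewrite /continuous_at nbhs_subspace_in.
move=> /cvgrPdist_le/(_ e e0) h.
have [z [Oz zx]] := Cx _ h.
rewrite -[y x](subrK (y z)); apply: (le_trans (ler_normD _ _)); rewrite addrC.
by apply: lerD; [exact: inO|apply: zx; exact: subset_closure].
Qed.

End h10.

(** * The nonlinearity and the bilinear form *)

Section caratheodory.
Context d (T : measurableType d) (R : realType) (D : set T).
Hypothesis mD : measurable D.
Implicit Types (f : T -> R -> R) (y : T -> R).

Let measurable_floor_preimage y (z : int) : measurable_fun D y ->
  measurable (D `&` [set x | Num.floor (y x) = z]).
Proof.
move=> my; have := my mD _ (measurable_itv `[z%:~R, (z + 1)%:~R[).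
congr measurable; apply/seteqP; split => x /= [Dx]; rewrite in_itv/= => h; split => //.
  exact: floor_def.
by rewrite -h; exact: Num.Theory.floor_itv.
Qed.

(** [g k] rounds [y] down to multiples of [1 / k.+1]. It takes countably many values, so
    [f x (g k x)] is measurable piece by piece, and continuity of [f x] passes to the limit. *)
Lemma caratheodory_measurable f y : (forall t, measurable_fun D (f ^~ t)) ->
  (forall x, D x -> continuous (f x)) -> measurable_fun D y ->
  measurable_fun D (fun x => f x (y x)).
Proof.
move=> mf cf my.
pose g (k : nat) x : R := (Num.floor (k.+1%:R * y x))%:~R / k.+1%:R.
apply: (@measurable_fun_cvg _ _ _ D (fun k x => f x (g k x))) => [k|x Dx].
- move=> _ B mB.
  have mky : measurable_fun D (fun x => k.+1%:R * y x).
    by apply: measurable_funM => //; exact: measurable_cst.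
  rewrite (_ : D `&` _ = \bigcup_(z : int)
      ((D `&` [set x | Num.floor (k.+1%:R * y x) = z]) `&`
       (D `&` (f ^~ (z%:~R / k.+1%:R)) @^-1` B))).
    apply: countable_bigcupT_measurable => [|z]; first exact: countableP.
    apply: measurableI; first exact: measurable_floor_preimage.
    exact: mf.
  apply/seteqP; split => [x /= [Dx Bx]|x [z _ [[Dx /= zx] [_ /= Bx]]]].
    by exists (Num.floor (k.+1%:R * y x)).
  by split => //=; rewrite /g zx.
- suff gy : g k x @[k --> \oo] --> y x by exact: cvg_comp gy (cf x Dx (y x)).
  apply/cvgrPdist_le => e e0.
  have [N hN] := ltr_invS_exists e0.
  exists N => // k /= Nk; apply: le_trans (hN k Nk).
  have k0 : 0 < k.+1%:R :> R by [].
  have /andP[h1 h2] := Num.Theory.floor_itv (k.+1%:R * y x).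
  have -> : y x - g k x = (k.+1%:R * y x - (Num.floor (k.+1%:R * y x))%:~R) / k.+1%:R.
    by rewrite mulrBl mulrAC mulfV ?mul1r// gt_eqF.
  rewrite normrM [X in _ * X]ger0_norm ?invr_ge0// ler_piMl ?invr_ge0//.
  by move: h2; rewrite intrD ger0_norm; lra.
Qed.

Lemma derive1_measurable f t : (forall s, measurable_fun D (f ^~ s)) ->
  (forall x, D x -> derivable (f x) t 1) ->
  measurable_fun D (fun x => derive1 (f x) t).
Proof.
move=> mf df; pose h (k : nat) : R := k.+1%:R^-1.
apply: (@measurable_fun_cvg _ _ _ D (fun k x => (h k)^-1 * (f x (h k + t) - f x t))) => [k|x Dx].
  apply: measurable_funM; first exact: measurable_cst.
  by apply: measurable_funB; exact: mf.
rewrite derive1E; have dfx : _ --> 'D_1 (f x) t := df x Dx.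
have hcvg : h k @[k --> \oo] --> 0^'.
  move=> B nB.
  have hB : \forall k \near \oo, h k != 0 -> B (h k) by exact: (@cvg_harmonic R _ nB).
  by apply: filterS hB => k; apply; rewrite /h invr_eq0.
have := cvg_comp _ _ hcvg dfx.
by apply: cvg_trans; apply: near_eq_cvg; near=> k => /=; rewrite -[_ *: 1]/(_ * 1) mulr1.
Unshelve. all: by end_near. Qed.

End caratheodory.

Section mvt.
Context {R : realType}.

Lemma mvt_real (g : R -> R) (s t : R) : (forall x, derivable g x 1) ->
  exists2 c, (Num.min s t <= c <= Num.max s t) & g t - g s = derive1 g c * (t - s).
Proof.
move=> dg.
have cg x : {for x, continuous g}.
  by apply: differentiable_continuous; apply/derivable1_diffP.
have key (a b : R) : a < b -> exists2 c, a <= c <= b & g b - g a = derive1 g c * (b - a).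
  move=> ab; have [||c + ->] := @MVT R g (derive1 g) a b ab.
  - by move=> x _; rewrite derive1E; exact: derivableP.
  - by apply: continuous_subspaceT => x; exact: cg.
  - by rewrite in_itv/= => /andP[ac cb]; exists c => //; rewrite !ltW.
have [st|ts|->] := ltgtP s t.
- exact: key.
- have [c cst e] := key _ _ ts; exists c => //.
  by rewrite -opprB e; ring.
- by exists t; rewrite ?lexx// !subrr mulr0.
Qed.

Lemma abs_between (M s t c : R) : `|s| <= M -> `|t| <= M ->
  (Num.min s t <= c <= Num.max s t) -> `|c| <= M.
Proof.
rewrite !ler_norml => /andP[s1 s2] /andP[t1 t2] /andP[].
by rewrite ge_min le_max => /orP[] ? /orP[] ?; apply/andP; split; lra.
Qed.

End mvt.

Section forms.
Context {R : realType} {n : nat}.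
Variable Om : lipschitzDomain R n.
Local Notation mu := (lebesgue_on Om : {measure set 'rV[R]_n -> \bar R}).
Local Notation T := ('rV[R]_n).
Local Notation O := (domain_set Om).
Notation sq := (sqint mu O).
Notation nrm := (nrmD mu O).
Notation ip := (L2inner Om).
Notation ig f := (mu.-integrable O (EFin \o f)).
Implicit Types (u v y : T -> R) (G H : 'I_n -> T -> R).
Let mOm := measurable_domain Om.
Let Ofin := lebesgue_on_lty Om.
Let HS := prehilbert_sqint mu mOm.

(** The mean value theorem on [[-M, M]], applied to [f x] and to its derivative. The null set is
    independent of [s] and [t], so states may be substituted for them. *)
Lemma nonlinearity_bounds q f M : admissible_nonlinearity Om q f -> 0 < M ->
  exists2 C : R, 0 < C & {ae mu, forall x, O x -> forall s t, `|s| <= M -> `|t| <= M ->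
    [/\ 0 <= derive1 (f x) t, derive1 (f x) t <= C,
        `|derive1 (f x) t - derive1 (f x) s| <= C * `|t - s|,
        `|f x t - f x s| <= C * `|t - s| &
        0 <= (f x t - f x s) * (t - s)]}.
Proof.
move=> [[mf df] _ f0 fM _] M0; have [C C0 hC] := fM M M0; exists C => //.
move: f0 hC; apply: filterS2 => x f'0 hC Ox s t sM tM.
have [d1 d2 _] := df x Ox.
have f'C r : `|r| <= M -> derive1 (f x) r <= C.
  by move=> /hC; have := ler_norm (derive1 (f x) r); have := normr_ge0 (derive1n 2 (f x) r); lra.
have f''C r : `|r| <= M -> `|derive1 (derive1 (f x)) r| <= C.
  by move=> /hC; rewrite -[derive1n 2 _ _]/(derive1 (derive1 (f x)) r);
    have := normr_ge0 (derive1 (f x) r); lra.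
have [c c1 e1] := mvt_real s t d1; have [c' c2 e2] := mvt_real s t d2.
have cM := abs_between sM tM c1; have c'M := abs_between sM tM c2.
split => //; first exact: f'C.
- by rewrite e2 normrM ler_wpM2r// f''C.
- by rewrite e1 normrM ler_wpM2r// ger0_norm// f'C.
- by rewrite e1 -mulrA -expr2 mulr_ge0// sqr_ge0.
Qed.

Section elliptic.
Variable a : 'I_n -> 'I_n -> T -> R.
Hypothesis ella : elliptic_coefficients Om a.

Definition sqv G := forall i, sq (G i).

(** A form on vector fields rather than functions: it is bilinear in [G] and [H], whereas
    [bilinear_form] passes through [grad], which is not known to be linear. *)
Definition bform (b : 'I_n -> 'I_n -> T -> R) G H : R :=
  \sum_(i < n) \sum_(j < n) ip (fun x => b i j x * G i x) (H j).

Lemma sqv_lin c G H : sqv G -> sqv H -> sqv (lin c G H).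
Proof. by move=> sG sH i; exact: (ph_lin HS). Qed.

Lemma coefficient_sqint i j u : sq u -> sq (fun x => a i j x * u x).
Proof.
move=> su; have [ca _] := ella; have caij := ca i j.
have [M M0 hM] := within_closure_bounded caij.
have OO := @subset_closure _ O.
apply: (@ae_le_sqint _ _ _ mu _ mOm _ (M *: u)); last first.
- apply: aeW => x Ox; rewrite normrM -[X in _ <= `|X|]/(M * u x) normrM ler_wpM2r//.
  exact: le_trans (hM x (OO _ Ox)) (ler_norm _).
- exact: (phZ HS).
apply: measurable_funM; last exact: su.1.
apply: open_continuous_measurable_rV; first exact: domain_open.
have : {within O, continuous (a i j)} by apply: continuous_subspaceW caij.
by rewrite continuous_open_subspace; [move=> h x Ox; apply: h; rewrite inE|exact: domain_open].
Qed.

Lemma bform_linl c G G' H : sqv G -> sqv G' -> sqv H ->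
  bform a (lin c G G') H = c * bform a G H + bform a G' H.
Proof.
move=> sG sG' sH; rewrite /bform mulr_sumr -big_split/=; apply: eq_bigr => i _.
rewrite mulr_sumr -big_split/=; apply: eq_bigr => j _.
rewrite -[RHS](ph_ipl HS); [|exact: coefficient_sqint..|exact: sH].
apply: eq_Rintegral => x _; congr (_ * _).
by rewrite -[lin c G G' i x]/(c * G i x + G' i x) -[RHS]/(c * (a i j x * G i x) + a i j x * G' i x); ring.
Qed.

Lemma bform_linr c G H H' : sqv G -> sqv H -> sqv H' ->
  bform a G (lin c H H') = c * bform a G H + bform a G H'.
Proof.
move=> sG sH sH'; rewrite /bform mulr_sumr -big_split/=; apply: eq_bigr => i _.
rewrite mulr_sumr -big_split/=; apply: eq_bigr => j _.
have sa := coefficient_sqint i j (sG i).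
suff e : ipD mu O (fun x => a i j x * G i x) (c *: H j + H' j) =
    c * ipD mu O (fun x => a i j x * G i x) (H j) + ipD mu O (fun x => a i j x * G i x) (H' j) by [].
by rewrite (ipDr HS) ?(ipZr HS)//; exact: (phZ HS).
Qed.

(** Brings the adjoint equation, whose coefficients are transposed, to [bform a] with the test
    function in the first slot, where it meets the linearized equation. *)
Lemma bform_transpose G H : bform (fun i j => a j i) G H = bform a H G.
Proof.
rewrite /bform exchange_big/=; apply: eq_bigr => i _; apply: eq_bigr => j _.
by apply: eq_Rintegral => x _; ring.
Qed.

Let Rintegral_sum (I : Type) (r : seq I) (F : I -> T -> R) : (forall i, ig (F i)) ->
  ig (fun x => \sum_(i <- r) F i x) /\
  \int[mu]_(x in O) (\sum_(i <- r) F i x) = \sum_(i <- r) \int[mu]_(x in O) F i x.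
Proof.
move=> iF; elim: r => [|i r [ih1 ih2]].
  rewrite big_nil; under eq_fun do rewrite big_nil.
  split; first exact: ig_cst.
  by rewrite /Rintegral integral0.
have E : (fun x => \sum_(i <- i :: r) F i x) = (fun x => F i x + \sum_(i <- r) F i x).
  by apply/funext => x; rewrite big_cons.
by rewrite E big_cons -ih2 RintegralD//; split => //; exact: igD.
Qed.

Lemma bform_coercive : exists2 lam : R, 0 < lam & forall G, sqv G ->
  lam * \sum_(i < n) nrm (G i) ^+ 2 <= bform a G G.
Proof.
have [_ [lam lam0 ell]] := ella; exists lam => // G sG.
have iaG i j : ig (fun x => a i j x * G i x * G j x).
  by apply: (sqint_mul mOm) => //; exact: coefficient_sqint.
have [_ e1] := Rintegral_sum (index_enum 'I_n) (fun i => (sG i).2).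
have -> : \sum_(i < n) nrm (G i) ^+ 2 = \int[mu]_(x in O) \sum_(i < n) G i x ^+ 2.
  by rewrite e1; apply: eq_bigr => i _; exact: nrmD_sq.
have i1 := (Rintegral_sum (index_enum 'I_n) (fun i => (sG i).2)).1.
rewrite -RintegralZl//.
have i2 i := (Rintegral_sum (index_enum 'I_n) (iaG i)).1.
have e2 i := (Rintegral_sum (index_enum 'I_n) (iaG i)).2.
have [i3 e3] := Rintegral_sum (index_enum 'I_n) i2.
have -> : bform a G G = \int[mu]_(x in O) \sum_(i < n) \sum_(j < n) a i j x * G i x * G j x.
  by rewrite e3; apply: eq_bigr => i _; rewrite e2.
apply: ae_le_Rintegral => //; first exact: igZ.
apply: filterS ell => x h Ox; have := h (\row_i G i x).
under eq_bigr do rewrite mxE.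
by under [X in _ <= X -> _]eq_bigr do under eq_bigr do rewrite !mxE.
Qed.

End elliptic.
End forms.

(** * Smoothing operators *)

Section operators.
Context {R : realType} {n : nat}.
Variable Om : lipschitzDomain R n.
Local Notation mu := (lebesgue_on Om : {measure set 'rV[R]_n -> \bar R}).
Local Notation T := ('rV[R]_n).
Local Notation O := (domain_set Om).
Notation sq := (sqint mu O).
Notation nrm := (nrmD mu O).
Notation ip := (L2inner Om).
Notation ig f := (mu.-integrable O (EFin \o f)).
Implicit Types (u v w y g h : T -> R).
Let mOm := measurable_domain Om.
Let Ofin := lebesgue_on_lty Om.
Let HS := prehilbert_sqint mu mOm.
Let H2 := prehilbert_L2 Om.

Lemma L2_ipC u v : ip u v = ip v u.
Proof. exact: (ph_sym H2). Qed.

Lemma ip_le u v : L2 Om u -> L2 Om v -> `|ip u v| <= nrm u * nrm v.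
Proof. by move=> Lu Lv; apply: (ipD_le mOm); exact: L2_sqint. Qed.

Lemma nrm_le_sup y (B : R) : sq y -> 0 <= B -> (forall x, O x -> `|y x| <= B) ->
  nrm y <= nrm (fun=> 1) * B.
Proof.
move=> sy B0 yB; have s1 := sqint_cst mOm Ofin 1.
rewrite mulrC -[X in X * _]ger0_norm// -nrmDZ//; apply: ae_le_nrmD => //.
  exact: (phZ HS).
by apply: aeW => x Ox; rewrite -[X in _ <= `|X|]/(B * 1) mulr1 [leRHS]ger0_norm// yB.
Qed.

(** Meant for a [v] that is a product of two L^2 functions: its L^1 norm is what Cauchy-Schwarz
    controls. *)
Lemma ip_le_sup u v (B : R) : sq u -> sq v -> (forall x, O x -> `|u x| <= B) ->
  `|ip u v| <= B * \int[mu]_(x in O) `|v x|.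
Proof.
move=> su sv uB; have iuv := sqint_mul mOm su sv; have iv := sqint_ig mOm Ofin sv.
apply: (le_trans (le_normr_Rintegral mOm iuv)).
rewrite -RintegralZl//; last exact: ig_norm.
apply: le_Rintegral => //; first exact: ig_norm.
  by apply: igZ => //; exact: ig_norm.
by move=> x Ox; rewrite normrM ler_wpM2r// uB.
Qed.

Variables D Dadj : (T -> R) -> T -> R.
Hypothesis DL2 : forall h, L2 Om h -> L2 Om (D h).
Hypothesis Dlin : forall c h k x, L2 Om h -> L2 Om k -> O x ->
  D (c *: h + k) x = c * D h x + D k x.
Hypothesis Dsup : exists2 C : R, 0 <= C & forall h x, L2 Om h -> O x -> `|D h x| <= C * nrm h.

Lemma operator_bounded : exists2 C : R, 0 <= C & forall h, L2 Om h -> nrm (D h) <= C * nrm h.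
Proof.
have [C C0 hC] := Dsup; exists (nrm (fun=> 1) * C); first by rewrite mulr_ge0 ?nrmD_ge0.
move=> h Lh; rewrite -mulrA; apply: nrm_le_sup.
- exact/L2_sqint/DL2.
- by rewrite mulr_ge0 ?nrmD_ge0.
- by move=> x Ox; exact: hC.
Qed.

Let D0 x : O x -> D 0 x = 0.
Proof.
have [C C0 hC] := Dsup => Ox; have := hC 0 x (ph0 H2) Ox.
by rewrite -[nrm 0]/(Num.sqrt (ip 0 0)) (nrm0 H2) mulr0 normr_le0 => /eqP.
Qed.

Let Dsum (es : seq (T -> R)) (c : nat -> R) x m : (forall i, L2 Om es`_i) -> O x ->
  D (\sum_(i < m) c i *: es`_i) x = \sum_(i < m) c i * D es`_i x.
Proof.
move=> Les Ox; elim: m => [|m ih]; first by rewrite !big_ord0 D0.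
rewrite !big_ord_recr/= addrC Dlin// ?ih 1?addrC//.
by apply: (ph_sum H2) => i; exact: (phZ H2).
Qed.

(* Bessel's inequality for the functionals [h |-> D h x]: test with *)
(* [h = \sum_i D e_i x *: e_i].                                       *)
Let bessel (C : R) (es : seq (T -> R)) x :
  (forall h x, L2 Om h -> O x -> `|D h x| <= C * nrm h) ->
  (forall i, L2 Om es`_i) -> orthonormal ip es -> O x ->
  \sum_(i < size es) (D es`_i x) ^+ 2 <= C ^+ 2.
Proof.
move=> hC Les oes Ox; pose s := \sum_(i < size es) (D es`_i x) ^+ 2.
pose h := \sum_(i < size es) D es`_i x *: es`_i.
have Lc (i : 'I_(size es)) : L2 Om (D es`_i x *: es`_i) by exact: (phZ H2).
have Lh : L2 Om h by exact: (ph_sum H2).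
have Dh : D h x = s.
  by rewrite (@Dsum es (fun i => D es`_i x))//; apply: eq_bigr => i _; rewrite expr2.
have hh : ip h h = s.
  rewrite {1}/h (ip_suml H2)//; apply: eq_bigr => i _.
  rewrite (ipZl H2)// L2_ipC /h (ip_suml H2)// (bigD1 i)//= (ipZl H2)// oes// eqxx mulr1.
  rewrite big1 ?addr0 ?expr2// => j ji; rewrite (ipZl H2)// oes//.
  by have /negbTE -> : (j != i :> nat) by []; rewrite mulr0.
have s0 : 0 <= s by apply: sumr_ge0 => i _; exact: sqr_ge0.
have nh : nrm h ^+ 2 = s by rewrite (nrm_sq H2).
have := hC h x Lh Ox; rewrite Dh ger0_norm// -/s => sC.
have n0 := nrmD_ge0 mu O h; rewrite -nh in sC *.
have [->|hn0] := eqVneq (nrm h) 0; first by rewrite expr0n/= sqr_ge0.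
have hp : 0 < nrm h by rewrite lt_neqAle eq_sym hn0.
move: sC; rewrite expr2 ler_pM2r// => hC'.
by rewrite -expr2 ler_pXn2r// ?nnegrE// (le_trans n0).
Qed.

(** Bessel's bound holds at each point with the same [C]; integrating it over the domain gives a
    bound independent of [es]. *)
Let hilbert_schmidt (C : R) (es : seq (T -> R)) :
  (forall h x, L2 Om h -> O x -> `|D h x| <= C * nrm h) ->
  (forall i, L2 Om es`_i) -> orthonormal ip es ->
  \sum_(i < size es) nrm (D es`_i) ^+ 2 <= \int[mu]_(x in O) C ^+ 2.
Proof.
move=> hC Les oes.
have sD i : sq (D es`_i) by exact/L2_sqint/DL2.
suff key m : (m <= size es)%N -> ig (fun x => \sum_(i < m) D es`_i x ^+ 2) /\
    \sum_(i < m) nrm (D es`_i) ^+ 2 = \int[mu]_(x in O) \sum_(i < m) D es`_i x ^+ 2.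
  have [i1 ->] := key _ (leqnn _); apply: le_Rintegral => //; first exact: ig_cst.
  by move=> x Ox; exact: bessel.
elim: m => [_|m ih mes].
  under eq_fun do rewrite big_ord0.
  split; first exact: ig_cst.
  by rewrite big_ord0 /Rintegral integral0.
have [i1 e1] := ih (ltnW mes).
under eq_fun do rewrite big_ord_recr/=.
split; first by apply: igD => //; exact: (sD m).2.
rewrite big_ord_recr/= e1 RintegralD//; last exact: (sD m).2.
by rewrite nrmD_sq.
Qed.

Lemma operator_compact (I : Type) (F : set_system I) (FF : Filter F) (h : I -> T -> R) (B : R) :
  (forall i, L2 Om (h i)) -> (\forall i \near F, nrm (h i) <= B) ->
  (forall v, L2 Om v -> ip (h i) v @[i --> F] --> 0) ->
  nrm (D (h i)) @[i --> F] --> 0.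
Proof.
move=> Lh hB hw; have [C C0 hC] := Dsup.
apply: (@hilbert_schmidt_compact _ _ _ _ D I F FF h B _ Lh hB hw).
apply: (hilbert_schmidt_approx H2 (B := \int[mu]_(x in O) C ^+ 2)) => //.
- move=> c x y Lx Ly; apply: (ae_nrmD_eq0 mOm).
    apply: L2_sqint; apply: (phB H2); first by apply: DL2; exact: (ph_lin H2).
    by apply: (ph_lin H2); exact: DL2.
  by apply: aeW => t Ot; rewrite -[LHS]/(D (c *: x + y) t - (c * D x t + D y t)) Dlin// subrr.
- by have [B' _ hB'] := operator_bounded; exists B'.
- by move=> es Les oes; exact: hilbert_schmidt.
Qed.

Hypothesis adj : L2_adjoint Om D Dadj.

Lemma adjoint_L2 w : L2 Om w -> L2 Om (Dadj w).
Proof. by move=> /adj[]. Qed.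

Lemma adjointE w v : L2 Om w -> L2 Om v -> ip (D v) w = ip v (Dadj w).
Proof. by move=> /adj[_]; apply. Qed.

Let self_le w (B : R) : L2 Om w -> 0 <= B -> ip (D (Dadj w)) w <= B * nrm (Dadj w) -> nrm (Dadj w) <= B.
Proof.
move=> Lw B0; have La := adjoint_L2 Lw; rewrite adjointE// -[ip _ _]/(ipD mu O _ _) -nrmD_ip//.
  have [->//|n0] := eqVneq (nrm (Dadj w)) 0.
  by rewrite expr2 ler_pM2r// lt_neqAle eq_sym n0 nrmD_ge0.
exact: L2_sqint.
Qed.

Lemma adjoint_bounded : exists2 C : R, 0 <= C & forall w, L2 Om w -> nrm (Dadj w) <= C * nrm w.
Proof.
have [C C0 hC] := operator_bounded; exists C => // w Lw.
have La := adjoint_L2 Lw; apply: self_le => //; first by rewrite mulr_ge0 ?nrmD_ge0.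
apply: (le_trans (ler_norm _)); apply: (le_trans (ip_le (DL2 La) Lw)).
by rewrite mulrAC ler_wpM2r ?nrmD_ge0// hC.
Qed.

(** [L2_adjoint] does not ask for linearity of [Dadj]; uniqueness supplies it up to norm zero. *)
Lemma adjoint_unique w z : L2 Om w -> L2 Om z ->
  (forall v, L2 Om v -> ip (D v) w = ip v z) -> nrm (Dadj w - z) = 0.
Proof.
move=> Lw Lz h; set e := Dadj w - z; have La := adjoint_L2 Lw.
have Le : L2 Om e by exact: (phB H2).
have ee : ip e e = 0 by rewrite {2}/e (ipBr H2)// -adjointE// h// subrr.
by rewrite -[nrm e]/(Num.sqrt (ip e e)) ee sqrtr0.
Qed.

(** [|Dadj h|^2 = (D (Dadj h), h) <= |D (Dadj h)| |h|]. The functions [Dadj (h i)] are bounded and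
    tend weakly to 0, so compactness of [D] makes the first factor vanish. *)
Lemma adjoint_compact (I : Type) (F : set_system I) (FF : Filter F) (h : I -> T -> R) (B : R) :
  (forall i, L2 Om (h i)) -> (\forall i \near F, nrm (h i) <= B) ->
  (forall v, L2 Om v -> ip (h i) v @[i --> F] --> 0) ->
  nrm (Dadj (h i)) @[i --> F] --> 0.
Proof.
move=> Lh hB hw; have [C C0 hC] := adjoint_bounded.
pose B' := `|B| + 1; have B'0 : 0 < B' by rewrite ltr_wpDl.
have hB' : \forall i \near F, nrm (h i) <= B'.
  by apply: filterS hB => i; have := ler_norm B; rewrite /B'; lra.
have La i := adjoint_L2 (Lh i).
have : nrm (D (Dadj (h i))) @[i --> F] --> 0.
  apply: (@operator_compact _ _ _ _ (C * B')) => //.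
    by apply: filterS hB' => i hi; apply: (le_trans (hC _ (Lh i))); rewrite ler_wpM2l.
  move=> v Lv; apply: cvg_trans (hw (D v) (DL2 Lv)).
  by under eq_cvg do rewrite L2_ipC -adjointE// L2_ipC.
move=> /cvgr0Pnorm_le k; apply/cvgr0Pnorm_le => e e0.
have := k (e ^+ 2 / B') ltac:(by rewrite divr_gt0// exprn_gt0).
move: hB'; apply: filterS2 => i hi; rewrite !ger0_norm ?nrmD_ge0// => ki.
rewrite -(@ler_pXn2r _ 2)// ?nnegrE ?nrmD_ge0 ?(ltW e0)//.
rewrite (nrmD_ip mOm (L2_sqint (La i))).
rewrite -[ipD _ _ _ _]/(ip _ _) -adjointE//.
apply: (le_trans (ler_norm _)); apply: (le_trans (ip_le (DL2 (La i)) (Lh i))).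
have -> : e ^+ 2 = e ^+ 2 / B' * B' by rewrite mulfVK// gt_eqF.
by apply: ler_pM; rewrite ?nrmD_ge0.
Qed.

End operators.

(** * Control-to-state map *)

Section state_equation.
Context {R : realType} {n : nat}.
Variable Om : lipschitzDomain R n.
Local Notation mu := (lebesgue_on Om : {measure set 'rV[R]_n -> \bar R}).
Local Notation T := ('rV[R]_n).
Local Notation O := (domain_set Om).
Notation sq := (sqint mu O).
Notation nrm := (nrmD mu O).
Notation ig f := (mu.-integrable O (EFin \o f)).
Implicit Types (u v w y g h : T -> R) (G H : 'I_n -> T -> R).
Let mOm := measurable_domain Om.
Let Ofin := lebesgue_on_lty Om.
Let HS := prehilbert_sqint mu mOm.
Let H2 := prehilbert_L2 Om.

Lemma within_lin c y w : {within closure O, continuous y} -> {within closure O, continuous w} ->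
  {within closure O, continuous (c *: y + w)}.
Proof.
move=> cy cw x; apply: cvgD; last exact: cw.
by apply: cvgM; [exact: cvg_cst|exact: cy].
Qed.

Lemma within_sub y w : {within closure O, continuous y} -> {within closure O, continuous w} ->
  {within closure O, continuous (y - w)}.
Proof.
by move=> cy cw; rewrite (_ : y - w = (-1) *: w + y); [exact: within_lin|rewrite scaleN1r addrC].
Qed.

Lemma Y_L2 y : Y Om y -> L2 Om y.
Proof. by move=> [/H10_L2]. Qed.

Lemma Y_sq y : Y Om y -> sq y.
Proof. by move=> /Y_L2/L2_sqint. Qed.

Lemma Y_bounded y : Y Om y -> exists2 M : R, 0 < M & forall x, O x -> `|y x| <= M.
Proof.
move=> [_ /within_closure_bounded[M M0 hM]]; exists M => // x Ox.
by apply: hM; exact: subset_closure.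
Qed.

(** * Pointwise estimates for [S] and its derivative *)

Section derivative_of_S.
Variables (S : (T -> R) -> T -> R) (dS : (T -> R) -> (T -> R) -> T -> R).
Hypothesis SY : forall u, L2 Om u -> Y Om (S u).
Hypothesis S2 : C2_with_derivative (L2 Om) (L2norm Om) (Y Om) (Ynorm Om) S dS.

Lemma dS_Y u h : L2 Om u -> L2 Om h -> Y Om (dS u h).
Proof. by move=> Lu; have [/(_ u Lu)[[]]] := S2; auto. Qed.

Lemma dS_L2 u h : L2 Om u -> L2 Om h -> L2 Om (dS u h).
Proof. by move=> Lu Lh; exact: Y_L2 (dS_Y Lu Lh). Qed.

(** The derivative is linear up to [Ynorm] zero, and [Ynorm] dominates the sup norm on the closure,
    so equality is pointwise. *)
Lemma dS_lin u c h k x : L2 Om u -> L2 Om h -> L2 Om k -> O x ->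
  dS u (c *: h + k) x = c * dS u h x + dS u k x.
Proof.
move=> Lu Lh Lk Ox; have [/(_ u Lu)[[_ hl _] _] _] := S2.
have ch := (dS_Y Lu Lh).2; have ck := (dS_Y Lu Lk).2.
have chk := (dS_Y Lu (ph_lin H2 c Lh Lk)).2.
have := Ynorm_ge (within_sub chk (@within_lin c _ _ ch ck)) (subset_closure Ox).
by rewrite hl// normr_le0 subr_eq0 => /eqP.
Qed.

Lemma dS_sup u : L2 Om u -> exists2 C : R, 0 <= C &
  forall h x, L2 Om h -> O x -> `|dS u h x| <= C * nrm h.
Proof.
move=> Lu; have [/(_ u Lu)[[_ _ [C hC]] _] _] := S2.
exists `|C| => // h x Lh Ox.
apply: (le_trans (Ynorm_ge (dS_Y Lu Lh).2 (subset_closure Ox))).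
apply: (le_trans (hC h Lh)); rewrite L2normE//.
by rewrite ler_wpM2r ?nrmD_ge0// ler_norm.
Qed.

Lemma S_differentiable u (e : R) : L2 Om u -> 0 < e -> exists2 d : R, 0 < d &
  forall h x, L2 Om h -> nrm h < d -> closure O x ->
    `|S (u + h) x - S u x - dS u h x| <= e * nrm h.
Proof.
move=> Lu e0; have [/(_ u Lu)[_ /(_ e e0)[d d0 hd]] _] := S2; exists d => // h x Lh hd' Cx.
rewrite -L2normE//; apply: le_trans (hd h Lh _); last by rewrite L2normE.
have cuh := (SY (phD H2 Lu Lh)).2; have cu := (SY Lu).2; have cd := (dS_Y Lu Lh).2.
exact: (Ynorm_ge (within_sub (within_sub cuh cu) cd) Cx).
Qed.

Lemma dS_closure_le u h (B : R) : L2 Om u -> L2 Om h ->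
  (forall x, O x -> `|dS u h x| <= B) -> forall x, closure O x -> `|dS u h x| <= B.
Proof.
move=> Lu Lh hB; apply: ae_le_closure; first exact: (dS_Y Lu Lh).2.
exact: aeW.
Qed.

Lemma S_continuous u (e : R) : L2 Om u -> 0 < e -> exists2 d : R, 0 < d &
  forall h x, L2 Om h -> nrm h < d -> closure O x -> `|S (u + h) x - S u x| <= e.
Proof.
move=> Lu e0; have [C C0 hC] := dS_sup Lu.
have [d d0 hd] := S_differentiable Lu ltr01.
have C1 : 0 < C + 1 by rewrite ltr_wpDl.
(* The remainder is at most [nrm h] and the derivative at most [C * nrm h], hence the factor
   [C + 1]. *)
exists (Num.min d (e / (C + 1))); first by rewrite lt_min d0 divr_gt0.
move=> h x Lh; rewrite lt_min => /andP[hd' he] Cx.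
rewrite -[_ - _](subrK (dS u h x)); apply: (le_trans (ler_normD _ _)).
have h1 := hd h x Lh hd' Cx.
have h2 := dS_closure_le Lu Lh (fun x Ox => hC h x Lh Ox) Cx.
move: he; rewrite ltr_pdivlMr// => he; move: h1 h2 he; rewrite mul1r.
by move: (`|_ - _ - _|) (`|dS u h x|) (nrm h) => A B N; lra.
Qed.

End derivative_of_S.

(** * Integrability of compositions with [f] *)

Section nonlinearity.
Variables (q : \bar R) (f : T -> R -> R).
Hypothesis q1 : (1 <= q)%E.
Hypothesis adm : admissible_nonlinearity Om q f.

Lemma nonlinearity_measurable y : sq y -> measurable_fun O (fun x => f x (y x)).
Proof.
move=> sy; have [[mf df] _ _ _ _] := adm.
apply: caratheodory_measurable => //; last exact: sy.1.
move=> x Ox t; have [d1 _ _] := df x Ox.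
by apply: differentiable_continuous; apply/derivable1_diffP.
Qed.

Lemma derivative_measurable y : sq y -> measurable_fun O (fun x => derive1 (f x) (y x)).
Proof.
move=> sy; have [[mf df] _ _ _ _] := adm.
apply: (@caratheodory_measurable _ _ _ _ mOm (fun x => derive1 (f x)) y) => //; last exact: sy.1.
  move=> t; apply: derive1_measurable => // x Ox.
  by have [d1 _ _] := df x Ox; exact: d1.
move=> x Ox t; have [_ d2 _] := df x Ox.
by apply: differentiable_continuous; apply/derivable1_diffP.
Qed.

Lemma nonlinearity_integrable y : Y Om y -> ig (fun x => f x (y x)).
Proof.
move=> Yy; have [M M0 hM] := Y_bounded Yy; have sy := Y_sq Yy.
have [C C0 hC] := nonlinearity_bounds adm M0.
have [_ f0 _ _ _] := adm.
have muT : mu setT \is a fin_num.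
  rewrite ge0_fin_numE// /= /lebesgue_on /mrestr setTI.
  by have := Ofin; rewrite /= /lebesgue_on /mrestr setIid.
have i0 : ig (f ^~ 0).
  have /Lfun1_integrable := Lfun_subset (lexx (1%E : \bar R)) q1 muT q1 f0.
  exact: integrableS.
have i1 := igD mOm (ig_norm i0) (ig_cst mOm Ofin (C * M)).
apply: (ae_le_integrable mOm (nonlinearity_measurable sy) i1).
apply: filterS hC => x h Ox; have yM := hM x Ox.
have [|_ _ _ fy _] := h Ox 0 (y x) _ yM; first by rewrite normr0 ltW.
rewrite subr0 in fy; rewrite -[f x (y x)](subrK (f x 0)).
apply: (le_trans (ler_normD _ _)); rewrite addrC lerD2l.
by apply: (le_trans fy); rewrite ler_wpM2l// ltW.
Qed.

Lemma linearized_sqint y u : Y Om y -> sq u -> sq (fun x => derive1 (f x) (y x) * u x).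
Proof.
move=> Yy su; have [M M0 hM] := Y_bounded Yy; have sy := Y_sq Yy.
have [C C0 hC] := nonlinearity_bounds adm M0.
apply: (@ae_le_sqint _ _ _ mu _ mOm _ (C *: u)).
- by apply: measurable_funM; [exact: derivative_measurable|exact: su.1].
- exact: (phZ HS).
apply: filterS hC => x h Ox; have yM := hM x Ox; have [h1 h2 _ _ _] := h Ox _ _ yM yM.
rewrite normrM -[X in _ <= `|X|]/(C * u x) normrM ler_wpM2r//.
by rewrite !ger0_norm// ltW.
Qed.

(** The Lipschitz bound on bounded ranges puts the difference in L^2, although each term is only
    known to be integrable. *)
Lemma increment_sqint y w : Y Om y -> Y Om w -> sq (fun x => f x (y x) - f x (w x)).
Proof.
move=> Yy Yw; have [M1 M10 hM1] := Y_bounded Yy; have [M2 M20 hM2] := Y_bounded Yw.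
have M0 : 0 < M1 + M2 by rewrite addr_gt0.
have [C C0 hC] := nonlinearity_bounds adm M0.
apply: (@ae_le_sqint _ _ _ mu _ mOm _ (C *: (y - w))).
- by apply: measurable_funB; apply: nonlinearity_measurable; exact: Y_sq.
- by apply: (phZ HS); apply: (phB HS); exact: Y_sq.
apply: filterS hC => x h Ox.
have y1 : `|y x| <= M1 + M2 by apply: (le_trans (hM1 x Ox)); rewrite lerDl ltW.
have w1 : `|w x| <= M1 + M2 by apply: (le_trans (hM2 x Ox)); rewrite lerDr ltW.
have [_ _ _ h1 _] := h Ox _ _ w1 y1.
by rewrite -[X in _ <= `|X|]/(C * (y x - w x)) normrM (gtr0_norm C0).
Qed.

(** [f x (y x)] is only known to be integrable, so its integral against a test function is split
    only when that function is bounded. This is why the state equations are tested in [Y]. *)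
Lemma L1_bounded_integrable g w : ig g -> Y Om w -> ig (fun x => g x * w x).
Proof.
move=> ig_g Yw; have [M M0 hM] := Y_bounded Yw.
have igM := igZ mOm M (ig_norm ig_g).
apply: (@le_integrableR _ _ _ _ _ mOm _ _ _ igM).
  by apply: measurable_funM; [exact: ig_meas ig_g|exact: (Y_sq Yw).1].
by move=> x Ox; rewrite normrM mulrC ler_wpM2r// hM.
Qed.

End nonlinearity.
End state_equation.

(** * Differences of states and the linearized equation *)

Section perturbation.
Context {R : realType} {n : nat}.
Variable n_gt0 : (0 < n)%N.
Variable Om : lipschitzDomain R n.
Local Notation mu := (lebesgue_on Om : {measure set 'rV[R]_n -> \bar R}).
Local Notation T := ('rV[R]_n).
Local Notation O := (domain_set Om).
Notation sq := (sqint mu O).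
Notation nrm := (nrmD mu O).
Notation ip := (L2inner Om).
Implicit Types (u v w y g h : T -> R) (G H : 'I_n -> T -> R).
Let mOm := measurable_domain Om.
Let HS := prehilbert_sqint mu mOm.
Let H2 := prehilbert_L2 Om.

Variables (a : 'I_n -> 'I_n -> T -> R) (f : T -> R -> R) (q : \bar R).
Variables (S : (T -> R) -> T -> R) (dS : (T -> R) -> (T -> R) -> T -> R).
Variable ubar : T -> R.
Hypothesis ella : elliptic_coefficients Om a.
Hypothesis q1 : (1 <= q)%E.
Hypothesis adm : admissible_nonlinearity Om q f.
Hypothesis SS : forall u, L2 Om u -> weak_solution Om a f u (S u).
Hypothesis S2 : C2_with_derivative (L2 Om) (L2norm Om) (Y Om) (Ynorm Om) S dS.
Hypothesis dSw : forall v h, L2 Om v -> L2 Om h ->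
  weak_solution Om a (linearized f (S v)) h (dS v h).
Hypothesis Lub : L2 Om ubar.

Let SY u : L2 Om u -> Y Om (S u). Proof. by move=> /SS[]. Qed.
Local Notation yb := (S ubar).
Let Yb : Y Om yb := SY Lub.
Local Notation D := (dS ubar).
Let cb (x : T) : R := derive1 (f x) (yb x).
Let Fi u (x : T) : R := f x (S u x) - f x (yb x).
Let i0 : 'I_n := Ordinal n_gt0.

Let SE u w : L2 Om u -> Y Om w ->
  bform Om a (grad Om (S u)) (grad Om w) + ip (fun x => f x (S u x)) w = ip u w.
Proof. by move=> Lu Yw; exact: (SS Lu).2 w Yw.1. Qed.

Lemma grad_sqv y : H10 Om y -> sqv Om (grad Om y).
Proof. by move=> Hy i; apply: L2_sqint; exact: (H10_weak_gradient Hy i).1. Qed.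

(** Written as a combination so that [Gz u], built with [lin], is its gradient in the sense of
    [H10pair]. *)
Let z u : T -> R := (-1) *: yb + S u.
Let Gz u := lin (-1) (grad Om yb) (grad Om (S u)).

Lemma zE u : z u = S u - yb.
Proof. by rewrite /z scaleN1r addrC. Qed.

Let Lz u : L2 Om u -> L2 Om (z u).
Proof. by move=> Lu; apply: (ph_lin H2); apply: Y_L2 => //; exact: SY. Qed.

Let sGz u : L2 Om u -> sqv Om (Gz u).
Proof. by move=> Lu; apply: sqv_lin; apply: grad_sqv; [exact: Yb.1|exact: (SY Lu).1]. Qed.

Let sF u : L2 Om u -> sq (Fi u).
Proof. by move=> Lu; apply: (increment_sqint adm) => //; exact: SY. Qed.

Lemma difference_equation u w : L2 Om u -> Y Om w ->
  bform Om a (Gz u) (grad Om w) + ip (Fi u) w = ip (u - ubar) w.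
Proof.
move=> Lu Yw; have Lw := Y_L2 Yw; have sw := grad_sqv Yw.1.
have e1 := SE Lu Yw; have e2 := SE Lub Yw.
rewrite (bform_linl ella)//; [|exact: grad_sqv Yb.1|exact: grad_sqv (SY Lu).1].
have i1 := L1_bounded_integrable (nonlinearity_integrable q1 adm (SY Lu)) Yw.
have i2 := L1_bounded_integrable (nonlinearity_integrable q1 adm Yb) Yw.
have -> : ip (Fi u) w = ip (fun x => f x (S u x)) w - ip (fun x => f x (yb x)) w.
  rewrite /L2inner -RintegralB//; apply: eq_Rintegral => x _; rewrite /Fi; ring.
rewrite (ipBl H2)//.
have arith (b1 b2 s1 s2 r1 r2 : R) : b1 + s1 = r1 -> b2 + s2 = r2 ->
  -1 * b2 + b1 + (s1 - s2) = r1 - r2 by move=> <- <-; ring.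
exact: arith e1 e2.
Qed.

(** The gradient [Gz u] need not be [grad (z u)], so the difference equation is tested with [S u]
    and with [yb] separately, and the results are combined by bilinearity. *)
Lemma difference_energy u : L2 Om u ->
  bform Om a (Gz u) (Gz u) + ip (Fi u) (z u) = ip (u - ubar) (z u).
Proof.
move=> Lu; have Yu := SY Lu; have Lh := phB H2 Lu Lub.
have e1 := difference_equation Lu Yu; have e2 := difference_equation Lu Yb.
rewrite {2}/Gz (bform_linr ella)//; [|exact: sGz|exact: grad_sqv Yb.1|exact: grad_sqv Yu.1].
have LY := Y_L2 Yu; have Lb := Y_L2 Yb.
rewrite {1 2}/z.
have -> : ip (Fi u) ((-1) *: yb + S u) = - ip (Fi u) yb + ip (Fi u) (S u).
  have := ipDr HS (phZ HS (-1) (L2_sqint Lb)) (L2_sqint LY) (sF Lu).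
  rewrite (ipZr HS); [|exact: L2_sqint|exact: sF].
  by rewrite mulN1r.
rewrite (ipDr H2) ?(ipZr H2)//; last exact: (phZ H2).
have arith (b1 b2 s1 s2 r1 r2 : R) : b1 + s1 = r1 -> b2 + s2 = r2 ->
  -1 * b2 + b1 + (- s2 + s1) = -1 * r2 + r1 by move=> <- <-; ring.
exact: arith e1 e2.
Qed.

Lemma z_H10pair u : L2 Om u -> H10pair Om (z u) (Gz u).
Proof.
by move=> Lu; apply: H10pair_lin; apply: H10_pair; [exact: Yb.1|exact: (SY Lu).1].
Qed.

Let coercive_poincare : exists2 C : R, 0 <= C & forall y G, H10pair Om y G -> sqv Om G ->
  nrm y ^+ 2 <= C * bform Om a G G.
Proof.
have [C C0 hC] := H10pair_poincare Om; have [lam lam0 hl] := bform_coercive ella.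
exists (C ^+ 2 / lam); first by rewrite divr_ge0 ?sqr_ge0// ltW.
move=> y G yG sG; have h1 := hC y G i0 yG.
have h2 : lam * nrm (G i0) ^+ 2 <= bform Om a G G.
  apply: le_trans (hl G sG); rewrite ler_pM2l// (bigD1 i0)//= lerDl.
  by apply: sumr_ge0 => i _; exact: sqr_ge0.
apply: (@le_trans _ _ ((C * nrm (G i0)) ^+ 2)).
  by rewrite ler_pXn2r// ?nnegrE ?mulr_ge0 ?nrmD_ge0.
rewrite exprMn -mulrA ler_wpM2l ?sqr_ge0// mulrC ler_pdivlMr// mulrC.
exact: h2.
Qed.

Let F_ge0 u : L2 Om u -> 0 <= ip (Fi u) (z u).
Proof.
move=> Lu; have [M1 M10 hM1] := Y_bounded (SY Lu); have [M2 M20 hM2] := Y_bounded Yb.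
have M0 : 0 < M1 + M2 by rewrite addr_gt0.
have [C C0 hC] := nonlinearity_bounds adm M0.
apply: (ae_ge0_Rintegral mOm).
  by apply: (sqint_mul mOm); [exact: sF|apply: L2_sqint; exact: Lz].
apply: filterS hC => x h Ox.
have y1 : `|S u x| <= M1 + M2 by apply: (le_trans (hM1 x Ox)); rewrite lerDl ltW.
have w1 : `|yb x| <= M1 + M2 by apply: (le_trans (hM2 x Ox)); rewrite lerDr ltW.
by have [_ _ _ _] := h Ox _ _ w1 y1; rewrite zE.
Qed.

(** The monotonicity of [f] discards the nonlinear term. The pairing is kept on the right instead of
    a product of norms, since only the pairing profits from weak convergence of the controls. *)
Lemma energy_estimate : exists2 C : R, 0 <= C & forall u, L2 Om u ->
  nrm (z u) ^+ 2 <= C * ip (u - ubar) (z u).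
Proof.
have [C C0 hC] := coercive_poincare; exists C => // u Lu.
apply: (le_trans (hC _ _ (z_H10pair Lu) (sGz Lu))); rewrite ler_wpM2l//.
by rewrite -(difference_energy Lu) lerDl; exact: F_ge0.
Qed.

(** The error of linearizing [f] at [yb]. Moved to the right-hand side, it makes the difference of
    states an exact solution of the linearized equation. *)
Let g u (x : T) : R := Fi u x - cb x * z u x.

Let sg u : L2 Om u -> sq (g u).
Proof.
move=> Lu; apply: (phB HS (x := Fi u)); first exact: sF.
by apply: (linearized_sqint adm) => //; apply: L2_sqint; exact: Lz.
Qed.

Definition rhs u : T -> R := (u - ubar) - (g u) \_ O.

Lemma rhs_L2 u : L2 Om u -> L2 Om (rhs u).
Proof.
move=> Lu; apply: (phB H2); first exact: (phB H2).
by apply: sqint_restrict_L2; exact: sg.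
Qed.

Let ip_restrict h w : ip (h \_ O) w = ip h w.
Proof. by apply: eq_Rintegral => x xO; rewrite patchE xO. Qed.

(** [z u] and [D (rhs u)] solve the same linearized equation; their difference [dl] solves the
    homogeneous one, and coercivity with Poincare's inequality forces its norm to vanish. The bound
    of [D] from L^2 to the sup norm thus becomes available for [z u]. *)
Lemma representation u : L2 Om u -> nrm (z u - D (rhs u)) = 0.
Proof.
move=> Lu; have Lk := rhs_L2 Lu; set k := rhs u in Lk *.
have [YD eD] := dSw Lub Lk.
pose dl := (-1) *: z u + D k; pose G := lin (-1) (Gz u) (grad Om (D k)).
have LD := Y_L2 YD; have Lzu := Lz Lu; have sGzu := sGz Lu; have sGD := grad_sqv YD.1.
have Ldl : L2 Om dl by exact: (ph_lin H2).
have scdl : sq (fun x => cb x * dl x) by apply: (linearized_sqint adm) => //; exact: L2_sqint.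
have scz : sq (fun x => cb x * z u x) by apply: (linearized_sqint adm) => //; exact: L2_sqint.
have scD : sq (fun x => cb x * D k x) by apply: (linearized_sqint adm) => //; exact: L2_sqint.
have sG : sqv Om G by exact: sqv_lin.
have star w : Y Om w -> bform Om a G (grad Om w) = - ip (fun x => cb x * dl x) w.
  move=> Yw; have Lw := Y_L2 Yw; have sw := L2_sqint Lw.
  have e1 := difference_equation Lu Yw; have e2 := eD w Yw.1.
  rewrite (bform_linl ella)//; last exact: grad_sqv Yw.1.
  have e3 : ip k w = ip (u - ubar) w - (ip (Fi u) w - ip (fun x => cb x * z u x) w).
    rewrite /k /rhs (ipBl H2) ?ip_restrict//; last 2 first.
    - exact: (phB H2).
    - by apply: sqint_restrict_L2; exact: sg.
    by congr (_ - _); exact: (ipBl HS (sF Lu) scz sw).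
  have e4 : ip (fun x => cb x * dl x) w = - ip (fun x => cb x * z u x) w + ip (fun x => cb x * D k x) w.
    rewrite -mulN1r; have <- := ph_ipl HS (-1) scz scD sw.
    apply: eq_Rintegral => x _; congr (_ * _).
    by rewrite -[RHS]/((-1) * (cb x * z u x) + cb x * D k x) -[dl x]/((-1) * z u x + D k x); ring.
  have e2' : bform Om a (grad Om (D k)) (grad Om w) + ip (fun x => cb x * D k x) w = ip k w by exact: e2.
  have arith (b1 b2 fi h' k' cz cD cd : R) : b1 + fi = h' -> k' = h' - (fi - cz) ->
    cd = - cz + cD -> b2 + cD = k' -> -1 * b1 + b2 = - cd.
    by move=> <- -> -> /(canRL (addrK _)) ->; ring.
  exact: arith e1 e3 e4 e2'.
have sdl := L2_sqint Ldl.
(* [star] tests with functions of [Y] and their chosen [grad]. As [G] combines the gradients of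
   [yb], [S u] and [D k], testing with [dl] goes through these three. *)
have e0 : bform Om a G G = - ip (fun x => cb x * dl x) dl.
  have Yu := SY Lu.
  have sb := grad_sqv Yb.1; have su := grad_sqv Yu.1.
  have [Lb LY] := (Y_L2 Yb, Y_L2 Yu).
  have b2 : bform Om a G G = -1 * bform Om a G (Gz u) + bform Om a G (grad Om (D k)).
    by apply: bform_linr.
  have b1 : bform Om a G (Gz u) = -1 * bform Om a G (grad Om yb) + bform Om a G (grad Om (S u)).
    by apply: bform_linr.
  have ipl c x y : L2 Om x -> L2 Om y ->
      ip (fun x => cb x * dl x) (c *: x + y) = c * ip (fun x => cb x * dl x) x + ip (fun x => cb x * dl x) y.
    move=> /L2_sqint sx /L2_sqint sy.
    by have := ph_ipl HS c sx sy scdl; rewrite !(ph_sym HS _ (fun x => cb x * dl x)).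
  have l2 := ipl (-1) _ _ Lzu LD; have l1 := ipl (-1) _ _ Lb LY.
  have arith (s1 s2 s3 t t' B B1 B2 B3 B4 : R) : B = -1 * B4 + B3 -> B4 = -1 * B1 + B2 ->
    B1 = - s1 -> B2 = - s2 -> B3 = - s3 -> t' = -1 * t + s3 -> t = -1 * s1 + s2 -> B = - t'.
    by move=> -> -> -> -> -> -> ->; ring.
  exact: (arith _ _ _ _ _ _ _ _ _ _ b2 b1 (star _ Yb) (star _ Yu) (star _ YD) l2 l1).
have [M M0 hM] := Y_bounded Yb; have [C C0 hC] := nonlinearity_bounds adm M0.
have ge0 : 0 <= ip (fun x => cb x * dl x) dl.
  apply: (ae_ge0_Rintegral mOm); first exact: (sqint_mul mOm).
  apply: filterS hC => x h Ox; have [h1 _ _ _ _] := h Ox _ _ (hM x Ox) (hM x Ox).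
  by rewrite -mulrA -expr2 mulr_ge0// sqr_ge0.
have [C' C'0 hC'] := coercive_poincare.
have dG : H10pair Om dl G.
  by apply: H10pair_lin; [exact: z_H10pair|apply: H10_pair; exact: YD.1].
have := hC' _ _ dG sG; rewrite e0 => le0.
have : nrm dl ^+ 2 <= 0 by apply: (le_trans le0); rewrite mulrN oppr_le0 mulr_ge0.
rewrite exprn_even_le0//= => /eqP ndl.
have -> : z u - D k = - dl by rewrite /dl scaleN1r opprD opprK.
by rewrite nrmDN.
Qed.

Lemma energy_bound : exists2 C : R, 0 <= C & forall u, L2 Om u ->
  nrm (S u - yb) ^+ 2 <= C * ip (u - ubar) (S u - yb).
Proof.
by have [C C0 hC] := energy_estimate; exists C => // u Lu; rewrite -zE; exact: hC.
Qed.

Lemma representation_bounded M : 0 < M -> (forall x, O x -> `|yb x| <= M) ->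
  exists2 C : R, 0 < C & forall u, L2 Om u -> (forall x, O x -> `|S u x| <= M) ->
  exists g, [/\ L2 Om g, nrm g <= C * nrm (S u - yb) &
    forall x, closure O x -> S u x - yb x = D (u - ubar - g) x].
Proof.
move=> M0 bM; have [C C0 hC] := nonlinearity_bounds adm M0.
(* One [C] comes from the Lipschitz bound on [f], the other from the bound on the coefficient
   [cb]. *)
exists (C + C); first by rewrite addr_gt0.
move=> u Lu uM; exists (g u \_ O); have Lg := sqint_restrict_L2 (sg Lu).
have sz := L2_sqint (Lz Lu).
split => //.
- rewrite restrict_nrm -zE -[C + C]ger0_norm ?addr_ge0 ?(ltW C0)// -nrmDZ//.
  apply: ae_le_nrmD => //; [exact: sg|exact: (phZ HS)|].
  apply: filterS hC => x h Ox; have [h1 h2 _ h3 _] := h Ox _ _ (bM x Ox) (uM x Ox).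
  have [k1 k2 _ _ _] := h Ox _ _ (bM x Ox) (bM x Ox).
  rewrite -[X in _ <= `|X|]/((C + C) * z u x) normrM ger0_norm ?addr_ge0 ?(ltW C0)//.
  apply: (le_trans (ler_normB _ _)); rewrite mulrDl zE; apply: lerD => //.
  by rewrite normrM ler_wpM2r// /cb ger0_norm.
- have rep := representation Lu; rewrite zE in rep.
  have Lk := rhs_L2 Lu; have Yk := dS_Y S2 Lub Lk; have Yu := SY Lu.
  have cz := within_sub (within_sub Yu.2 Yb.2) Yk.2.
  have sD : sq (S u - yb - D (rhs u)).
    by apply: L2_sqint; apply: (phB H2); [apply: (phB H2)|]; exact: Y_L2.
  have ae0 : {ae mu, forall x, O x -> `|(S u - yb - D (rhs u)) x| <= 0}.
    by apply: filterS (nrmD_eq0_ae mOm sD rep) => x h Ox; rewrite h// normr0.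
  move=> x Cx; apply/eqP; rewrite -subr_eq0 -normr_le0.
  exact: (ae_le_closure cz ae0 Cx).
Qed.

End perturbation.

(** * Adjoint states *)

Section adjoint_state.
Context {R : realType} {n : nat}.
Variable n_gt0 : (0 < n)%N.
Variable Om : lipschitzDomain R n.
Local Notation mu := (lebesgue_on Om : {measure set 'rV[R]_n -> \bar R}).
Local Notation T := ('rV[R]_n).
Local Notation O := (domain_set Om).
Notation sq := (sqint mu O).
Notation nrm := (nrmD mu O).
Notation ip := (L2inner Om).
Implicit Types (u v w y g h : T -> R) (G H : 'I_n -> T -> R).
Let mOm := measurable_domain Om.
Let HS := prehilbert_sqint mu mOm.
Let H2 := prehilbert_L2 Om.

Variables (a : 'I_n -> 'I_n -> T -> R) (f : T -> R -> R) (q : \bar R).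
Variables (S : (T -> R) -> T -> R) (dS dSadj : (T -> R) -> (T -> R) -> T -> R).
Variables (p : (T -> R) -> T -> R) (yd : T -> R).
Variable ubar : T -> R.
Hypothesis ella : elliptic_coefficients Om a.
Hypothesis q1 : (1 <= q)%E.
Hypothesis adm : admissible_nonlinearity Om q f.
Hypothesis SS : forall u, L2 Om u -> weak_solution Om a f u (S u).
Hypothesis S2 : C2_with_derivative (L2 Om) (L2norm Om) (Y Om) (Ynorm Om) S dS.
Hypothesis dSw : forall v h, L2 Om v -> L2 Om h ->
  weak_solution Om a (linearized f (S v)) h (dS v h).
Hypothesis adj : forall v, L2 Om v -> L2_adjoint Om (dS v) (dSadj v).
Hypothesis Lyd : L2 Om yd.
Hypothesis pst : adjoint_state Om a f yd S p.
Hypothesis Lub : L2 Om ubar.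

Let SY u : L2 Om u -> Y Om (S u). Proof. by move=> /SS[]. Qed.
Local Notation yb := (S ubar).
Let Yb : Y Om yb := SY Lub.
Local Notation D := (dS ubar).
Local Notation Dadj := (dSadj ubar).

Let compact (I : Type) (F : set_system I) (FF : Filter F) (h : I -> T -> R) (B : R) :
  (forall i, L2 Om (h i)) -> (\forall i \near F, nrm (h i) <= B) ->
  (forall v, L2 Om v -> ip (h i) v @[i --> F] --> 0) ->
  nrm (Dadj (h i)) @[i --> F] --> 0.
Proof.
apply: (@adjoint_compact _ _ _ D) => //.
- by move=> k; exact: dS_L2 S2 _ _ Lub.
- by move=> c k k' x; exact: (dS_lin S2).
- by have [Cd ? ?] := dS_sup S2 Lub; exists Cd.
- exact: adj.
Qed.

Let segment_cont h : L2 Om h -> continuous (fun t : R => supnorm Om (S (ubar + t *: h) - yb)).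
Proof.
move=> Lh s; apply/cvgrPdist_le => e e0.
have Lt t : L2 Om (ubar + t *: h) by apply: (phD H2) => //; exact: (phZ H2).
have [d d0 hd] := S_continuous SY S2 (Lt s) e0.
have n1 : 0 < nrm h + 1 by rewrite ltr_wpDl// nrmD_ge0.
near=> t.
have ts : `|t - s| * nrm h < d.
  have : `|s - t| < d / (nrm h + 1).
    by near: t; apply: (@cvgr_dist_lt _ _ _ _ _ id) => //; rewrite divr_gt0.
  rewrite distrC ltr_pdivlMr//; apply: le_lt_trans.
  by rewrite ler_wpM2l// lerDl.
have cl x : closure O x -> `|S (ubar + t *: h) x - S (ubar + s *: h) x| <= e.
  have -> : ubar + t *: h = (ubar + s *: h) + (t - s) *: h.
    by rewrite -addrA -scalerDl (addrC s) subrK.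
  apply: hd; first exact: (phZ H2).
  by rewrite nrmDZ//; exact: L2_sqint.
have cz r := within_sub (SY (Lt r)).2 Yb.2.
have tri (b1 b2 b3 s0 : R) : `|b1 - b2| <= e -> `|b2 - b3| <= s0 -> `|b1 - b3| <= s0 + e.
  move=> h1 h2; rewrite -(subrKA b2 b1 (- b3)) addrC.
  by apply: (le_trans (ler_normD _ _)); exact: lerD.
have le1 : supnorm Om (S (ubar + t *: h) - yb) <= supnorm Om (S (ubar + s *: h) - yb) + e.
  by apply: supnorm_le => x Cx; apply: tri (cl x Cx) (supnorm_ge (cz s) Cx).
have le2 : supnorm Om (S (ubar + s *: h) - yb) <= supnorm Om (S (ubar + t *: h) - yb) + e.
  apply: supnorm_le => x Cx; apply: tri (supnorm_ge (cz t) Cx).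
  by rewrite distrC; exact: cl.
by rewrite ler_distlC; apply/andP; split; lra.
Unshelve. all: by end_near. Qed.

(* A continuation argument along the segment from [ubar] to [u i]: as long as *)
(* [|z_t| <= 2 r], the nonlinearity is Lipschitz along the states, so         *)
(* [z_t = D (t h - g_t)] with [|g_t|_2 <= C |z_t|_2]; since [|z_t|_2] is      *)
(* small by compactness and the energy estimate, in fact [|z_t| <= r].        *)
Lemma states_bounded (I : Type) (F : set_system I) (FF : Filter F) (u : I -> T -> R) (B : R) :
  (forall i, L2 Om (u i)) -> (\forall i \near F, nrm (u i - ubar) <= B) ->
  (forall v, L2 Om v -> ip (u i - ubar) v @[i --> F] --> 0) ->
  exists2 M : R, 0 < M & (forall x, O x -> `|yb x| <= M) /\
    \forall i \near F, forall x, O x -> `|S (u i) x| <= M.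
Proof.
move=> Lu uB uw; have [Cd Cd0 hCd] := dS_sup S2 Lub; have [My My0 hMy] := Y_bounded Yb.
pose B' := `|B| + 1; have B'0 : 0 < B' by rewrite ltr_wpDl.
(* [Cd * B'] bounds the linear part [D (t *: h)] and [1] is reserved for the nonlinear part; the gap
   to exclude is between [r] and [2 * r]. *)
pose r := Cd * B' + 1; have r0 : 0 < r by rewrite ltr_wpDl// mulr_ge0// ltW.
pose M := My + 2 * r; have M0 : 0 < M by rewrite addr_gt0// mulr_gt0.
have hMyM x : O x -> `|yb x| <= M.
  by move=> Ox; apply: (le_trans (hMy x Ox)); rewrite lerDl mulr_ge0// ltW.
exists M => //; split => //.
have [C C0 rep] := representation_bounded n_gt0 ella q1 adm SS S2 dSw Lub M0 hMyM.
have [CE CE0 en] := energy_bound n_gt0 ella q1 adm SS Lub.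
(* Bounds [nrm k] for the data [k] with [z = D k], as long as [|z| <= 2 * r]. *)
pose K := B' + C * (nrm (fun=> 1) * (2 * r)).
have K0 : 0 <= K by rewrite addr_ge0 ?mulr_ge0 ?nrmD_ge0// ltW.
(* Once [nrm z <= e1], the nonlinear part of [z] is at most [Cd * C * e1 <= 1] in the sup norm. *)
pose e1 := (Cd * C + 1)^-1.
have Cd1 : 0 < Cd * C + 1 by rewrite ltr_wpDl// mulr_ge0// ltW.
have e10 : 0 < e1 by rewrite invr_gt0.
have CEK1 : 0 < CE * K + 1 by rewrite ltr_wpDl// mulr_ge0.
have Lh i : L2 Om (u i - ubar) by exact: (phB H2).
have Th0 := compact FF Lh uB uw.
(* With this threshold the energy bound [CE * K * nrm (Dadj h)] is at most [e1 ^+ 2]. *)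
have : \forall i \near F, nrm (Dadj (u i - ubar)) <= e1 ^+ 2 / (CE * K + 1).
  move/cvgr0Pnorm_le: Th0 => /(_ (e1 ^+ 2 / (CE * K + 1)) ltac:(by rewrite divr_gt0// exprn_gt0)).
  by apply: filterS => i; apply: le_trans; exact: ler_norm.
move: uB; apply: filterS2 => i hB hT; set h := u i - ubar in hB hT.
have Lhi : L2 Om h by exact: Lh.
have La : L2 Om (Dadj h) by have [] := adj Lub Lhi.
have hB' : nrm h <= B' by apply: (le_trans hB); have := ler_norm B; rewrite /B'; lra.
have Lt t : L2 Om (ubar + t *: h) by apply: (phD H2) => //; exact: (phZ H2).
pose phi t := supnorm Om (S (ubar + t *: h) - yb).
have cz t := within_sub (SY (Lt t)).2 Yb.2.
have claim t : 0 <= t <= 1 -> phi t <= 2 * r -> phi t <= r.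
  move=> /andP[t0 t1] pt; set z := S (ubar + t *: h) - yb.
  have zle x : O x -> `|z x| <= 2 * r.
    by move=> Ox; apply: (le_trans (supnorm_ge (cz t) (subset_closure Ox))).
  have yM x : O x -> `|S (ubar + t *: h) x| <= M.
    move=> Ox; rewrite -[S _ x](subrK (yb x)); apply: (le_trans (ler_normD _ _)).
    by rewrite addrC; apply: lerD; [exact: hMy|exact: zle].
  have [g [Lg gz zE]] := rep _ (Lt t) yM.
  set k := ubar + t *: h - ubar - g in zE.
  have kE : k = t *: h - g by rewrite /k (addrC ubar) addrK.
  have Lk : L2 Om k by rewrite kE; apply: (phB H2) => //; exact: (phZ H2).
  have Lz : L2 Om z by apply: (phB H2); apply: Y_L2 => //; exact: SY.
  have nk : nrm k <= B' + C * nrm z.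
    rewrite kE; apply: (le_trans (ler_nrmB mOm (phZ HS t (L2_sqint Lhi)) (L2_sqint Lg))).
    apply: lerD => //; rewrite nrmDZ//; last exact: L2_sqint.
    by rewrite ger0_norm//; apply: le_trans hB'; rewrite ler_piMl// nrmD_ge0.
  have nz : nrm z <= nrm (fun=> 1) * (2 * r).
    by apply: nrm_le_sup => //; [exact: L2_sqint|rewrite mulr_ge0// ltW].
  have nkK : nrm k <= K.
    by apply: (le_trans nk); rewrite lerD2l ler_wpM2l// ltW.
  (* [z] is [D k] on the domain, so the energy pairing moves onto [Dadj h], which is small, while
     [k] is merely bounded. *)
  have hz : ip (t *: h) z = t * ip k (Dadj h).
    rewrite (ipZl H2)//; congr (_ * _).
    rewrite -(adjointE (adj Lub) Lhi Lk) L2_ipC.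
    apply: eq_Rintegral => x xO; congr (_ * _).
    by apply: zE; apply: subset_closure; exact: set_mem.
  have nz2 : nrm z <= e1.
    rewrite -(@ler_pXn2r _ 2)// ?nnegrE ?nrmD_ge0 ?(ltW e10)//.
    have := en _ (Lt t); rewrite -/z (addrC ubar) addrK hz => /le_trans; apply.
    have kT : `|ip k (Dadj h)| <= K * (e1 ^+ 2 / (CE * K + 1)).
      by apply: (le_trans (ip_le Lk La)); apply: ler_pM; rewrite ?nrmD_ge0.
    have tk : t * ip k (Dadj h) <= K * (e1 ^+ 2 / (CE * K + 1)).
      apply: le_trans kT; apply: (le_trans (ler_norm _)); rewrite normrM.
      by rewrite ler_piMl// ger0_norm.
    apply: (le_trans (ler_wpM2l CE0 tk)).
    rewrite [leLHS](_ : _ = e1 ^+ 2 * ((CE * K) / (CE * K + 1))); last first.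
      by rewrite (mulrCA K) (mulrCA CE) !mulrA.
    by rewrite ler_piMr ?sqr_ge0// ler_pdivrMr// mul1r lerDl.
  have zE' x : closure O x -> z x = D k x by exact: zE.
  apply: supnorm_le => x Cx; rewrite -[_ x]/(z x) zE'//.
  have Dk x' : O x' -> `|D k x'| <= r.
    move=> Ox; apply: (le_trans (hCd k x' Lk Ox)).
    apply: (@le_trans _ _ (Cd * (B' + C * e1))).
      by rewrite ler_wpM2l//; apply: (le_trans nk); rewrite lerD2l ler_wpM2l// ltW.
    rewrite mulrDr lerD2l mulrA /e1 ler_pdivrMr//; lra.
  exact: (dS_closure_le S2 Lub Lk Dk Cx).
have phi1 : phi 1 <= 2 * r.
  rewrite leNgt; apply/negP => h1.
  have phi0 : phi 0 = 0.
    apply/eqP; rewrite eq_le supnorm_ge0 andbT; apply: supnorm_le => x _.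
    by rewrite scale0r addr0 subrr normr0.
  (* [phi] starts at 0, so it would attain [2 * r], where [claim] says [2 * r <= r]. *)
  have [||c c01 pc] := @IVT R phi 0 1 (2 * r) ler01.
  - by apply: continuous_subspaceT => s; exact: segment_cont.
  - rewrite phi0 (min_idPl _) ?(max_idPr _) ?supnorm_ge0// mulr_ge0 ?(ltW r0)//=; exact: ltW.
  - move: c01; rewrite in_itv/= => c01.
    by have := claim c c01; rewrite pc lexx => /(_ isT); lra.
have uE : ubar + 1 *: h = u i by rewrite scale1r /h addrC subrK.
have := @cz 1; move: phi1; rewrite /phi uE => phi1 cu x Ox.
rewrite -[S _ x](subrK (yb x)); apply: (le_trans (ler_normD _ _)).
rewrite addrC; apply: lerD; first exact: hMy.
by apply: le_trans phi1; exact: (supnorm_ge cu (subset_closure Ox)).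
Qed.

Let pY u : L2 Om u -> Y Om (p u). Proof. by move=> /pst[]. Qed.
Local Notation pb := (p ubar).
Let c u (x : T) : R := derive1 (f x) (S u x).
Let cd u (x : T) : R := c u x - c ubar x.

Let adjoint_equation u v : L2 Om u -> Y Om v ->
  bform Om a (grad Om v) (grad Om (p u)) + ip (fun x => c u x * p u x) v = ip (S u - yd) v.
Proof. by move=> Lu Yv; rewrite -bform_transpose; exact: (pst Lu).2 v Yv.1. Qed.

Let linearized_equation u v w : L2 Om u -> L2 Om v -> Y Om w ->
  bform Om a (grad Om (dS u v)) (grad Om w) + ip (fun x => c u x * dS u v x) w = ip v w.
Proof. by move=> Lu Lv Yw; exact: (dSw Lu Lv).2 w Yw.1. Qed.

Let ip_mulC (b v w : T -> R) : ip (fun x => b x * v x) w = ip (fun x => b x * w x) v.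
Proof. by apply: eq_Rintegral => x _; rewrite mulrAC. Qed.

(** The adjoint equation and the linearized one, each tested with the solution of the other, share
    their left-hand side. This is what makes [p u] the gradient of the objective. *)
Lemma adjoint_state_gradient u v : L2 Om u -> L2 Om v ->
  ip v (p u) = ip (S u - yd) (dS u v).
Proof.
move=> Lu Lv; have e1 := adjoint_equation Lu (dS_Y S2 Lu Lv).
have e2 := linearized_equation Lu Lv (pY Lu).
by rewrite -e2 -e1 ip_mulC.
Qed.

Let sc u y : L2 Om u -> sq y -> sq (fun x => c u x * y x).
Proof. by move=> Lu sy; exact: (linearized_sqint adm (SY Lu) sy). Qed.

(** [w'] collects the terms bounded by the state error; [r] is the term that still contains the
    unknown difference of adjoint states. *)
Let w' u (x : T) : R := (S u x - yb x) - cd u x * pb x.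
Let r u (x : T) : R := cd u x * (p u x - pb x).

Let scd u y : L2 Om u -> sq y -> sq (fun x => cd u x * y x).
Proof.
move=> Lu sy; have := phB HS (sc Lu sy) (sc Lub sy); congr sqint.
by apply/funext => x; rewrite /cd mulrBl.
Qed.

Let sw' u : L2 Om u -> sq (w' u).
Proof.
move=> Lu; apply: (phB HS (x := S u - yb)).
  by apply: (phB HS); apply: Y_sq; exact: SY.
by apply: scd => //; apply: Y_sq; exact: pY.
Qed.

Let sr u : L2 Om u -> sq (r u).
Proof.
by move=> Lu; apply: (scd (y := p u - pb)) => //; apply: (phB HS); apply: Y_sq; exact: pY.
Qed.

Let ip_sub4 (x1 x2 x3 x4 z : T -> R) : sq x1 -> sq x2 -> sq x3 -> sq x4 -> sq z ->
  ip ((x1 - x2) - (x3 - x4)) z = ip x1 z - ip x2 z - (ip x3 z - ip x4 z).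
Proof.
move=> s1 s2 s3 s4 sz.
transitivity (ip (x1 - x2) z - ip (x3 - x4) z).
  exact: (ipBl HS (phB HS s1 s2) (phB HS s3 s4) sz).
by congr (_ - _); [exact: (ipBl HS s1 s2 sz)|exact: (ipBl HS s3 s4 sz)].
Qed.

Let duality u v : L2 Om u -> L2 Om v ->
  ip v (p u - pb) = ip (w' u) (D v) - ip (r u) (D v).
Proof.
move=> Lu Lv; have Yz := dS_Y S2 Lub Lv; set z := D v in Yz *.
have Yp := pY Lu; have Yq := pY Lub; have sz := Y_sq Yz.
have Yu := SY Lu.
have sp := Y_sq Yp; have spb := Y_sq Yq.
have e1 := adjoint_equation Lu Yz; have e2 := adjoint_equation Lub Yz.
have e3 := linearized_equation Lub Lv Yp; have e4 := linearized_equation Lub Lv Yq.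
rewrite -/z ip_mulC in e3; rewrite -/z ip_mulC in e4.
have e5 : ip (w' u) z = ip (S u - yb) z - (ip (fun x => c u x * pb x) z - ip (fun x => c ubar x * pb x) z).
  transitivity (ip (S u - yb) z - ip ((fun x => c u x * pb x) - (fun x => c ubar x * pb x)) z).
    have <- := ipBl HS (phB HS (Y_sq Yu) (Y_sq Yb)) (phB HS (sc Lu spb) (sc Lub spb)) sz.
    by apply: eq_Rintegral => x _; congr (_ * _); rewrite /w' /cd mulrBl.
  by congr (_ - _); exact: (ipBl HS (sc Lu spb) (sc Lub spb) sz).
have e6 : ip (r u) z = (ip (fun x => c u x * p u x) z - ip (fun x => c u x * pb x) z) -
    (ip (fun x => c ubar x * p u x) z - ip (fun x => c ubar x * pb x) z).
  rewrite -(ip_sub4 (sc Lu sp) (sc Lu spb) (sc Lub sp) (sc Lub spb) sz).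
  apply: eq_Rintegral => x _; congr (_ * _); rewrite /r /cd.
  rewrite -[RHS]/((c u x * p u x - c u x * pb x) - (c ubar x * p u x - c ubar x * pb x)); ring.
have e7 : ip (S u - yb) z = ip (S u - yd) z - ip (yb - yd) z.
  have [Lz LSu Lyb] := And3 (Y_L2 Yz) (Y_L2 Yu) (Y_L2 Yb).
  by rewrite !(ipBl H2)//; ring.
have arith (A1 A2 P1 P2 P3 Q Y1 Y2 V1 V2 W Rr Z X : R) :
    A1 + P1 = Y1 -> A2 + Q = Y2 -> A1 + P2 = V1 -> A2 + Q = V2 ->
    W = Z - (P3 - Q) -> Rr = P1 - P3 - (P2 - Q) -> Z = Y1 - Y2 -> X = V1 - V2 -> X = W - Rr.
  by move=> <- <- <- <- -> -> -> ->; ring.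
have e8 : ip v (p u - pb) = ip v (p u) - ip v pb by apply: (ipBr H2) => //; exact: Y_L2.
exact: arith e1 e2 e3 e4 e5 e6 e7 e8.
Qed.

(* [D v] is bounded by [C |v|_2], so the adjoint of [D] maps L^1 to L^2; this *)
(* is what makes the remainder [cd (p u - pb)] quadratically small.           *)
Lemma adjoint_expansion (M : R) : 0 < M -> (forall x, O x -> `|yb x| <= M) ->
  exists2 C : R, 0 <= C & forall u, L2 Om u -> (forall x, O x -> `|S u x| <= M) ->
  exists w, [/\ L2 Om w, nrm w <= C * nrm (S u - yb) &
    nrm (p u - pb - Dadj w) <= C * nrm (S u - yb) * nrm (p u - pb)].
Proof.
move=> M0 bM; have [C C0 hC] := nonlinearity_bounds adm M0.
have [Cd Cd0 hCd] := dS_sup S2 Lub; have [Mp Mp0 hMp] := Y_bounded (pY Lub).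
have K0 : 0 <= 1 + C * Mp by rewrite addr_ge0// mulr_ge0// ltW.
have K1 : 0 <= Cd * C by rewrite mulr_ge0// ltW.
(* [1 + C * Mp] bounds [w] and [Cd * C] bounds the expansion error; the sum serves for both. *)
exists (1 + C * Mp + Cd * C); first exact: addr_ge0.
move=> u Lu uM; have sz : sq (S u - yb) by apply: (phB HS); apply: Y_sq; exact: SY.
have nz := nrmD_ge0 mu O (S u - yb).
have cdz : {ae mu, forall x, O x -> `|cd u x| <= C * `|S u x - yb x|}.
  by apply: filterS hC => x h Ox; have [_ _] := h Ox _ _ (bM x Ox) (uM x Ox).
have Lw := sqint_restrict_L2 (sw' Lu); set w := w' u \_ O in Lw.
have Ld : L2 Om (p u - pb) by apply: (phB H2); apply: Y_L2; exact: pY.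
have LT : L2 Om (Dadj w) by have [] := adj Lub Lw.
have sd := L2_sqint Ld.
have cdm : measurable_fun O (cd u).
  by apply: measurable_funB; apply: (derivative_measurable adm); apply: Y_sq; exact: SY.
have scdu : sq (cd u).
  apply: (@ae_le_sqint _ _ _ mu _ mOm _ (C *: (S u - yb))) => //; first exact: (phZ HS).
  apply: filterS cdz => x h Ox; rewrite -[X in _ <= `|X|]/(C * (S u x - yb x)) normrM.
  by rewrite (gtr0_norm C0) h.
have ncd : nrm (cd u) <= C * nrm (S u - yb).
  rewrite -[C in leRHS](gtr0_norm C0) -nrmDZ//; apply: ae_le_nrmD => //; first exact: (phZ HS).
  apply: filterS cdz => x h Ox; rewrite -[X in _ <= `|X|]/(C * (S u x - yb x)) normrM.
  by rewrite (gtr0_norm C0) h.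
exists w; split => //.
- apply: (@le_trans _ _ ((1 + C * Mp) * nrm (S u - yb))); last first.
    by rewrite ler_wpM2r// lerDl.
  rewrite restrict_nrm -[X in X * _](ger0_norm K0) -nrmDZ//.
  apply: ae_le_nrmD => //; [exact: sw'|exact: (phZ HS)|].
  apply: filterS cdz => x h Ox.
  rewrite -[X in _ <= `|X|]/((1 + C * Mp) * (S u x - yb x)) normrM (ger0_norm K0).
  rewrite [leRHS]mulrDl [1 * _]mul1r; apply: (le_trans (ler_normB _ _)).
  rewrite lerD2l [leLHS]normrM mulrAC.
  by apply: ler_pM => //; [exact: h|exact: hMp].
- set e := p u - pb - Dadj w; have Le : L2 Om e by exact: (phB H2).
  have se := L2_sqint Le; have LDe := dS_L2 S2 Lub Le.
  (* [duality] tested with [e] itself: the [w'] term cancels against [Dadj w]. *)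
  have ee : ip e e = - ip (r u) (D e).
    rewrite {2}/e (ipBr H2)// duality// -(adjointE (adj Lub) Lw Le).
    have -> : ip (D e) w = ip (w' u) (D e).
      rewrite L2_ipC; apply: eq_Rintegral => x xO; by rewrite /w patchE xO.
    ring.
  have ir : `|ip (r u) (D e)| <= Cd * nrm e * (nrm (cd u) * nrm (p u - pb)).
    rewrite L2_ipC; apply: (le_trans (ip_le_sup (L2_sqint LDe) (sr Lu) (B := Cd * nrm e) _)).
      by move=> x Ox; exact: hCd.
    rewrite ler_wpM2l ?mulr_ge0 ?nrmD_ge0//.
    rewrite -(nrmD_norm mu O (cd u)) -(nrmD_norm mu O (p u - pb)).
    have := ipD_le mOm (sqint_norm mOm scdu) (sqint_norm mOm sd).
    apply: le_trans; apply: le_trans (ler_norm _).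
    by rewrite le_eqVlt; apply/orP; left; apply/eqP; apply: eq_Rintegral => x _; rewrite normrM.
  apply: (@le_trans _ _ (Cd * C * nrm (S u - yb) * nrm (p u - pb))); last first.
    by rewrite ler_wpM2r ?nrmD_ge0// ler_wpM2r// lerDr.
  have : nrm e ^+ 2 <= Cd * nrm e * (nrm (cd u) * nrm (p u - pb)).
    rewrite nrmD_ip// -[leLHS]/(ip e e) ee; apply: le_trans ir; rewrite -normrN; exact: ler_norm.
  have [->|ne0] := eqVneq (nrm e) 0.
    by move=> _; rewrite !mulr_ge0 ?nrmD_ge0// ltW.
  have nep : 0 < nrm e by rewrite lt_neqAle eq_sym ne0 nrmD_ge0.
  rewrite mulrAC [leRHS]mulrC expr2 ler_pM2l// => /le_trans; apply.
  by rewrite -!mulrA ler_wpM2l// mulrA ler_wpM2r ?nrmD_ge0.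
Qed.

End adjoint_state.

(** * Projection onto the admissible set *)

Section clip.
Variable R : realType.
Implicit Types a b s t : R.

(** No order between [a] and [b] is assumed, so the bound applies at every point and not just where
    [ua <= ub]. *)
Lemma clip_lipschitz a b s t :
  `|Num.max a (Num.min s b) - Num.max a (Num.min t b)| <= `|s - t|.
Proof.
wlog st : s t / s <= t.
  by move=> h; have [/h//|/ltW/h] := leP s t; rewrite distrC (distrC t).
rewrite (distrC s) (ger0_norm (x := t - s)) ?subr_ge0// ler_norml !maxEle !minEle.
by case: (leP s b) => ?; case: (leP t b) => ?; case: (leP a s) => ?;
  case: (leP a t) => ?; case: (leP a b) => ?; apply/andP; split; lra.
Qed.

(** The variational inequality of the projection of [t] onto [[a, b]], tested with the point [s] of
    the interval. *)
Lemma clip_variational a b s t : a <= s <= b ->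
  0 <= (Num.max a (Num.min t b) - t) * (s - Num.max a (Num.min t b)).
Proof.
move=> /andP[as_ sb]; have ab := le_trans as_ sb.
rewrite minEle; case: (leP t b) => tb.
  by rewrite maxEle; case: (leP a t) => at_; [rewrite subrr mul0r|
    rewrite mulr_ge0// subr_ge0// ltW].
by rewrite maxEle ab mulr_le0// subr_le0// ltW.
Qed.

Lemma clip_norm a b t : `|Num.max a (Num.min t b)| <= `|a| + `|b|.
Proof.
rewrite maxEle minEle; case: (leP t b) => tb; case: ifPn => h; rewrite ?lerDl ?lerDr//.
have h1 := ler_norm b; have := ler_norm (- a); have := normr_ge0 a; have := normr_ge0 b.
by rewrite ler_norml normrN => *; apply/andP; split; lra.
Qed.

End clip.

Section projection.
Context {R : realType} {n : nat}.
Variable Om : lipschitzDomain R n.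
Local Notation mu := (lebesgue_on Om : {measure set 'rV[R]_n -> \bar R}).
Local Notation T := ('rV[R]_n).
Local Notation O := (domain_set Om).
Notation nrm := (nrmD mu O).
Notation ip := (L2inner Om).
Implicit Types (u v w y g h : T -> R) (G H : 'I_n -> T -> R).
Let mOm := measurable_domain Om.
Let Ofin := lebesgue_on_lty Om.
Let HS := prehilbert_sqint mu mOm.
Let H2 := prehilbert_L2 Om.

Lemma Linfty_L2 u : u \in Lfun mu +oo%E -> L2 Om u.
Proof.
apply: Lfun_subset; rewrite ?leey ?lee1n//.
rewrite ge0_fin_numE//; apply: le_lt_trans Ofin.
by rewrite /= /lebesgue_on /mrestr setTI setIid.
Qed.

Variables ua ub : T -> R.
Hypothesis Lua : L2 Om ua.
Hypothesis Lub : L2 Om ub.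
Local Notation proj := (proj_Uad ua ub).

Lemma proj_L2 v : L2 Om v -> L2 Om (proj v).
Proof.
move=> Lv; have mp : measurable_fun setT (proj v).
  apply: measurable_maxr; first exact: (L2_measurable Lua).
  by apply: measurable_minr; [exact: (L2_measurable Lv)|exact: (L2_measurable Lub)].
apply: sqint_L2 => //.
apply: (@ae_le_sqint _ _ _ mu _ mOm _ (fun x => `|ua x| + `|ub x|)).
- exact: measurable_funTS.
- by apply: (phD HS (x := fun x => `|ua x|)); apply: sqint_norm => //; exact: L2_sqint.
- by apply: aeW => x Ox; rewrite (ger0_norm (addr_ge0 _ _))//; exact: clip_norm.
Qed.

Lemma proj_lipschitz v w : L2 Om v -> L2 Om w -> nrm (proj v - proj w) <= nrm (v - w).
Proof.
move=> Lv Lw; apply: ae_le_nrmD => //.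
- by apply: L2_sqint; apply: (phB H2); exact: proj_L2.
- by apply: L2_sqint; apply: (phB H2).
- by apply: aeW => x _; exact: clip_lipschitz.
Qed.

Hypothesis uab : {ae mu, forall x, ua x <= ub x}.

Lemma proj_Uad_in v : L2 Om v -> Uad Om ua ub (proj v).
Proof.
move=> Lv; split; first exact: proj_L2.
apply: filterS uab => x h; rewrite /proj_Uad le_max lexx/= ge_max h/=.
by rewrite ge_min lexx orbT.
Qed.

Lemma Uad_bounded v w : Uad Om ua ub v -> Uad Om ua ub w -> nrm (v - w) <= nrm (ub - ua).
Proof.
move=> [Lv hv] [Lw hw]; apply: ae_le_nrmD => //; [by apply: L2_sqint; exact: (phB H2)..|].
apply: filterS2 hv hw => x /andP[h1 h2] /andP[h3 h4] _.
rewrite -[X in `|X| <= _]/(v x - w x) -[X in _ <= `|X|]/(ub x - ua x).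
rewrite [leRHS]ger0_norm ?subr_ge0 ?(le_trans h1)// ler_norml; apply/andP; split; lra.
Qed.

(* On [K] the controls [u i] are projections of [d i], which converge         *)
(* strongly; the weak limit must be the projection of the limit there.        *)
Lemma limit_on_set (I : Type) (F : set_system I) (FF : ProperFilter F) (K : set T)
    (u k d : I -> T -> R) (ubar g : T -> R) : measurable K -> K `<=` O ->
  (forall i, L2 Om (u i)) -> (forall i, L2 Om (k i)) -> (forall i, L2 Om (d i)) ->
  L2 Om ubar -> L2 Om g ->
  (forall i x, K x -> k i x = d i x) ->
  (\forall i \near F, nrm (u i - proj (k i)) = 0) ->
  (forall v, L2 Om v -> ip (u i) v @[i --> F] --> ip ubar v) ->
  nrm (d i - g) @[i --> F] --> 0 ->
  {ae mu, forall x, K x -> ubar x = proj g x}.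
Proof.
move=> mK KO Lu Lk Ld Lubar Lg kd uk uw dg.
have Lpg := proj_L2 Lg.
have Lz : L2 Om (ubar - proj g) by exact: (phB H2).
(* The difference cut off to [K] is itself the test function: [ip (u i - proj g) v] tends to
   [nrm v ^+ 2] by weak convergence, and to 0 because on [K] it only sees [proj (d i) - proj g]. *)
pose v x := \1_K x * (ubar x - proj g x).
have Lv : L2 Om v.
  have mv : measurable_fun setT v.
    apply: measurable_funM; first exact: measurable_indic.
    exact: (L2_measurable Lz).
  apply: sqint_L2 => //; apply: ae_le_sqint (L2_sqint Lz) _ => //.
    exact: measurable_funTS.
  apply: aeW => x _; rewrite /v normrM ler_piMl// indicE.
  by case: (x \in K); rewrite ?normr1 ?normr0.
have sv := L2_sqint Lv.
have vv : ip (ubar - proj g) v = nrm v ^+ 2.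
  rewrite nrmD_ip//; apply: eq_Rintegral => x _; rewrite /v indicE.
  by case: (x \in K); rewrite ?mul1r// !mul0r mulr0.
have c1 : ip (u i - proj g) v @[i --> F] --> ip (ubar - proj g) v.
  rewrite (ipBl H2)//; under eq_fun do rewrite (ipBl H2)//.
  by apply: cvgB; [exact: uw|exact: cvg_cst].
have c2 : ip (u i - proj g) v @[i --> F] --> 0.
  have : nrm (d i - g) * nrm v @[i --> F] --> 0.
    by rewrite -(mul0r (nrm v)); apply: cvgMl.
  move=> /cvgr0Pnorm_le h; apply/cvgr0Pnorm_le => e e0; have := h e e0.
  move: uk; apply: filterS2 => i uk; apply: le_trans.
  have Lpk := proj_L2 (Lk i); have Lpd := proj_L2 (Ld i).
  have -> : ip (u i - proj g) v = ip (u i - proj (k i)) v + ip (proj (k i) - proj g) v.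
    rewrite !(ipBl H2)//; ring.
  have -> : ip (u i - proj (k i)) v = 0.
    apply/eqP; rewrite -normr_le0; apply: (le_trans (ip_le _ Lv)); first exact: (phB H2).
    by rewrite uk mul0r.
  have -> : ip (proj (k i) - proj g) v = ip (proj (d i) - proj g) v.
    apply: eq_Rintegral => x _; rewrite /v indicE; have [|_] := boolP (x \in K); last by rewrite mul0r !mulr0.
    rewrite inE => /kd e1; congr (_ * _).
    by rewrite -[LHS]/(proj (k i) x - proj g x) /proj_Uad e1.
  rewrite add0r [leRHS]ger0_norm ?mulr_ge0 ?nrmD_ge0//.
  apply: (le_trans (ip_le _ Lv)); first exact: (phB H2).
  by apply: ler_wpM2r; [exact: nrmD_ge0|exact: proj_lipschitz].
have v0 : nrm v = 0.
  apply/eqP; rewrite -sqrf_eq0 -vv; apply/eqP.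
  exact: cvg_unique c1 c2.
apply: filterS (nrmD_eq0_ae mOm sv v0) => x h Kx.
have := h (KO x Kx); rewrite /v indicE mem_set// mul1r => /eqP.
by rewrite subr_eq0 => /eqP.
Qed.

End projection.

(** * Stationary points *)

Section stationarity.
Context {R : realType} {n : nat}.
Variable n_gt0 : (0 < n)%N.
Variable Om : lipschitzDomain R n.
Local Notation mu := (lebesgue_on Om : {measure set 'rV[R]_n -> \bar R}).
Local Notation T := ('rV[R]_n).
Local Notation O := (domain_set Om).
Notation nrm := (nrmD mu O).
Notation ip := (L2inner Om).
Implicit Types (u v w y g h : T -> R) (G H : 'I_n -> T -> R).
Let mOm := measurable_domain Om.
Let H2 := prehilbert_L2 Om.

Variables (a : 'I_n -> 'I_n -> T -> R) (f : T -> R -> R) (q : \bar R).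
Variables (S : (T -> R) -> T -> R) (dS dSadj : (T -> R) -> (T -> R) -> T -> R).
Variables (p : (T -> R) -> T -> R) (yd : T -> R).
Variable ubar : T -> R.
Hypothesis ella : elliptic_coefficients Om a.
Hypothesis q1 : (1 <= q)%E.
Hypothesis adm : admissible_nonlinearity Om q f.
Hypothesis SS : forall u, L2 Om u -> weak_solution Om a f u (S u).
Hypothesis S2 : C2_with_derivative (L2 Om) (L2norm Om) (Y Om) (Ynorm Om) S dS.
Hypothesis dSw : forall v h, L2 Om v -> L2 Om h ->
  weak_solution Om a (linearized f (S v)) h (dS v h).
Hypothesis adj : forall v, L2 Om v -> L2_adjoint Om (dS v) (dSadj v).
Hypothesis Lyd : L2 Om yd.
Hypothesis pst : adjoint_state Om a f yd S p.
Hypothesis Lub : L2 Om ubar.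

Variables ua ub : T -> R.
Hypothesis Lua : L2 Om ua.
Hypothesis Lub' : L2 Om ub.
Hypothesis uab : {ae mu, forall x, ua x <= ub x}.

Let SY u : L2 Om u -> Y Om (S u). Proof. by move=> /SS[]. Qed.
Let SL2 u : L2 Om u -> L2 Om (S u). Proof. by move=> /SY /Y_L2. Qed.
Let pL2 u : L2 Om u -> L2 Om (p u). Proof. by move=> /pst[/Y_L2]. Qed.

Let ler_frac (s b : R) : 0 <= s -> 0 <= b -> s * (b / (s + 1)) <= b.
Proof.
move=> s0 b0; rewrite mulrCA ler_piMr// ler_pdivrMr ?mul1r ?lerDl//.
by rewrite ltr_wpDl.
Qed.

(** With [z] the increment of the state and [r] its linearization error, the error for the objective
    is [(S u - yd, r) + |z|^2 / 2]. The two summands take [e / 2] each: [e1] absorbs the factor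
    [Ny * N1], and [nrm h < e / (L ^+ 2 + 1)] absorbs [L ^+ 2]. *)
Lemma objective_differentiable u (e : R) : L2 Om u -> 0 < e -> exists2 d : R, 0 < d &
  forall h, L2 Om h -> nrm h < d ->
  `|objective Om S yd (u + h) - objective Om S yd u - ip (p u) h| <= e * nrm h.
Proof.
move=> Lu e0; have [Cd Cd0 hCd] := dS_sup S2 Lu.
pose N1 := nrm (fun=> 1); have N10 : 0 <= N1 by exact: nrmD_ge0.
pose Ny := nrm (S u - yd); have Ny0 : 0 <= Ny by exact: nrmD_ge0.
have LSu := SL2 Lu; have Lr : L2 Om (S u - yd) by exact: (phB H2).
have c0 : 0 < Ny * N1 + 1 by rewrite ltr_wpDl// mulr_ge0.
pose e1 := e / 2 / (Ny * N1 + 1); have e10 : 0 < e1 by rewrite !divr_gt0.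
pose L := N1 * (Cd + e1); have L0 : 0 <= L by rewrite mulr_ge0// addr_ge0// ltW.
have [d1 d10 hd1] := S_differentiable SY S2 Lu e10.
have L1 : 0 < L ^+ 2 + 1 by rewrite ltr_wpDl// sqr_ge0.
exists (Num.min d1 (e / (L ^+ 2 + 1))) => [|h Lh].
  by rewrite lt_min d10 divr_gt0.
rewrite lt_min => /andP[hd hd2].
have Luh : L2 Om (u + h) by exact: (phD H2).
have LSh := SL2 Luh; have LD := dS_L2 S2 Lu Lh.
set z := S (u + h) - S u; have Lz : L2 Om z by exact: (phB H2).
set r := z - dS u h; have Lr' : L2 Om r by exact: (phB H2).
have nh := nrmD_ge0 mu O h.
have nr : nrm r <= N1 * (e1 * nrm h).
  apply: nrm_le_sup; [exact: L2_sqint|by rewrite mulr_ge0// ltW|].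
  by move=> x Ox; apply: hd1 => //; exact: subset_closure.
have nD : nrm (dS u h) <= N1 * (Cd * nrm h).
  apply: nrm_le_sup; [exact: L2_sqint|by rewrite mulr_ge0// ltW|].
  by move=> x Ox; exact: hCd.
have nz : nrm z <= L * nrm h.
  have -> : z = r + dS u h by rewrite /r subrK.
  apply: (le_trans (ler_nrmD mOm (L2_sqint Lr') (L2_sqint LD))).
  apply: (le_trans (lerD nr nD)); rewrite /L -mulrA mulrDl mulrDr addrC //.
have expand : objective Om S yd (u + h) - objective Om S yd u - ip (p u) h =
    ip (S u - yd) r + 2^-1 * nrm z ^+ 2.
  have E1 : S (u + h) - yd = 1 *: (S u - yd) + z.
    by rewrite scale1r [RHS]addrC /z subrKA.
  rewrite /objective !L2normE//; last by rewrite E1; apply: (ph_lin H2).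
  rewrite !nrmD_ip ?E1//; try exact: L2_sqint; last by apply/L2_sqint/(ph_lin H2).
  have e2 := ip_sqD H2 1 Lr Lz.
  have e3 : ip (p u) h = ip (S u - yd) (dS u h).
    by rewrite L2_ipC; exact: (adjoint_state_gradient S2 dSw pst Lu Lh).
  have e4 : ip (S u - yd) r = ip (S u - yd) z - ip (S u - yd) (dS u h) by exact: (ipBr H2).
  have arith (b1 b2 b3 b4 b5 b6 b7 : R) : b1 = b2 * 1 ^+ 2 + 2 * b3 * 1 + b4 ->
      b5 = b6 -> b7 = b3 - b6 -> 2^-1 * b1 - 2^-1 * b2 - b5 = b7 + 2^-1 * b4.
    by move=> -> -> ->; field.
  exact: arith e2 e3 e4.
rewrite expand; apply: (le_trans (ler_normD _ _)).
have p1 : `|ip (S u - yd) r| <= e / 2 * nrm h.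
  apply: (le_trans (ip_le Lr Lr')); apply: (le_trans (ler_wpM2l Ny0 nr)).
  rewrite (mulrA N1) (mulrA Ny) (mulrA Ny); apply: ler_wpM2r => //.
  by apply: ler_frac; [exact: mulr_ge0|rewrite divr_ge0// ltW].
have p2 : `|2^-1 * nrm z ^+ 2| <= e / 2 * nrm h.
  have g0 : 0 <= 2^-1 * nrm z ^+ 2 by rewrite mulr_ge0 ?invr_ge0 ?sqr_ge0.
  rewrite (ger0_norm g0) (mulrC e) -(mulrA 2^-1) ler_wpM2l//.
  have nz0 := nrmD_ge0 mu O z.
  apply: (@le_trans _ _ ((L * nrm h) ^+ 2)); first by rewrite ler_pXn2r ?nnegrE// mulr_ge0.
  rewrite exprMn (expr2 (nrm h)) mulrA; apply: ler_wpM2r => //.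
  move: (ltW hd2); rewrite ler_pdivlMr// => hd3; apply: le_trans hd3.
  by rewrite mulrC ler_wpM2l// lerDl.
by apply: (le_trans (lerD p1 p2)); rewrite -mulrDl -splitr.
Qed.

(** [stationary_point] provides some Frechet derivative [dJ]. Both linear functionals approximate
    the same increment along [t *: v] for a small [t > 0], and dividing by [t] identifies them. *)
Lemma objective_derivative u dJ v : L2 Om u -> L2 Om v ->
  frechet_derivative (L2 Om) (L2norm Om) [set: R] Num.norm (objective Om S yd) u dJ ->
  dJ v = ip (p u) v.
Proof.
move=> Lu Lv [[_ lin _] fr].
have L0 : L2 Om 0 by exact: (ph0 H2).
have dJ0 : dJ 0 = 0.
  have := lin 1 0 0 L0 L0; rewrite scaler0 addr0 scale1r => /normr0_eq0/eqP.
  by rewrite opprD addNKr oppr_eq0 => /eqP.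
have dJZ t : dJ (t *: v) = t * dJ v.
  have := lin t v 0 Lv L0; rewrite addr0 dJ0 addr0 => /normr0_eq0/eqP.
  by rewrite subr_eq0 => /eqP.
apply/eqP; rewrite -subr_eq0 -normr_le0; apply/ler_addgt0Pr => e e0; rewrite add0r.
have nv := nrmD_ge0 mu O v; have nv1 : 0 < nrm v + 1 by rewrite ltr_wpDl.
pose e1 := e / 2 / (nrm v + 1); have e10 : 0 < e1 by rewrite !divr_gt0.
have [d1 d10 h1] := fr _ e10; have [d2 d20 h2] := objective_differentiable Lu e10.
pose t := Num.min d1 d2 / (nrm v + 1).
have m0 : 0 < Num.min d1 d2 by rewrite lt_min d10.
have t0 : 0 < t by rewrite divr_gt0.
have Lt : L2 Om (t *: v) by exact: (phZ H2).
have ntE : nrm (t *: v) = t * nrm v.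
  by rewrite nrmDZ//; [rewrite gtr0_norm|exact: L2_sqint].
have nt : nrm (t *: v) < Num.min d1 d2.
  by rewrite ntE /t mulrAC ltr_pdivrMr// ltr_pM2l// ltrDl.
have [nt1 nt2] : nrm (t *: v) < d1 /\ nrm (t *: v) < d2.
  by move: nt; rewrite lt_min => /andP[].
have := h2 _ Lt nt2; have := h1 _ Lt; rewrite L2normE// => /(_ nt1).
rewrite dJZ (ipZr H2)//; last exact: pL2.
rewrite ntE.
have arith (A b1 b2 s : R) : `|A - t * b1| <= e1 * (t * s) -> `|A - t * b2| <= e1 * (t * s) ->
    `|b1 - b2| <= 2 * (e1 * s).
  move=> a1 a2; rewrite -(ler_pM2l t0) -{1}(gtr0_norm t0) -normrM.
  rewrite (_ : t * (b1 - b2) = (A - t * b2) - (A - t * b1)); last by ring.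
  rewrite (_ : t * (2 * (e1 * s)) = e1 * (t * s) + e1 * (t * s)); last by ring.
  by apply: (le_trans (ler_normB _ _)); exact: lerD.
move=> a1 a2; apply: (le_trans (arith _ _ _ _ a1 a2)).
rewrite -ler_pdivlMl// [leRHS]mulrC (mulrC e1).
by apply: ler_frac => //; rewrite divr_ge0// ltW.
Qed.

(** Stationarity of [u] is tested with the projection [r], and the pointwise variational inequality
    of [r] with [u]. Adding the two leaves [alpha * |u - r|^2 <= 0]. *)
Lemma stationary_projection (alpha : R) u : 0 < alpha ->
  stationary_point Om S yd ua ub alpha u ->
  nrm (u - proj_Uad ua ub (- alpha^-1 *: p u)) = 0.
Proof.
move=> al0 [[Lu uab'] [dJ fr st]]; have Lp := pL2 Lu.
have Lk : L2 Om (- alpha^-1 *: p u) by exact: (phZ H2).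
set r := proj_Uad ua ub _.
have rU : Uad Om ua ub r by exact: proj_Uad_in.
have Lr := rU.1; set e := u - r; have Le : L2 Om e by exact: (phB H2).
have := st r rU; rewrite (objective_derivative Lu _ fr); last exact: (phB H2).
rewrite -(opprB u r) -/e !(ipNr H2)// => h1.
have h2 : 0 <= ip (p u) e + alpha * ip r e.
  have -> : ip (p u) e + alpha * ip r e = ip (alpha *: r + p u) e.
    by rewrite (ipDl H2)//; [rewrite (ipZl H2)// addrC|exact: (phZ H2)].
  have Lq : L2 Om (alpha *: r + p u) by exact: (ph_lin H2).
  apply: ae_ge0_Rintegral => //.
    by apply: sqint_mul => //; exact: L2_sqint.
  apply: filterS uab' => x hx _.
  have := clip_variational (- alpha^-1 * p u x) hx.
  have arith (s P v : R) : 0 <= (s - - alpha^-1 * P) * (v - s) ->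
      0 <= (alpha * s + P) * (v - s).
    move=> h; rewrite (_ : _ * _ = alpha * ((s - - alpha^-1 * P) * (v - s))).
      by rewrite mulr_ge0// ltW.
    by field; rewrite gt_eqF.
  exact: arith.
have h3 : ip e e = ip u e - ip r e by rewrite {1}/e (ipBl H2).
apply/eqP; rewrite -sqrf_eq0 nrmD_ip//; last exact: L2_sqint.
rewrite -[ipD _ _ _ _]/(ip e e) eq_le (ph_ge0 H2)// andbT.
rewrite -(pmulr_rle0 _ al0).
have arith (b1 b2 b3 b4 : R) : 0 <= - b1 + alpha * - b2 -> 0 <= b1 + alpha * b3 ->
    b4 = b2 - b3 -> alpha * b4 <= 0.
  by move=> a1 a2 ->; rewrite mulrBr; lra.
exact: arith h1 h2 h3.
Qed.

Variable u : R -> T -> R.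
Hypothesis Lu : forall alpha, L2 Om (u alpha).
Hypothesis st : forall alpha, 0 < alpha -> stationary_point Om S yd ua ub alpha (u alpha).
Hypothesis Uubar : Uad Om ua ub ubar.
Hypothesis uw : forall v, L2 Om v ->
  ip (u alpha) v @[alpha --> 0^'+] --> ip ubar v.
Variable k : R.
Hypothesis k0 : 0 < k.
Local Notation yb := (S ubar).
Local Notation D := (dS ubar).
Local Notation Dadj := (dSadj ubar).
Local Notation eta alpha := (nrm (S (u alpha) - yb)).
Let d alpha := p (u alpha) - p ubar.
Hypothesis etaO : \forall alpha \near 0^'+, eta alpha <= k * alpha.

Let Ld alpha : L2 Om (d alpha). Proof. by apply: (phB H2); exact: pL2. Qed.
Let LD h : L2 Om h -> L2 Om (D h). Proof. by move=> Lh; exact: (dS_L2 S2). Qed.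
Let LDadj h : L2 Om h -> L2 Om (Dadj h). Proof. by move=> Lh; have [] := adj Lub Lh. Qed.
Let eta_ge0 alpha : 0 <= eta alpha. Proof. exact: nrmD_ge0. Qed.

Let near_pos : \forall alpha \near (0 : R)^'+, 0 < alpha.
Proof. exact: nbhs_right_gt. Qed.

Lemma adjoint_approximation : exists C : R, exists w : R -> T -> R,
  [/\ 0 <= C, forall alpha, L2 Om (w alpha),
    \forall alpha \near 0^'+, nrm (w alpha) <= C * eta alpha &
    \forall alpha \near 0^'+,
      nrm (d alpha - Dadj (w alpha)) <= C * eta alpha * nrm (d alpha)].
Proof.
have uB : \forall alpha \near 0^'+, nrm (u alpha - ubar) <= nrm (ub - ua).
  by move: near_pos; apply: filterS => al al0; apply: Uad_bounded => //; exact: (st al0).1.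
have uw0 v : L2 Om v -> ip (u al - ubar) v @[al --> 0^'+] --> 0.
  move=> Lv; have : ip (u al - ubar) v @[al --> 0^'+] --> ip ubar v - ip ubar v.
    under eq_fun do rewrite (ipBl H2)//.
    by apply: cvgB; [exact: uw|exact: cvg_cst].
  by rewrite subrr.
have [M M0 [yM uM]] := states_bounded n_gt0 ella q1 adm SS S2 dSw adj Lub _ Lu uB uw0.
have [C C0 hC] := adjoint_expansion adm SS S2 dSw adj Lyd pst Lub M0 yM.
have /choice[w hw] al : exists w, L2 Om w /\
    ((forall x, O x -> `|S (u al) x| <= M) -> nrm w <= C * eta al /\
     nrm (d al - Dadj w) <= C * eta al * nrm (d al)).
  have [h|h] := pselect (forall x, O x -> `|S (u al) x| <= M); last first.
    (* Where the state bound fails, [w alpha] is set to 0; the bound holds for all [alpha] near 0,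
       where the estimates are claimed. *)
    by exists 0; split => //; exact: (ph0 H2).
  by have [w [Lw w1 w2]] := hC _ (Lu al) h; exists w.
exists C; exists w; split => //; first by move=> al; have [] := hw al.
- by move: uM; apply: filterS => al h; have [_ /(_ h)[]] := hw al.
- by move: uM; apply: filterS => al h; have [_ /(_ h)[]] := hw al.
Qed.

Let Dadj_bounded : exists2 C : R, 0 <= C & forall w, L2 Om w -> nrm (Dadj w) <= C * nrm w.
Proof.
by apply: (adjoint_bounded LD); [have [C ? ?] := dS_sup S2 Lub; exists C|exact: adj].
Qed.

Let absorb_half (s t1 t2 t3 t4 : R) :
  s <= t1 + t2 -> t1 <= t3 -> t3 <= 2^-1 * s -> t2 <= t4 -> s <= 2 * t4.
Proof. by move=> *; lra. Qed.

(** The expansion error contains [nrm (d alpha)] itself, with the factor [C * eta alpha]. That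
    factor tends to 0, so for small [alpha] the term is absorbed on the left. *)
Lemma adjoint_rate : exists2 C : R, 0 <= C &
  \forall alpha \near 0^'+, nrm (d alpha) <= C * eta alpha.
Proof.
have [C [w [C0 Lw w1 w2]]] := adjoint_approximation.
have [CT CT0 hT] := Dadj_bounded.
exists (2 * (CT * C)); first by rewrite !mulr_ge0.
have c0 : 0 < 2 * (C * k) + 1 by rewrite ltr_wpDl// !mulr_ge0// ltW.
near=> al; have al0 : 0 < al by near: al; exact: near_pos.
(* This makes [C * k * al <= 2^-1]. *)
have al1 : al < (2 * (C * k) + 1)^-1.
  by near: al; apply: nbhs_right_lt; rewrite invr_gt0.
have h1 : nrm (w al) <= C * eta al by near: al.
have h2 : nrm (d al - Dadj (w al)) <= C * eta al * nrm (d al) by near: al.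
have h3 : eta al <= k * al by near: al.
have nd := nrmD_ge0 mu O (d al).
have h4 : C * eta al <= 2^-1.
  apply: (le_trans (ler_wpM2l C0 h3)).
  rewrite mulrA -(ler_pM2l (x := 2))// mulfV// mulrA.
  move: al1; rewrite -[_^-1]mul1r ltr_pdivlMr// mulrDr mulr1 mulrC => al1.
  by apply/ltW; apply: le_lt_trans al1; rewrite lerDl ltW.
have h5 : nrm (d al) <= nrm (d al - Dadj (w al)) + nrm (Dadj (w al)).
  rewrite -[X in nrm X <= _](subrK (Dadj (w al))).
  apply: ler_nrmD => //; first by apply: L2_sqint; apply: (phB H2) => //; exact: LDadj.
  by apply: L2_sqint; exact: LDadj.
have h6 : nrm (Dadj (w al)) <= CT * C * eta al.
  by apply: (le_trans (hT _ (Lw al))); rewrite -mulrA ler_wpM2l.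
have h7 : C * eta al * nrm (d al) <= 2^-1 * nrm (d al) by rewrite ler_wpM2r.
rewrite -mulrA; exact: absorb_half h5 h2 h7 h6.
Unshelve. all: by end_near. Qed.

Let K := [set x | O x /\ p ubar x = 0].
(** On [K], where [p ubar] vanishes, this is [- alpha^-1 *: p (u alpha)], the argument of the
    projection. *)
Let g alpha := - alpha^-1 *: d alpha.
Let Lg alpha : L2 Om (g alpha). Proof. exact: (phZ H2). Qed.

Let mK : measurable K.
Proof.
have := L2_measurable (pL2 Lub) measurableT (measurable_set1 (0 : R)).
rewrite setTI => h; have := measurableI _ _ mOm h; congr measurable.
Qed.

(** [F] is an ultrafilter refining [0^'+] in the first assertion and [0^'+] itself in the second. *)
Lemma limit_on_K (F : set_system R) (FF : ProperFilter F) l :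
  0^'+ `<=` F -> L2 Om l -> nrm (g alpha - l) @[alpha --> F] --> 0 ->
  {ae mu, forall x, K x -> ubar x = proj_Uad ua ub l x}.
Proof.
move=> F0 Ll gl.
apply: (@limit_on_set _ _ Om ua ub Lua Lub' _ F FF K u
  (fun al => - al^-1 *: p (u al)) g ubar l) => //.
- by move=> x [].
- by move=> al; apply: (phZ H2); exact: pL2.
- move=> al x [_ p0]; rewrite /g /d.
  by rewrite -[RHS]/(- al^-1 * (p (u al) x - p ubar x)) p0 subr0.
- apply: F0; move: near_pos; apply: filterS => al al0.
  exact: (stationary_projection al0 (st al0)).
- by move=> v Lv; apply: cvg_trans (uw Lv); exact: cvg_app.
Qed.

Let ng alpha : 0 < alpha -> nrm (g alpha) = alpha^-1 * nrm (d alpha).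
Proof.
by move=> al0; rewrite nrmDZ//; [rewrite normrN gtr0_norm ?invr_gt0|exact: L2_sqint].
Qed.

(* [z alpha := - (Dadj (w alpha)) / alpha] differs from [g alpha] by           *)
(* [O(alpha)], and [Dadj] turns a weak limit [l] of [- (w alpha) / alpha],     *)
(* taken along an ultrafilter, into a strong one.                             *)
Lemma projection_on_K : exists2 w, L2 Om w &
  {ae mu, forall x, K x -> ubar x = proj_Uad ua ub (Dadj w) x}.
Proof.
have [C [w [C0 Lw w1 w2]]] := adjoint_approximation.
have [C' C'0 dC] := adjoint_rate.
pose h alpha := - alpha^-1 *: w alpha.
have Lh al : L2 Om (h al) by exact: (phZ H2).
have hB : \forall al \near 0^'+, nrm (h al) <= C * k.
  near=> al; have al0 : 0 < al by near: al; exact: near_pos.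
  rewrite nrmDZ//; last exact: L2_sqint.
  rewrite normrN gtr0_norm ?invr_gt0// ler_pdivrMl//.
  have h1 : nrm (w al) <= C * eta al by near: al.
  apply: (le_trans h1); rewrite (mulrC al) -(mulrA C) ler_wpM2l//.
  by near: al.
pose z alpha := - alpha^-1 *: Dadj (w alpha).
have Lz al : L2 Om (z al) by apply: (phZ H2); exact: LDadj.
have gz : nrm (g al - z al) @[al --> 0^'+] --> 0.
  (* [C * eta * nrm d] is at most [C * (k * alpha) * (C' * k * alpha)], so after division by [alpha]
     the bound is [B * alpha]. *)
  pose B := C * (k * (C' * k)); have B0 : 0 <= B by rewrite !mulr_ge0// ltW.
  apply/cvgr0Pnorm_le => e e0; near=> al.
  have al0 : 0 < al by near: al; exact: near_pos.
  have al1 : al < e / (B + 1) by near: al; apply: nbhs_right_lt; rewrite divr_gt0// ltr_wpDl.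
  have h2 : nrm (d al - Dadj (w al)) <= C * eta al * nrm (d al) by near: al.
  have h3 : eta al <= k * al by near: al.
  have h4 : nrm (d al) <= C' * eta al by near: al.
  rewrite ger0_norm ?nrmD_ge0// -scalerBr nrmDZ//; last first.
    by apply: L2_sqint; apply: (phB H2) => //; exact: LDadj.
  rewrite normrN gtr0_norm ?invr_gt0// ler_pdivrMl//; apply: (le_trans h2).
  have h5 : nrm (d al) <= C' * (k * al) by apply: (le_trans h4); rewrite ler_wpM2l.
  have kal : 0 <= k * al by rewrite mulr_ge0// ltW.
  have h6 := ler_pM (eta_ge0 al) (nrmD_ge0 mu O (d al)) h3 h5.
  rewrite -mulrA; apply: (le_trans (ler_wpM2l C0 h6)).
  rewrite (_ : C * _ = al * (B * al)); last by rewrite /B; ring.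
  apply: ler_wpM2l; first exact: ltW.
  apply: (le_trans (ler_wpM2l B0 (ltW al1))).
  rewrite mulrCA ler_piMr ?(ltW e0)// ler_pdivrMr ?mul1r ?lerDl//.
  by rewrite ltr_wpDl.
(* The conclusion about [ubar] does not mention the filter, so a limit along a single refinement
   suffices. *)
have [U [UU FU]] := ultraFilterLemma (at_right_proper_filter (0 : R)).
have PU : ProperFilter U by exact: ultra_proper.
have hBU : \forall al \near U, nrm (h al) <= C * k by exact: FU.
have [l Ll hl] := ultra_weak_limit H2 UU (@L2_complete _ _ Om) Lh hBU.
exists l => //; apply: (limit_on_K PU FU (LDadj Ll)).
have hlB : \forall al \near U, nrm (h al - l) <= C * k + nrm l.
  move: hBU; apply: filterS => al h1.
  by apply: (le_trans (ler_nrmB mOm (L2_sqint (Lh al)) (L2_sqint Ll))); rewrite lerD2r.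
have hl0 v : L2 Om v -> ip (h al - l) v @[al --> U] --> 0.
  move=> Lv; rewrite -(subrr (ip l v)).
  under eq_fun do rewrite (ipBl H2)//.
  by apply: cvgB; [exact: hl|exact: cvg_cst].
have Lhl al : L2 Om (h al - l) by exact: (phB H2).
have Thl : nrm (Dadj (h al - l)) @[al --> U] --> 0.
  apply: (adjoint_compact LD _ _ (adj Lub) _ Lhl hlB hl0).
  - by move=> c h1 h2 x L1 L2; exact: (dS_lin S2).
  - by have [Cd ? ?] := dS_sup S2 Lub; exists Cd.
have zl al : nrm (z al - Dadj l) <= nrm (Dadj (h al - l)).
  have Lzl : L2 Om (z al - Dadj l) by apply: (phB H2) => //; exact: LDadj.
  (* Linearity of [Dadj] up to norm zero, by uniqueness of the adjoint. *)
  have e0 : nrm (Dadj (h al - l) - (z al - Dadj l)) = 0.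
    apply: (adjoint_unique (adj Lub)) => // v Lv; have LDv := LD Lv.
    rewrite (ipBr H2)// (ipBr H2)//; last exact: LDadj.
    rewrite (ipZr H2)// (ipZr H2)//; last exact: LDadj.
    by rewrite !(adjointE (adj Lub)).
  have LT := LDadj (Lhl al).
  have := ler_nrmB mOm (L2_sqint LT) (L2_sqint (phB H2 LT Lzl)).
  by rewrite e0 addr0 subKr.
have gzU : nrm (g al - z al) @[al --> U] --> 0.
  by apply: cvg_trans gz; exact: cvg_app.
have sum0 : nrm (g al - z al) + nrm (Dadj (h al - l)) @[al --> U] --> 0.
  by rewrite -(addr0 0); exact: cvgD.
apply: (squeeze_cvgr _ (cvg_cst 0) sum0); apply: nearW => al; rewrite nrmD_ge0/=.
have -> : g al - Dadj l = (g al - z al) + (z al - Dadj l) by rewrite addrA subrK.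
apply: (@le_trans _ _ (nrm (g al - z al) + nrm (z al - Dadj l))); last by rewrite lerD2l.
by apply: ler_nrmD => //; apply: L2_sqint; apply: (phB H2) => //; exact: LDadj.
Unshelve. all: by end_near. Qed.

(** [adjoint_rate] turns a state error of order [o(alpha)] into [nrm (d alpha) = o(alpha)], so [g]
    tends to 0 in norm. *)
Lemma projection_of_zero_on_K :
  (forall e, 0 < e -> \forall alpha \near 0^'+, eta alpha <= e * alpha) ->
  {ae mu, forall x, K x -> ubar x = proj_Uad ua ub (cst 0) x}.
Proof.
move=> eo; have [C C0 dC] := adjoint_rate.
apply: (limit_on_K (at_right_proper_filter 0) _ (ph0 H2)) => //.
apply/cvgr0Pnorm_le => e e0; near=> al.
have al0 : 0 < al by near: al; exact: near_pos.
have h1 : nrm (d al) <= C * eta al by near: al.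
have h2 : eta al <= (e / (C + 1)) * al.
  by near: al; apply: eo; rewrite divr_gt0// ltr_wpDl.
rewrite ger0_norm ?nrmD_ge0// subr0 ng// ler_pdivrMl//.
apply: (le_trans h1); apply: (le_trans (ler_wpM2l C0 h2)).
rewrite mulrA mulrC ler_wpM2l ?(ltW al0)// mulrCA ler_piMr ?(ltW e0)//.
by rewrite ler_pdivrMr ?mul1r ?lerDl// ltr_wpDl.
Unshelve. all: by end_near. Qed.

End stationarity.

Theorem theorem5p2 (R : realType) (n : nat) (n_gt0 : (0 < n)%N)
    (n_le3 : (n <= 3)%N) (Om : lipschitzDomain R n)
    (a : 'I_n -> 'I_n -> 'rV[R]_n -> R) (f : 'rV[R]_n -> R -> R) (q : \bar R)
    (yd ua ub : 'rV[R]_n -> R)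
    (S : ('rV[R]_n -> R) -> 'rV[R]_n -> R)
    (dS dSadj : ('rV[R]_n -> R) -> ('rV[R]_n -> R) -> 'rV[R]_n -> R)
    (p : ('rV[R]_n -> R) -> 'rV[R]_n -> R)
    (u : R -> 'rV[R]_n -> R) (ubar : 'rV[R]_n -> R) :
  let mu := lebesgue_on Om in
  let K := [set x | domain_set Om x /\ p ubar x = 0] in
  elliptic_coefficients Om a ->
  ((n%:R / 2)%:E < q)%E -> (1 <= q)%E ->
  admissible_nonlinearity Om q f ->
  yd \in Lfun mu 2%:E -> yd \in Lfun mu q ->
  ua \in Lfun mu +oo%E -> ub \in Lfun mu +oo%E ->
  {ae mu, forall x, ua x <= ub x} ->
  control_to_state Om a f S ->
  C2_with_derivative (L2 Om) (L2norm Om) (Y Om) (Ynorm Om) S dS ->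
  (forall v h, L2 Om v -> L2 Om h ->
    weak_solution Om a (linearized f (S v)) h (dS v h)) ->
  (forall v, L2 Om v -> L2_adjoint Om (dS v) (dSadj v)) ->
  adjoint_state Om a f yd S p ->
  (forall alpha, 0 < alpha -> stationary_point Om S yd ua ub alpha (u alpha)) ->
  Uad Om ua ub ubar ->
  (forall v, L2 Om v ->
    L2inner Om (u alpha) v @[alpha --> 0^'+] --> L2inner Om ubar v) ->
  (fun alpha => L2norm Om (S (u alpha) - S ubar)) =O_ (0^'+) (fun alpha => alpha) ->
  (exists2 w, L2 Om w &
    {ae mu, forall x, K x -> ubar x = proj_Uad ua ub (dSadj ubar w) x}) /\
  ((fun alpha => L2norm Om (S (u alpha) - S ubar)) =o_ (0^'+) (fun alpha => alpha) ->
    {ae mu, forall x, K x -> ubar x = proj_Uad ua ub (cst 0) x} /\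
    ({ae mu, forall x, K x -> ua x <= 0 <= ub x} ->
     {ae mu, forall x, K x -> ubar x = 0})).
Proof.
move=> mu K ella _ q1 adm Lyd _ /Linfty_L2 Lua /Linfty_L2 Lub uab ctrl S2 dSw adj pst st.
move=> Uubar uw O1.
have SS v : L2 Om v -> weak_solution Om a f v (S v) by move=> /ctrl[].
have Lubar := Uubar.1.
have SL2 v : L2 Om v -> L2 Om (S v) by move=> /SS[/Y_L2].
(* Only [u alpha] with [0 < alpha] is controlled. *)
pose u' alpha := if 0 < alpha then u alpha else ubar.
have Lu' alpha : L2 Om (u' alpha).
  by rewrite /u'; case: ifPn => // /st[[]].
have st' alpha : 0 < alpha -> stationary_point Om S yd ua ub alpha (u' alpha).
  by move=> al0; rewrite /u' al0; exact: st.
have uE : \forall alpha \near (0 : R)^'+, u' alpha = u alpha.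
  by move: (nbhs_right_gt (0 : R)); apply: filterS => al al0; rewrite /u' al0.
have uw' v : L2 Om v -> L2inner Om (u' alpha) v @[alpha --> 0^'+] --> L2inner Om ubar v.
  move=> Lv; apply: cvg_trans (uw v Lv); apply: near_eq_cvg.
  by move: uE; apply: filterS => al ->.
have etaE e : (\forall alpha \near (0 : R)^'+,
      `|L2norm Om (S (u alpha) - S ubar)| <= e * `|alpha|) ->
    \forall alpha \near 0^'+, nrmD mu (domain_set Om) (S (u' alpha) - S ubar) <= e * alpha.
  have := nbhs_right_gt (0 : R); apply: filterS3 uE => al -> al0.
  have Lu : L2 Om (u al) by have [[]] := st al al0.
  have LS : L2 Om (S (u al) - S ubar) by apply: (phB (prehilbert_L2 Om)); exact: SL2.
  by rewrite L2normE// (gtr0_norm al0) ger0_norm ?nrmD_ge0.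
have [k k0 kO] : exists2 k : R, 0 < k & \forall alpha \near 0^'+,
    nrmD mu (domain_set Om) (S (u' alpha) - S ubar) <= k * alpha.
  move/eqOP: O1 => /(filterI (nbhs_pinfty_gt (num_real 0))) /filter_ex[k [k0 kO]].
  by exists k => //; exact: etaE.
split.
  exact: (projection_on_K n_gt0 ella q1 adm SS S2 dSw adj Lyd pst Lubar Lua Lub uab
    Lu' st' Uubar uw' k0 kO).
move=> /eqoP o1.
have P0 : {ae mu, forall x, K x -> ubar x = proj_Uad ua ub (cst 0) x}.
  apply: (projection_of_zero_on_K n_gt0 ella q1 adm SS S2 dSw adj Lyd pst Lubar Lua Lub uab
    Lu' st' Uubar uw' k0 kO).
  by move=> e e0; apply: etaE; exact: o1.
(* The projection of 0 onto [[ua x, ub x]] is 0 where this interval contains 0. *)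
split => // uab0; apply: filterS2 P0 uab0 => x h1 h2 Kx.
have /andP[a0 b0] := h2 Kx; rewrite (h1 Kx) /proj_Uad /=.
by rewrite (min_idPl b0) (max_idPr a0).
Qed.
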